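(* Let $\lambda\in\mathbb R$ be a constant, and for $t\ge0$ let $\Omega(t)$ be antisymmetric, $\Gamma(t)$ symmetric with $\operatorname{tr}\Gamma(t)=0$, both continuous and bounded, and let $D_r(t)$ be a symmetric positive definite $3\times3$ matrix, continuously differentiable in $t$, such that $D_r(t)$, $dD_r/dt$ and $D_r(t)^{-1}$ are bounded on $[0,\infty)$ (i.e. the eigenvalues of $D_r(t)$ are bounded above and bounded below by a positive constant). Let $B_0$ be symmetric positive definite with $\det B_0=1$ and $A_0=A(B_0)$. Consider the Fast Exact Closure system with anisotropic diffusion $$\frac{dA}{dt}=\tfrac12\,\mathbb C(B):\big[B\cdot(\Omega+\lambda\Gamma)+(-\Omega+\lambda\Gamma)\cdot B\big]+2D_r+3(\operatorname{tr}D_r)A-5\,\mathbb C(B):(B\cdot D_r+D_r\cdot B),$$ $$\frac{dB}{dt}=-\tfrac12\big(B\cdot(\Omega+\lambda\Gamma)+(-\Omega+\lambda\Gamma)\cdot B\big)-\mathbb D(B):\big(2D_r+3(\operatorname{tr}D_r)A\big)+5(B\cdot D_r+D_r\cdot B),$$ with $A(0)=A_0$, $B(0)=B_0$. Then this system has a solution for all $t\ge0$ which stays physical: for every $t\ge0$, $B(t)$ is symmetric positive definite and finite (no eigenvalue becomes $0$ or infinite in finite time), $\det B(t)=1$, and $A(t)=A(B(t))$ is positive definite with trace $1$.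
   Context: All matrices are real $3\times3$. For a symmetric positive definite matrix $B$ define $$A(B)=\tfrac12\int_0^\infty \frac{(B+sI)^{-1}\,ds}{\sqrt{\det(B+sI)}},\qquad \mathbb C(B)=\tfrac34\int_0^\infty\frac{\mathcal S\big((B+sI)^{-1}\otimes(B+sI)^{-1}\big)\,ds}{\sqrt{\det(B+sI)}},$$ where for a rank-4 tensor $\mathbb T$, $\mathcal S(\mathbb T)_{ijkl}$ is the average of $\mathbb T_{mnpq}$ over all permutations $(m,n,p,q)$ of $(i,j,k,l)$. For a rank-4 tensor $\mathbb T$ and a matrix $M$, $(\mathbb T:M)_{ij}=\sum_{k,l}\mathbb T_{ijkl}M_{kl}$. The linear map $M\mapsto \mathbb C(B):M$ on symmetric matrices is invertible; $\mathbb D(B)$ denotes the rank-4 tensor with $\mathbb D_{ijkl}=\mathbb D_{jikl}=\mathbb D_{ijlk}$ representing its inverse, i.e. $\mathbb C(B):\mathbb D(B):M=\mathbb D(B):\mathbb C(B):M=M$ for every symmetric $M$. Here $t$ is time along a material (Lagrangian) trajectory. *)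

(* Defs.v *)
From HB Require Import structures.
From mathcomp Require Import all_boot all_order all_algebra all_fingroup.
From mathcomp Require Import all_classical all_reals all_analysis.
Set Implicit Arguments. Unset Strict Implicit. Unset Printing Implicit Defensive.
Import Order.TTheory GRing.Theory Num.Theory.
Import numFieldNormedType.Exports.
Local Open Scope classical_set_scope.
Local Open Scope ring_scope.

Section Defs.
Variable R : realType.

Definition tensor4 := 'I_3 -> 'I_3 -> 'I_3 -> 'I_3 -> R.

Definition sym4 (T : tensor4) : tensor4 := fun i j k l =>
  let idx : 'I_4 -> 'I_3 := fun m =>
    match val m with 0%N => i | 1%N => j | 2%N => k | _ => l end in
  (24%:R)^-1 * \sum_(s : 'S_4)
      T (idx (s ord0)) (idx (s (inord 1))) (idx (s (inord 2))) (idx (s (inord 3))).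

Definition tprod (M N : 'M[R]_3) : tensor4 := fun i j k l => M i j * N k l.

Definition tcontr (T : tensor4) (M : 'M[R]_3) : 'M[R]_3 :=
  \matrix_(i, j) \sum_(k < 3) \sum_(l < 3) T i j k l * M k l.

Definition sym_mx (M : 'M[R]_3) : Prop := M^T = M.

Definition posdef (M : 'M[R]_3) : Prop :=
  sym_mx M /\ forall v : 'cV[R]_3, v != 0 -> 0 < (v^T *m M *m v) ord0 ord0.

Definition Aof (B : 'M[R]_3) : 'M[R]_3 :=
  \matrix_(i, j) (2^-1 * Rintegral (@lebesgue_measure R) `[0%R, +oo[%classic
     (fun s : R => invmx (B + s%:M) i j / Num.sqrt (\det (B + s%:M)))).

Definition Cof (B : 'M[R]_3) : tensor4 := fun i j k l =>
  3 / 4 * Rintegral (@lebesgue_measure R) `[0%R, +oo[%classic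
     (fun s : R => sym4 (tprod (invmx (B + s%:M)) (invmx (B + s%:M))) i j k l
                    / Num.sqrt (\det (B + s%:M))).

Definition is_Dof (B : 'M[R]_3) (D : tensor4) : Prop :=
  (forall i j k l, D i j k l = D j i k l) /\
  (forall i j k l, D i j k l = D i j l k) /\
  (forall M : 'M[R]_3, sym_mx M ->
     tcontr (Cof B) (tcontr D M) = M /\ tcontr D (tcontr (Cof B) M) = M).

End Defs.

(* Main.v *)
Require Import Defs.
From HB Require Import structures.
From mathcomp Require Import all_boot all_order all_algebra all_fingroup.
From mathcomp Require Import all_classical all_reals all_analysis.
From mathcomp Require Import measurable_realfun ring lra.
Set Implicit Arguments. Unset Strict Implicit. Unset Printing Implicit Defensive.
Import Order.TTheory GRing.Theory Num.Theory.
Import numFieldNormedType.Exports.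
Local Open Scope classical_set_scope.
Local Open Scope ring_scope.

(** With [E = (Omega + lam Gamma) / 2 - 5 D_r] the system reads
    [A' = C(B):(B E + E^T B) + 2 D_r + 3 (tr D_r) A] and
    [B' = - (B E + E^T B) - D(B):(2 D_r + 3 (tr D_r) A)]. Since the derivative of [A(B)] in a
    symmetric direction [H] is [- C(B):H], it suffices to solve the second equation with
    [A = A(B)].

    Local theory: on the set [K] of symmetric [B] with [m <= B] and [|B| <= M], elementary
    expansions of [(B + s)^-1] and [det (B + s)^(-1/2)], uniform in [s], show that [A] and [C] are
    Lipschitz and that [C] is coercive. The vector field is therefore Lipschitz on [K]; it is
    extended to all matrices by McShane's formula and the extension is solved globally by Picard
    iteration.

    A priori bounds: [tr A(B) = det(B)^(-1/2)] gives [(tr A - 1)' = - 2 (tr D_r) (tr A - 1)], so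
    that [tr A = 1] and [det B = 1] are preserved. For [q = tr A^-1], the matrices [A], [B] and
    [(B + s)^-1] commute and [|(B + s)^-1 B| <= 1], whence [q' <= k q - a q^2] with [a > 0]
    coming from the lower bound on [D_r]. So [q] stays bounded, and together with
    [tr (A B) <= 6] and [det B = 1] this confines [B] to a compact subset of the interior
    of [K], uniformly in time. *)

(** * Quadratic forms *)

Section QuadraticForms.
Variable R : realType.

(** The field is defined only for positive definite [B], and its Lipschitz constant degenerates at
    the boundary, so the region [K] has to be fixed before the equation is solved. This works
    because the inequality for [q] closes with constants that see only the bound on [E] and the
    lower bound on [D_r], not [m] or [M]: transport costs a term linear in [q] however
    ill-conditioned [B] is, whereas [2 D_r] contributes the quadratic [- 2 tr (P D_r P)] with
    [P = A^-1]. [K] is then taken with a margin around the set that these estimates allow, and an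
    open-closed argument in time keeps the solution inside. Antisymmetry of [Omega] and
    tracelessness of [Gamma] enter through [tr E = - 5 tr D_r], which is what conserves the trace.
    Eigenvalues are avoided throughout: the factorization [M = Z^T Z] yields trace inequalities such
    as [|v|^2 <= tr (M^-1) (v, M v)], and explicit polynomials for 3 x 3 determinants do the rest.
    The matrix norm is the largest absolute value of an entry, which accounts for the factors 3, 6
    and 9. *)

Definition qf n (M : 'M[R]_n) (v : 'cV[R]_n) : R := (v^T *m M *m v) ord0 ord0.
Definition nrm2 m n (v : 'M[R]_(m, n)) : R := \sum_i \sum_j v i j ^+ 2.

Lemma mx_entry_le m n (M : 'M[R]_(m, n)) i j : `|M i j| <= `|M|.
Proof.
rewrite [leRHS]/Num.Def.normr/= mx_normrE.
exact: (le_bigmax _ (fun ij : 'I_m * 'I_n => `|M ij.1 ij.2|) (i, j)).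
Qed.

Lemma mx_norm_le m n (M : 'M[R]_(m, n)) c :
  0 <= c -> (forall i j, `|M i j| <= c) -> `|M| <= c.
Proof.
by move=> c0 Mc; rewrite [leLHS]/Num.Def.normr/= mx_normrE; apply: bigmax_le => // -[i j] _.
Qed.

Lemma nrm2_ge0 m n (v : 'M[R]_(m, n)) : 0 <= nrm2 v.
Proof. by do 2 (apply: sumr_ge0 => ? _); rewrite sqr_ge0. Qed.

Lemma nrm2_eq0 m n (v : 'M[R]_(m, n)) : (nrm2 v == 0) = (v == 0).
Proof.
apply/eqP/eqP => [/eqP|->]; last first.
  by rewrite /nrm2 big1 // => i _; rewrite big1 // => j _; rewrite mxE expr0n.
rewrite psumr_eq0 => [/allP v0|i _]; last by apply: sumr_ge0 => ? _; rewrite sqr_ge0.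
apply/matrixP => i j; rewrite mxE; apply/eqP.
have := v0 i (mem_index_enum i); rewrite psumr_eq0 => [/allP/(_ j (mem_index_enum j))|? _].
  by rewrite /= sqrf_eq0.
by rewrite sqr_ge0.
Qed.

Lemma nrm2E n (v : 'cV[R]_n) : nrm2 v = (v^T *m v) ord0 ord0.
Proof.
rewrite mxE /nrm2; apply: eq_bigr => i _.
by rewrite big_ord_recl big_ord0 addr0 mxE expr2.
Qed.

Lemma qf1 n (v : 'cV[R]_n) : qf 1%:M v = nrm2 v.
Proof. by rewrite /qf mulmx1 nrm2E. Qed.

Lemma qfE n (M : 'M[R]_n) v : qf M v = \sum_i \sum_j v i 0 * M i j * v j 0.
Proof.
rewrite /qf mxE exchange_big /=; apply: eq_bigr => j _.
by rewrite mxE mulr_suml; apply: eq_bigr => i _; rewrite mxE.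
Qed.

Lemma qfD n (M N : 'M[R]_n) v : qf (M + N) v = qf M v + qf N v.
Proof. by rewrite /qf mulmxDr mulmxDl mxE. Qed.

Lemma qfZ n a (M : 'M[R]_n) v : qf (a *: M) v = a * qf M v.
Proof. by rewrite /qf -scalemxAr -scalemxAl mxE. Qed.

Lemma qf_scalar n a (v : 'cV[R]_n) : qf a%:M v = a * nrm2 v.
Proof. by rewrite -scalemx1 qfZ qf1. Qed.

Lemma qf_conj m n (M : 'M[R]_m) (N : 'M[R]_(m, n)) v :
  qf (N^T *m M *m N) v = qf M (N *m v).
Proof. by rewrite /qf trmx_mul !mulmxA. Qed.

Lemma qf_gram n (M : 'M[R]_n) v : qf (M^T *m M) v = nrm2 (M *m v).
Proof. by rewrite -[M^T]mulmx1 qf_conj qf1. Qed.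

(** Block elimination: the Schur complement [S] of the first diagonal entry is again positive, so
    the induction applies to it. This factorization replaces square roots and diagonalization in the
    whole file. *)
Lemma cholesky n (M : 'M[R]_n) : M^T = M ->
  (forall v, v != 0 -> 0 < qf M v) -> exists Z : 'M[R]_n, M = Z^T *m Z.
Proof.
elim: n M => [|n IH] M symM pM; first by exists M; rewrite [LHS]flatmx0 [RHS]flatmx0.
rewrite -[n.+1]/(1 + n)%N in M symM pM *.
pose a := M ord0 ord0.
pose b : 'rV_n := ursubmx M; pose C := drsubmx M.
have Ma : ulsubmx M = a%:M.
  by rewrite [LHS]mx11_scalar /a; congr (_%:M); rewrite !mxE; congr (M _ _); apply/val_inj.
have ME : M = block_mx a%:M b b^T C.
  rewrite -[LHS]submxK Ma; congr block_mx.
  by rewrite /b -[in RHS]symM trmx_ursub trmxK.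
have symC : C^T = C by rewrite /C trmx_drsub symM.
have a0 : 0 < a.
  have := pM (col_mx 1 0); rewrite [in qf M _]ME /qf tr_col_mx mul_row_block mul_row_col.
  rewrite trmx1 trmx0 !(mulmx1, mul1mx, mulmx0, mul0mx, addr0) [_%:M _ _]mxE mulr1n.
  apply; apply/eqP => /(congr1 usubmx); rewrite col_mxKu linear0 => /eqP.
  by rewrite oner_eq0.
pose S := C - a^-1 *: (b^T *m b).
have [|w w0|Z' SE] := IH S.
- by rewrite /S linearB /= linearZ /= trmx_mul trmxK symC.
(* The first coordinate minimizes the form of [M] for the given [w]; the minimum is the form of
   [S]. *)
- pose v : 'cV_(1 + n) := col_mx (- (a^-1 *: (b *m w))) w.
  have -> : qf S w = qf M v.
    have vT : (- (a^-1 *: (b *m w)))^T = - (a^-1 *: (w^T *m b^T)).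
      by rewrite -trmx_mul; apply/matrixP => i j; rewrite !mxE.
    rewrite [in qf M _]ME /v /qf tr_col_mx mul_row_block mul_row_col /S vT.
    rewrite !(mulNmx, mulmxN, mulmxDl, mulmxDr, mulmxBr, mulmxBl).
    rewrite -!(scalemxAl, scalemxAr) mul_mx_scalar -?scalemxAl -!mulmxA.
    move: (w^T *m (b^T *m (b *m w))) (w^T *m (C *m w)) => x y; rewrite !mxE.
    by field; apply: lt0r_neq0.
  apply: pM; apply: contra_neq w0.
  by move=> /(congr1 dsubmx); rewrite col_mxKd linear0.
- exists (block_mx (Num.sqrt a)%:M ((Num.sqrt a)^-1 *: b) 0 Z').
  rewrite {1}ME tr_block_mx mulmx_block !trmx0 !(mul0mx, mulmx0, addr0).
  have sa : Num.sqrt a != 0 by rewrite sqrtr_eq0 -ltNge.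
  have bT : ((Num.sqrt a)^-1 *: b)^T = (Num.sqrt a)^-1 *: b^T.
    by apply/matrixP => i j; rewrite !mxE.
  have bb : ((Num.sqrt a)^-1 *: b^T) *m ((Num.sqrt a)^-1 *: b) = a^-1 *: (b^T *m b).
    by rewrite -scalemxAl -scalemxAr scalerA -expr2 exprVn sqr_sqrtr ?ltW.
  rewrite tr_scalar_mx bT bb -SE /S addrC subrK -scalar_mxM -expr2 sqr_sqrtr ?ltW//.
  by rewrite mul_scalar_mx mul_mx_scalar !scalerA mulfV// !scale1r.
Qed.

End QuadraticForms.

(** * Positive definite 3 x 3 matrices *)

Local Notation i0 := (@ord0 2).
Local Notation i1 := (lift (@ord0 2) (@ord0 1)).
Local Notation i2 := (lift (@ord0 2) (lift (@ord0 1) (@ord0 0))).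

Section Det3.
Variable R : realType.
Implicit Types M N : 'M[R]_3.

Lemma sum3E (V : nmodType) (F : 'I_3 -> V) : \sum_i F i = F i0 + F i1 + F i2.
Proof. by rewrite !big_ord_recl big_ord0 addr0 addrA. Qed.

Lemma det3E M : \det M =
  M i0 i0 * (M i1 i1 * M i2 i2 - M i1 i2 * M i2 i1)
  - M i0 i1 * (M i1 i0 * M i2 i2 - M i1 i2 * M i2 i0)
  + M i0 i2 * (M i1 i0 * M i2 i1 - M i1 i1 * M i2 i0).
Proof.
rewrite (expand_det_row _ ord0) !big_ord_recl big_ord0 /cofactor.
rewrite !(expand_det_row _ ord0) !big_ord_recl !big_ord0 /cofactor !det_mx11 !mxE /=.
have -> : lift i1 (@ord0 1) = i0 by apply/val_inj.
have -> : lift i2 (@ord0 1) = i0 by apply/val_inj.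
have -> : lift i1 (lift (@ord0 1) (@ord0 0)) = i2 by apply/val_inj.
have -> : lift i2 (lift (@ord0 1) (@ord0 0)) = i1 by apply/val_inj.
have -> : lift (lift (@ord0 1) (@ord0 0)) (@ord0 0) = ord0 by apply/val_inj.
have -> : lift i1 (@ord0 1) = i0 by apply/val_inj.
have -> : lift i2 (@ord0 1) = i0 by apply/val_inj.
rewrite /bump /=; ring.
Qed.

Lemma norm_mulmx3 M N : `|M *m N| <= 3 * `|M| * `|N|.
Proof.
apply: mx_norm_le => [|i j]; first by rewrite !mulr_ge0.
rewrite mxE (le_trans (ler_norm_sum _ _ _))//.
have h k : `|M i k * N k j| <= `|M| * `|N|.
  by rewrite normrM ler_pM// mx_entry_le.
apply: le_trans (ler_sum _ (fun k _ => h k)) _.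
by rewrite sum3E; lra.
Qed.

Lemma norm_tr3 M : `|\tr M| <= 3 * `|M|.
Proof.
rewrite (le_trans (ler_norm_sum _ _ _))//.
apply: le_trans (ler_sum _ (fun k _ => mx_entry_le M k k)) _.
by rewrite sum3E; lra.
Qed.

Lemma norm_trmx m n (M : 'M[R]_(m, n)) : `|M^T| = `|M|.
Proof.
have h p q (A : 'M[R]_(p, q)) : `|A^T| <= `|A|.
  by apply: mx_norm_le => // i j; rewrite mxE mx_entry_le.
by apply/eqP; rewrite eq_le h/= -[X in `|X| <= _]trmxK h.
Qed.

Lemma det3_le M : `|\det M| <= 6 * `|M| ^+ 3.
Proof.
have h i j k l p q : `|M i j * (M k l * M p q)| <= `|M| ^+ 3.
  by rewrite !normrM exprS expr2 !ler_pM ?mulr_ge0 ?mx_entry_le.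
rewrite det3E !mulrBr.
have hh := (h i0 i0 i1 i1 i2 i2, h i0 i0 i1 i2 i2 i1, h i0 i1 i1 i0 i2 i2,
  h i0 i1 i1 i2 i2 i0, h i0 i2 i1 i0 i2 i1, h i0 i2 i1 i1 i2 i0).
move: hh; rewrite !ler_norml.
by move=> [[[[[]]]]] /andP[? ?] /andP[? ?] /andP[? ?] /andP[? ?] /andP[? ?] /andP[? ?]; lra.
Qed.

(** After the trace, the remainder consists of six products of two entries and six products of
    three. *)
Lemma det3_expand N :
  `|\det (1%:M + N) - 1 - \tr N| <= 6 * `|N| ^+ 2 + 6 * `|N| ^+ 3.
Proof.
have h1 i j k l p q : `|N i j * (N k l * N p q)| <= `|N| ^+ 3.
  by rewrite !normrM exprS expr2 !ler_pM ?mulr_ge0 ?mx_entry_le.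
have h2 i j k l : `|N i j * N k l| <= `|N| ^+ 2.
  by rewrite !normrM expr2 !ler_pM ?mulr_ge0 ?mx_entry_le.
rewrite det3E /mxtrace sum3E !mxE /=.
rewrite [X in `|X|](_ : _ =
    (N i0 i0 * N i1 i1 - N i0 i1 * N i1 i0 + N i0 i0 * N i2 i2 - N i0 i2 * N i2 i0
     + N i1 i1 * N i2 i2 - N i1 i2 * N i2 i1)
  + (N i0 i0 * (N i1 i1 * N i2 i2) - N i0 i0 * (N i1 i2 * N i2 i1)
     - N i0 i1 * (N i1 i0 * N i2 i2) + N i0 i1 * (N i1 i2 * N i2 i0)
     + N i0 i2 * (N i1 i0 * N i2 i1) - N i0 i2 * (N i1 i1 * N i2 i0))); last by ring.
have hh := (h1 i0 i0 i1 i1 i2 i2, h1 i0 i0 i1 i2 i2 i1, h1 i0 i1 i1 i0 i2 i2,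
  h1 i0 i1 i1 i2 i2 i0, h1 i0 i2 i1 i0 i2 i1, h1 i0 i2 i1 i1 i2 i0).
have hk := (h2 i0 i0 i1 i1, h2 i0 i1 i1 i0, h2 i0 i0 i2 i2, h2 i0 i2 i2 i0,
  h2 i1 i1 i2 i2, h2 i1 i2 i2 i1).
move: hh hk; rewrite !ler_norml.
move=> [[[[[]]]]] /andP[? ?] /andP[? ?] /andP[? ?] /andP[? ?] /andP[? ?] /andP[? ?].
by move=> [[[[[]]]]] /andP[? ?] /andP[? ?] /andP[? ?] /andP[? ?] /andP[? ?] /andP[? ?]; lra.
Qed.

(** The characteristic polynomial, with [\tr (\adj B)] as its second elementary symmetric function.
    It bounds [det (B + s)] below when [det B = 1], and at [s = 1] it recovers [tr B^-1] from
    [det (B + 1)]. *)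
Lemma det3_shift (B : 'M[R]_3) s :
  \det (B + s%:M) = \det B + s * \tr (\adj B) + s ^+ 2 * \tr B + s ^+ 3.
Proof.
have -> : \tr (\adj B) = B i0 i0 * B i1 i1 - B i0 i1 * B i1 i0 + (B i0 i0 * B i2 i2 - B i0 i2 * B
  i2 i0)
     + (B i1 i1 * B i2 i2 - B i1 i2 * B i2 i1).
  rewrite /mxtrace sum3E ![\adj B _ _]mxE /cofactor !(expand_det_row _ ord0) !big_ord_recl
    !big_ord0.
  rewrite /cofactor !det_mx11 !mxE /=.
  have -> : lift i1 (@ord0 1) = i0 by apply/val_inj.
  have -> : lift i2 (@ord0 1) = i0 by apply/val_inj.
  have -> : lift i1 (lift (@ord0 1) (@ord0 0)) = i2 by apply/val_inj.
  have -> : lift i2 (lift (@ord0 1) (@ord0 0)) = i1 by apply/val_inj.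
  have -> : lift (lift (@ord0 1) (@ord0 0)) (@ord0 0) = ord0 by apply/val_inj.
  have -> : lift i1 (@ord0 1) = i0 by apply/val_inj.
  have -> : lift i2 (@ord0 1) = i0 by apply/val_inj.
  rewrite /bump /=; ring.
by rewrite !det3E /mxtrace sum3E !mxE /=; ring.
Qed.

End Det3.

Section PosDef.
Variable R : realType.
Implicit Types M N Y Z B H P : 'M[R]_3.

Lemma posdef_unit M : posdef M -> M \in unitmx.
Proof.
move=> [_ pM]; rewrite unitmxE unitfE; apply/negP => /det0P[v v0 vM].
have vT0 : v^T != 0 by apply: contra_neq v0 => /(congr1 trmx); rewrite trmxK trmx0.
by have := pM _ vT0; rewrite trmxK vM mul0mx mxE ltxx.
Qed.

Lemma posdef_gram M : posdef M -> exists2 Z, Z \in unitmx & M = Z^T *m Z.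
Proof.
move=> pM; have [Z ZE] := cholesky pM.1 pM.2; exists Z => //.
by have := posdef_unit pM; rewrite {1}ZE unitmx_mul => /andP[].
Qed.

Lemma posdef_det_gt0 M : posdef M -> 0 < \det M.
Proof.
move=> /posdef_gram[Z Zu ->]; rewrite det_mulmx det_tr -expr2 exprn_even_gt0//=.
by move: Zu; rewrite unitmxE unitfE.
Qed.

Lemma qf_inv M v : sym_mx M -> M \in unitmx -> qf (invmx M) v = qf M (invmx M *m v).
Proof. by move=> sM uM; rewrite -qf_conj trmx_inv sM mulVmx// mul1mx. Qed.

Lemma sym_inv M : sym_mx M -> sym_mx (invmx M).
Proof. by move=> sM; rewrite /sym_mx trmx_inv sM. Qed.

Lemma posdef_inv M : posdef M -> posdef (invmx M).
Proof.
move=> pM; have uM := posdef_unit pM; split=> [|v v0]; first exact: sym_inv pM.1.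
rewrite -/(qf _ _) qf_inv//; last exact: pM.1.
apply: pM.2; apply: contra_neq v0 => h.
by rewrite -[v]mul1mx -(mulmxV uM) -mulmxA h mulmx0.
Qed.

Definition psd P := sym_mx P /\ forall v, 0 <= qf P v.

Lemma posdef_psd M : posdef M -> psd M.
Proof.
move=> [sM pM]; split=> // v; have [->|/pM/ltW//] := eqVneq v 0.
by rewrite /qf mulmx0 mxE.
Qed.

Lemma psd_diag P i : psd P -> 0 <= P i i.
Proof.
move=> [_ /(_ (delta_mx i 0))]; rewrite /qf trmx_delta -rowE -colE !mxE.
by [].
Qed.

(** The form is evaluated at the two vectors [delta_i + delta_j] and [delta_i - delta_j]. *)
Lemma psd_entry P i j : psd P -> `|P i j| <= (P i i + P j j) / 2.
Proof.
move=> [sP pP].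
have Pji : P j i = P i j by rewrite -{1}sP mxE.
have h (e : R) : e ^+ 2 = 1 -> 0 <= P i i + P j j + 2 * e * P i j.
  move=> e2; have := pP (delta_mx i 0 + e *: delta_mx j 0).
  have -> : qf P (delta_mx i 0 + e *: delta_mx j 0) =
      (((delta_mx 0 i + e *: delta_mx 0 j) : 'rV[R]_3) *m P *m
        ((delta_mx i 0 + e *: delta_mx j 0) : 'cV[R]_3)) 0 0.
    rewrite /qf; congr ((_ *m _ *m _) _ _).
    by apply/matrixP => a b; rewrite !mxE andbC [in X in _ + _ * X]andbC.
  rewrite mulmxDl mulmxDr !mulmxDl.
  rewrite -!scalemxAl -!scalemxAr -!rowE -!colE -?scalemxAl -?scalemxAr -?rowE -?colE.
  rewrite !mxE Pji => h.
  suff <- : P i i + e * P i j + (e * P i j + e * (e * P j j)) = P i i + P j j + 2 * e * P i j by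
    rewrite addrA in h *; lra.
  by ring: e2.
have h1 := h 1 (expr1n _ _); have h2 := h (-1) (sqrr_sign _ 1).
by rewrite ler_norml; apply/andP; split; lra.
Qed.

Lemma psd_tr P : psd P -> 0 <= \tr P.
Proof. by move=> pP; apply: sumr_ge0 => i _; exact: psd_diag. Qed.

Lemma psd_entry_tr P i j : psd P -> `|P i j| <= \tr P.
Proof.
move=> pP; apply: le_trans (psd_entry i j pP) _.
have h k : P k k <= \tr P.
  by rewrite /mxtrace (bigD1 k)//= lerDl sumr_ge0// => l _; exact: psd_diag.
by have := h i; have := h j; lra.
Qed.

(** The Loewner inequality [mu I <= Y], symmetry included. *)
Definition geI (mu : R) Y := sym_mx Y /\ forall v, mu * nrm2 v <= qf Y v.

Lemma geI_posdef mu Y : 0 < mu -> geI mu Y -> posdef Y.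
Proof.
move=> mu0 [sY Yge]; split=> // v v0; apply: lt_le_trans (Yge v).
by rewrite mulr_gt0// lt_def nrm2_ge0 nrm2_eq0 v0.
Qed.

(** With [Z = Y - mu >= 0] and [v = Y w], the expansion [Y^2 = Z^2 + mu Z + mu Y] gives
    [|v|^2 >= mu (w, Y w)]. *)
Lemma geI_inv_le mu Y v : 0 < mu -> geI mu Y -> qf (invmx Y) v <= mu^-1 * nrm2 v.
Proof.
move=> mu0 gY; have uY := posdef_unit (geI_posdef mu0 gY).
have [sY hY] := gY.
rewrite qf_inv//; set w := invmx Y *m v.
have -> : v = Y *m w by rewrite /w mulmxA mulmxV// mul1mx.
rewrite -ler_pdivrMl ?invr_gt0// invrK.
pose Z := Y - mu%:M.
have YE : Y = Z + mu%:M by rewrite subrK.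
have sZ : Z^T = Z by rewrite /Z linearB /= sY tr_scalar_mx.
have Z0 : 0 <= qf Z w.
  by rewrite -(lerD2r (mu * nrm2 w)) add0r -{2}qf_scalar -qfD -YE.
have -> : nrm2 (Y *m w) = nrm2 (Z *m w) + mu * qf Z w + mu * qf Y w.
  rewrite -!qf_gram sY sZ -!qfZ -!qfD; congr qf.
  by rewrite {1}YE mulmxDl mul_scalar_mx [in Z *m Y]YE mulmxDr mul_mx_scalar.
by have := mulr_ge0 (ltW mu0) Z0; have := nrm2_ge0 (Z *m w); lra.
Qed.

Lemma nrm2_delta (i : 'I_3) : nrm2 (delta_mx i 0 : 'cV[R]_3) = 1.
Proof. by rewrite -qf1 /qf trmx_delta -rowE -colE !mxE eqxx. Qed.

Lemma geI_inv_norm mu Y : 0 < mu -> geI mu Y -> `|invmx Y| <= mu^-1.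
Proof.
move=> mu0 gY; have pX := posdef_psd (posdef_inv (geI_posdef mu0 gY)).
have hd i : invmx Y i i <= mu^-1.
  have := geI_inv_le (delta_mx i 0) mu0 gY.
  by rewrite nrm2_delta mulr1 /qf trmx_delta -rowE -colE !mxE.
apply: mx_norm_le => [|i j]; first by rewrite invr_ge0 ltW.
by apply: le_trans (psd_entry i j pX) _; have := hd i; have := hd j; lra.
Qed.

(** The upper bound [det3_le] applied to the inverse; hence the factor 6. *)
Lemma geI_det mu Y : 0 < mu -> geI mu Y -> mu ^+ 3 / 6 <= \det Y.
Proof.
move=> mu0 gY; have pY := geI_posdef mu0 gY; have d0 := posdef_det_gt0 pY.
have := det3_le (invmx Y); rewrite det_inv ger0_norm ?invr_ge0 ?(ltW d0)//.
have h : `|invmx Y| ^+ 3 <= mu^-1 ^+ 3.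
  by rewrite lerXn2r ?nnegrE ?invr_ge0 ?(ltW mu0)//; exact: geI_inv_norm.
move=> hd; have {}hd : (\det Y)^-1 <= 6 * mu^-1 ^+ 3 by apply: le_trans hd _; rewrite ler_pM2l.
rewrite -[leRHS]invrK -[leLHS]invrK lef_pV2 ?posrE ?invr_gt0 ?divr_gt0 ?exprn_gt0//.
by rewrite invf_div -exprVn.
Qed.

Lemma geI_shift mu s B : geI mu B -> geI (mu + s) (B + s%:M).
Proof.
move=> [sB hB]; split=> [|v]; first by rewrite /sym_mx linearD /= sB tr_scalar_mx.
by rewrite qfD qf_scalar mulrDl lerD2r.
Qed.

Lemma geI_le mu nu B : nu <= mu -> geI mu B -> geI nu B.
Proof.
by move=> h [sB hB]; split=> // v; apply: le_trans (hB v); rewrite ler_wpM2r ?nrm2_ge0.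
Qed.

Lemma nrm2_mul_le Z (v : 'cV[R]_3) : nrm2 (Z *m v) <= nrm2 Z * nrm2 v.
Proof.
rewrite /nrm2 mulr_suml; apply: ler_sum => i _.
rewrite !sum3E !big_ord_recl !big_ord0 !addr0 !mxE sum3E.
set a := Z i _; set b := Z i _; set c := Z i _; set x := v _ _; set y := v _ _; set z := v _ _.
(* Lagrange's identity, which proves Cauchy-Schwarz row by row. *)
rewrite -subr_ge0 [leRHS](_ : _ = (a * y - b * x) ^+ 2 + (a * z - c * x) ^+ 2 + (b * z - c * y) ^+
  2); last by ring.
by rewrite !addr_ge0 ?sqr_ge0.
Qed.

Lemma nrm2_tr Z : nrm2 Z = \tr (Z^T *m Z).
Proof.
rewrite /nrm2 exchange_big /=; apply: eq_bigr => i _; rewrite mxE; apply: eq_bigr => j _.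
by rewrite mxE expr2.
Qed.

(** For [M = Z^T Z] one has [v = Z^-1 (Z v)] and [tr M^-1] is the squared Frobenius norm of [Z^-1].
    This serves as the lower eigenvalue bound wherever one is needed. *)
Lemma posdef_lower M v : posdef M -> nrm2 v <= \tr (invmx M) * qf M v.
Proof.
move=> /posdef_gram[Z Zu ->]; rewrite qf_gram.
have -> : \tr (invmx (Z^T *m Z)) = nrm2 (invmx Z).
  rewrite nrm2_tr mxtrace_mulC; congr (\tr _).
  have zz : Z^T *m Z \in unitmx by rewrite unitmx_mul unitmx_tr Zu.
  apply: (can_inj (mulKmx zz)); rewrite mulmxV// trmx_inv.
  by rewrite mulmxA -(mulmxA Z^T) mulmxV// mulmx1 mulmxV// unitmx_tr.
by rewrite -{1}[v](mulKmx Zu) nrm2_mul_le.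
Qed.

Lemma posdef_geI M : posdef M -> exists2 mu, 0 < mu & geI mu M.
Proof.
move=> pM; have t0 : 0 < \tr (invmx M).
  have h := posdef_inv pM; rewrite /mxtrace sum3E.
  have hi i : 0 < invmx M i i.
    have := h.2 (delta_mx i 0); rewrite trmx_delta -rowE -colE !mxE; apply.
    by rewrite -nrm2_eq0 nrm2_delta oner_eq0.
  by rewrite !addr_gt0.
exists (\tr (invmx M))^-1; first by rewrite invr_gt0.
split=> [|v]; first exact: pM.1.
by rewrite ler_pdivrMl//; exact: posdef_lower.
Qed.

End PosDef.

(** * Expansions of the inverse and of the inverse root of the determinant *)

Section Expansion.
Variable R : realType.
Implicit Types Y H X : 'M[R]_3.

Lemma mxDE m n (M N : 'M[R]_(m, n)) i j : (M + N) i j = M i j + N i j.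
Proof. by rewrite mxE. Qed.

Lemma mxBE m n (M N : 'M[R]_(m, n)) i j : (M - N) i j = M i j - N i j.
Proof. by rewrite !mxE. Qed.

Definition rdet Y : R := (Num.sqrt (\det Y))^-1.

Definition aent Y i j : R := invmx Y i j * rdet Y.

(** For symmetric [Y], three times the symmetrization of [Y^-1 (x) Y^-1], weighted by [det^(-1/2)]:
    the 24 permutations fall into these three pairings. *)
Definition cent Y i j k l : R := let X := invmx Y in
  (X i j * X k l + X i k * X j l + X i l * X j k) * rdet Y.

Lemma rdet_gt0 Y : posdef Y -> 0 < rdet Y.
Proof. by move=> pY; rewrite invr_gt0 sqrtr_gt0 posdef_det_gt0. Qed.

Lemma inv_diff Y1 Y2 : Y1 \in unitmx -> Y2 \in unitmx ->
  invmx Y2 - invmx Y1 = - (invmx Y1 *m (Y2 - Y1) *m invmx Y2).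
Proof.
move=> u1 u2; rewrite mulmxBr mulmxBl mulVmx// mul1mx -mulmxA mulmxV// mulmx1.
by rewrite opprB.
Qed.

(* With [w = r1 / r2] both bounds are polynomial inequalities in [w], since [p = w ^+ 2 - 1]. *)
Lemma rdet_diff Y1 Y2 : posdef Y1 -> posdef Y2 ->
  let p := \det (1%:M + invmx Y1 *m (Y2 - Y1)) - 1 in
  `|rdet Y2 - rdet Y1| <= rdet Y2 * `|p| /\
  `|rdet Y2 - rdet Y1 + rdet Y1 * p / 2| <= rdet Y2 * p ^+ 2.
Proof.
move=> p1 p2 p; have d1 := posdef_det_gt0 p1; have d2 := posdef_det_gt0 p2.
have u1 := posdef_unit p1.
pose s1 := Num.sqrt (\det Y1); pose s2 := Num.sqrt (\det Y2); pose w := s2 / s1.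
have s10 : 0 < s1 by rewrite sqrtr_gt0. 
have s20 : 0 < s2 by rewrite sqrtr_gt0.
have w0 : 0 < w by rewrite divr_gt0.
have pE : p = w ^+ 2 - 1.
  rewrite /p mulmxBr mulVmx// addrCA subrr addr0 det_mulmx det_inv /w expr_div_n !sqr_sqrtr ?ltW//.
  by rewrite mulrC.
have r1E : rdet Y1 = rdet Y2 * w.
  by rewrite /rdet -/s1 -/s2 /w; field; rewrite !gt_eqF.
have r20 := rdet_gt0 p2.
rewrite r1E pE; split.
- rewrite -{1}[rdet Y2]mulr1 -mulrBr normrM gtr0_norm// ler_pM2l//.
  rewrite (_ : w ^+ 2 - 1 = (1 - w) * - (1 + w)); last by ring.
  rewrite normrM normrN ler_peMr//.
  by rewrite ger0_norm ?addr_ge0 ?(ltW w0)// lerDl ltW.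
- rewrite (_ : rdet Y2 - _ + _ = rdet Y2 * ((w - 1) ^+ 2 * ((w + 2) / 2))); last by field.
  rewrite normrM gtr0_norm// ler_pM2l// ger0_norm; last first.
    by rewrite mulr_ge0 ?sqr_ge0//; lra.
  rewrite (_ : (w ^+ 2 - 1) ^+ 2 = (w - 1) ^+ 2 * (w + 1) ^+ 2); last by ring.
  by rewrite ler_wpM2l ?sqr_ge0//; nra.
Qed.

Section Bounds.
Variables (x h0 : R).
Hypothesis x0 : 0 <= x.
Hypothesis h00 : 0 <= h0.

(** Put [N = Y1^-1 H], so that [|N| <= 3 x |H|]. In [det3_expand] this gives 54 = 6 * 9 and 162 = 6
    * 27, whence [k2] for the second-order remainder; the 9 in [k1] comes from the trace. All bounds
    below keep the factors [r1], [r2] explicit, because these carry the decay in [s] needed for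
    integration. *)
Let k1 := 9 + 54 * (x * h0) + 162 * (x * h0) ^+ 2.
Let k2 := 54 + 162 * (x * h0).

Variables (Y1 Y2 : 'M[R]_3).
Hypotheses (p1 : posdef Y1) (p2 : posdef Y2).
Hypotheses (X1x : `|invmx Y1| <= x) (X2x : `|invmx Y2| <= x).
Let H := Y2 - Y1.
Hypothesis Hh : `|H| <= h0.

Let N0 : `|invmx Y1 *m H| <= 3 * x * `|H|.
Proof. by apply: le_trans (norm_mulmx3 _ _) _; rewrite ler_wpM2r// ler_wpM2l. Qed.

Let p := \det (1%:M + invmx Y1 *m H) - 1.

Let p_tr : `|p - \tr (invmx Y1 *m H)| <= k2 * x ^+ 2 * `|H| ^+ 2.
Proof.
apply: le_trans (det3_expand _) _.
have := N0; move: `|invmx Y1 *m H| (normr_ge0 (invmx Y1 *m H)) => n n0 nh.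
have n2 : n ^+ 2 <= (3 * x * `|H|) ^+ 2 by rewrite lerXn2r ?nnegrE ?mulr_ge0.
have n3 : n ^+ 3 <= (3 * x * `|H|) ^+ 3 by rewrite lerXn2r ?nnegrE ?mulr_ge0.
have e : (3 * x * `|H|) ^+ 3 <= 27 * x ^+ 3 * `|H| ^+ 2 * h0.
  rewrite (_ : (3 * x * `|H|) ^+ 3 = 27 * x ^+ 3 * `|H| ^+ 2 * `|H|); last by ring.
  by rewrite ler_wpM2l ?mulr_ge0 ?exprn_ge0.
rewrite (_ : k2 * _ * _ = 6 * (3 * x * `|H|) ^+ 2 + 6 * (27 * x ^+ 3 * `|H| ^+ 2 * h0)); last by
  rewrite /k2; ring.
by lra.
Qed.

Let p_le : `|p| <= k1 * x * `|H|.
Proof.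
have t := norm_tr3 (invmx Y1 *m H).
have -> : p = (p - \tr (invmx Y1 *m H)) + \tr (invmx Y1 *m H) by rewrite subrK.
apply: le_trans (ler_normD _ _) _.
have e : x ^+ 2 * `|H| ^+ 2 <= x * (x * h0) * `|H|.
  rewrite (_ : x ^+ 2 * `|H| ^+ 2 = x ^+ 2 * `|H| * `|H|); last by ring.
  rewrite (_ : x * (x * h0) * `|H| = x ^+ 2 * `|H| * h0); last by ring.
  by rewrite ler_wpM2l ?mulr_ge0 ?exprn_ge0.
have k20 : 0 <= k2 by rewrite addr_ge0// !mulr_ge0.
have e2 := ler_wpM2l k20 e.
rewrite (_ : k1 * x * `|H| = k2 * (x * (x * h0) * `|H|) + 9 * x * `|H|); last by rewrite /k1 /k2;
  ring.
by have := p_tr; have := N0; lra.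
Qed.

Let Xd : `|invmx Y2 - invmx Y1| <= 9 * x ^+ 2 * `|H|.
Proof.
rewrite inv_diff ?posdef_unit// normrN.
apply: le_trans (norm_mulmx3 _ _) _.
rewrite (_ : 9 * x ^+ 2 * `|H| = 3 * (3 * x * `|H|) * x); last by ring.
by rewrite ler_pM ?mulr_ge0// ler_pM2l.
Qed.

(** The identity [inv_diff] turns the left side into [X1 H (X1 - X2)], to which the first-order
    bound applies. *)
Lemma inv_quad : `|invmx Y2 - invmx Y1 + invmx Y1 *m H *m invmx Y1| <= 81 * x ^+ 3 * `|H| ^+ 2.
Proof.
rewrite inv_diff ?posdef_unit// -/H addrC -mulmxBr -normrN -mulmxN opprB.
apply: le_trans (norm_mulmx3 _ _) _.
rewrite (_ : 81 * _ * _ = 3 * (3 * x * `|H|) * (9 * x ^+ 2 * `|H|)); last by ring.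
by rewrite ler_pM ?mulr_ge0// ler_pM2l.
Qed.

Let r2 := rdet Y2.
Let r1 := rdet Y1.
Let r20 : 0 <= r2. Proof. exact/ltW/rdet_gt0. Qed.
Let r10 : 0 <= r1. Proof. exact/ltW/rdet_gt0. Qed.

Lemma rdet_lip : `|r2 - r1| <= k1 * x * `|H| * r2.
Proof.
have [h _] := rdet_diff p1 p2; apply: le_trans h _.
by rewrite mulrC ler_wpM2r.
Qed.

(** The derivative of [det^(-1/2)] is [- det^(-1/2) tr (Y^-1 H) / 2]: [rdet_diff] expands in [p],
    and [p_tr] replaces [p] by the trace. *)
Lemma rdet_quad : `|r2 - r1 + r1 * \tr (invmx Y1 *m H) / 2| <=
  (k1 ^+ 2 + k2) * x ^+ 2 * `|H| ^+ 2 * (r1 + r2).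
Proof.
have [_ h] := rdet_diff p1 p2; rewrite -/r1 -/r2 -/H -/p in h.
rewrite (_ : r2 - r1 + _ = (r2 - r1 + r1 * p / 2) - r1 / 2 * (p - \tr (invmx Y1 *m H))); last by
  field.
apply: le_trans (ler_normB _ _) _.
have h2 : p ^+ 2 <= (k1 * x * `|H|) ^+ 2 by rewrite -[p ^+ 2]real_normK ?num_real// lerXn2r
  ?nnegrE// (le_trans _ p_le).
have h3 : `|r1 / 2 * (p - \tr (invmx Y1 *m H))| <= r1 / 2 * (k2 * x ^+ 2 * `|H| ^+ 2).
  by rewrite normrM ger0_norm ?divr_ge0// ler_wpM2l ?divr_ge0.
have h4 := ler_wpM2l r20 h2.
have k20 : 0 <= k2 by rewrite addr_ge0// !mulr_ge0.
have h5 : 0 <= r1 * ((k1 * x * `|H|) ^+ 2) by rewrite mulr_ge0 ?sqr_ge0.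
have h6 : 0 <= r2 * (k2 * x ^+ 2 * `|H| ^+ 2) by rewrite !mulr_ge0 ?sqr_ge0.
have h7 : 0 <= r1 * (k2 * x ^+ 2 * `|H| ^+ 2) by rewrite !mulr_ge0 ?sqr_ge0.
rewrite (_ : (k1 ^+ 2 + k2) * _ * _ * _ = r1 * (k1 * x * `|H|) ^+ 2 + r2 * (k1 * x * `|H|) ^+ 2
  + r1 * (k2 * x ^+ 2 * `|H| ^+ 2) + r2 * (k2 * x ^+ 2 * `|H| ^+ 2)); last by ring.
by lra.
Qed.

Let prod2 i j k l :
  `|invmx Y2 i j * invmx Y2 k l * r2 - invmx Y1 i j * invmx Y1 k l * r1|
  <= (18 * x ^+ 3 + k1 * x ^+ 3) * `|H| * r2.
Proof.
set a2 := invmx Y2 i j; set b2 := invmx Y2 k l; set a1 := invmx Y1 i j; set b1 := invmx Y1 k l.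
have a2x : `|a2| <= x := le_trans (mx_entry_le _ _ _) X2x.
have b2x : `|b2| <= x := le_trans (mx_entry_le _ _ _) X2x.
have a1x : `|a1| <= x := le_trans (mx_entry_le _ _ _) X1x.
have b1x : `|b1| <= x := le_trans (mx_entry_le _ _ _) X1x.
have ad : `|a2 - a1| <= 9 * x ^+ 2 * `|H|.
  by apply: le_trans Xd; have := mx_entry_le (invmx Y2 - invmx Y1) i j; rewrite !mxE.
have bd : `|b2 - b1| <= 9 * x ^+ 2 * `|H|.
  by apply: le_trans Xd; have := mx_entry_le (invmx Y2 - invmx Y1) k l; rewrite !mxE.
rewrite (_ : a2 * b2 * r2 - _ = (a2 - a1) * b2 * r2 + a1 * (b2 - b1) * r2 + a1 * b1 * (r2 - r1));
  last by ring.
rewrite (_ : _ * r2 = 9 * x ^+ 2 * `|H| * x * r2 + x * (9 * x ^+ 2 * `|H|) * r2 + x * x * (k1 * x *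
  `|H| * r2)); last by ring.
apply: le_trans (ler_normD _ _) _; apply: lerD.
  apply: le_trans (ler_normD _ _) _; rewrite !normrM (ger0_norm r20).
  by apply: lerD; rewrite ler_wpM2r// ler_pM.
by rewrite !normrM ler_pM ?mulr_ge0// ?ler_pM// rdet_lip.
Qed.

Lemma cent_lip i j k l : `|cent Y2 i j k l - cent Y1 i j k l| <=
  3 * (18 * x ^+ 3 + k1 * x ^+ 3) * `|H| * r2.
Proof.
pose c := (18 * x ^+ 3 + k1 * x ^+ 3) * `|H| * r2.
rewrite [leRHS](_ : _ = c + c + c); last by rewrite /c; ring.
rewrite /cent -/r1 -/r2 !mulrDl opprD addrACA.
apply: le_trans (ler_normD _ _) _; apply: lerD; last exact: prod2.
rewrite opprD addrACA.
by apply: le_trans (ler_normD _ _) _; apply: lerD; exact: prod2.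
Qed.

Lemma aent_lip i j : `|aent Y2 i j - aent Y1 i j| <= (9 * x ^+ 2 + k1 * x ^+ 2) * `|H| * r2.
Proof.
rewrite /aent -/r1 -/r2; set a2 := invmx Y2 i j; set a1 := invmx Y1 i j.
have a1x : `|a1| <= x := le_trans (mx_entry_le _ _ _) X1x.
have ad : `|a2 - a1| <= 9 * x ^+ 2 * `|H|.
  by apply: le_trans Xd; have := mx_entry_le (invmx Y2 - invmx Y1) i j; rewrite !mxE.
rewrite (_ : a2 * r2 - _ = (a2 - a1) * r2 + a1 * (r2 - r1)); last by ring.
rewrite (_ : _ * r2 = 9 * x ^+ 2 * `|H| * r2 + x * (k1 * x * `|H| * r2)); last by ring.
apply: le_trans (ler_normD _ _) _; rewrite !normrM (ger0_norm r20).
by apply: lerD; [rewrite ler_wpM2r|rewrite ler_pM// rdet_lip].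
Qed.

(** With [X = Y^-1], the pairing [X_ij X_kl] yields the trace term, and the two mixed pairings both
    yield [X G X] because [X] and [G] are symmetric. Every later estimate on [C(B)] starts from this
    matrix form. *)
Lemma cent_contract Y G i j : sym_mx Y -> sym_mx G ->
  \sum_k \sum_l cent Y i j k l * G k l =
  (invmx Y i j * \tr (invmx Y *m G) + 2 * (invmx Y *m G *m invmx Y) i j) * rdet Y.
Proof.
move=> /sym_inv; rewrite /cent; move: (invmx Y) (rdet Y) => X r sX sG.
have G10 : G i1 i0 = G i0 i1 by rewrite -{1}sG mxE.
have G20 : G i2 i0 = G i0 i2 by rewrite -{1}sG mxE.
have G21 : G i2 i1 = G i1 i2 by rewrite -{1}sG mxE.
have X10 : X i1 i0 = X i0 i1 by rewrite -{1}sX mxE.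
have X20 : X i2 i0 = X i0 i2 by rewrite -{1}sX mxE.
have X21 : X i2 i1 = X i1 i2 by rewrite -{1}sX mxE.
have Xj k : X k j = X j k by rewrite -{1}sX mxE.
rewrite /mxtrace !sum3E !mxE !sum3E !mxE !sum3E !Xj !G10 !G20 !G21 ?X10 ?X20 ?X21; ring.
Qed.

(** The pointwise version of [A'(B) H = - C(B):H]; the factor [2^-1] here and the one in front of
    [A] together give the [4^-1] of [CofE]. *)
Lemma aent_quad i j :
  `|aent Y2 i j - aent Y1 i j + 2^-1 * \sum_k \sum_l cent Y1 i j k l * H k l| <=
  (81 * x ^+ 3 + 9 * k1 * x ^+ 3 + (k1 ^+ 2 + k2) * x ^+ 3) * `|H| ^+ 2 * (r1 + r2).
Proof.
have sH : sym_mx H by rewrite /sym_mx /H linearB /= p2.1 p1.1.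
rewrite cent_contract//; last exact: p1.1.
rewrite /aent -/r1 -/r2; set a2 := invmx Y2 i j; set a1 := invmx Y1 i j.
set t := \tr _; set z := (_ *m _ *m _) i j.
have a1x : `|a1| <= x := le_trans (mx_entry_le _ _ _) X1x.
have ad : `|a2 - a1 + z| <= 81 * x ^+ 3 * `|H| ^+ 2.
  by apply: le_trans inv_quad; have := mx_entry_le (invmx Y2 - invmx Y1 + invmx Y1 *m H *m invmx
    Y1) i j; rewrite mxDE mxBE.
have zx : `|z| <= 9 * x ^+ 2 * `|H|.
  apply: le_trans (mx_entry_le _ _ _) _; apply: le_trans (norm_mulmx3 _ _) _.
  rewrite (_ : 9 * x ^+ 2 * `|H| = 3 * (3 * x * `|H|) * x); last by ring.
  by rewrite ler_pM ?mulr_ge0// ler_pM2l.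
(* The remainder of the inverse, the cross term of second order, and the remainder of the weight. *)
rewrite [X in `|X| <= _](_ : _ = (a2 - a1 + z) * r2 + z * (r1 - r2) + a1 * (r2 - r1 + r1 * t / 2));
  last by field.
have h1 : `|(a2 - a1 + z) * r2| <= 81 * x ^+ 3 * `|H| ^+ 2 * r2.
  by rewrite normrM (ger0_norm r20) ler_wpM2r.
have h2 : `|z * (r1 - r2)| <= 9 * x ^+ 2 * `|H| * (k1 * x * `|H| * r2).
  by rewrite normrM ler_pM// distrC rdet_lip.
have h3 : `|a1 * (r2 - r1 + r1 * t / 2)| <= x * ((k1 ^+ 2 + k2) * x ^+ 2 * `|H| ^+ 2 * (r1 + r2)).
  by rewrite normrM ler_pM// rdet_quad.
have k10 : 0 <= k1 by rewrite !addr_ge0// ?mulr_ge0// exprn_ge0// mulr_ge0.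
have h4 : 0 <= (81 * x ^+ 3 + 9 * k1 * x ^+ 3) * `|H| ^+ 2 * r1.
  by rewrite !mulr_ge0 ?addr_ge0 ?mulr_ge0 ?exprn_ge0.
apply: le_trans (ler_normD _ _) _; apply: le_trans (lerD (ler_normD _ _) (lexx _)) _.
rewrite (_ : (81 * x ^+ 3 + _ + _) * _ * _ = 81 * x ^+ 3 * `|H| ^+ 2 * r2 + 9 * x ^+ 2 * `|H| * (k1
  * x * `|H| * r2)
  + x * ((k1 ^+ 2 + k2) * x ^+ 2 * `|H| ^+ 2 * (r1 + r2)) + (81 * x ^+ 3 + 9 * k1 * x ^+ 3) * `|H|
    ^+ 2 * r1); last by ring.
by lra.
Qed.

End Bounds.
End Expansion.

(** * Symmetrization of rank-4 tensors *)

Section Sym4.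
Variable R : realType.

(** Permutations are sorted by the image of [ord0]. Iterating this down to ['S_0] enumerates all 24
    permutations in [sym4]. *)
Lemma sum_perm_lift n (F : 'S_n.+1 -> R) :
  \sum_s F s = \sum_j \sum_(s : 'S_n) F (lift_perm ord0 j s).
Proof.
rewrite (partition_big (fun s : 'S_n.+1 => s ord0) predT)//=; apply: eq_bigr => j _.
rewrite (reindex (lift_perm ord0 j)); last first.
  (* The inverse of [lift_perm ord0 j]: the image of [ord0] is removed from the codomain. *)
  pose ulsf k (s : 'S_n.+1) := odflt k (unlift (s ord0) (s (lift ord0 k))).
  have ulsfK k (s : 'S_n.+1) : lift (s ord0) (ulsf k s) = s (lift ord0 k).
    rewrite /ulsf; have := neq_lift ord0 k.
    by rewrite -(can_eq (permK s)) => /unlift_some[] ? ? ->.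
  have inj_ulsf (s : 'S_n.+1) : injective (ulsf^~ s).
    by move=> k k' /(congr1 (lift (s ord0))); rewrite !ulsfK => /perm_inj/lift_inj.
  exists (fun s : 'S_n.+1 => perm (inj_ulsf s)) => [s _ | s].
    by apply/permP=> k'; rewrite permE /ulsf lift_perm_lift lift_perm_id liftK.
  rewrite inE => /eqP si0; apply/permP => k.
  case: (unliftP ord0 k) => [k'|] ->; rewrite ?lift_perm_id//.
  by rewrite lift_perm_lift -si0 permE ulsfK.
by apply: eq_bigl => s; rewrite lift_perm_id eqxx.
Qed.

Lemma sum_perm0 (F : 'S_0 -> R) : \sum_s F s = F 1%g.
Proof.
by rewrite (big_pred1 1%g)// => s; apply/esym/eqP/permP => -[].
Qed.

Lemma sym4_tprod (X : 'M[R]_3) i j k l : sym_mx X ->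
  sym4 (tprod X X) i j k l =
  3^-1 * (X i j * X k l + X i k * X j l + X i l * X j k).
Proof.
move=> sX; have Xs a b : X a b = X b a by rewrite -{1}sX mxE.
rewrite /sym4 /tprod.
have -> : inord 1 = lift ord0 ord0 :> 'I_4 by apply/val_inj; rewrite /= inordK.
have -> : inord 2 = lift ord0 (lift ord0 ord0) :> 'I_4 by apply/val_inj; rewrite /= inordK.
have -> : inord 3 = lift ord0 (lift ord0 (lift ord0 ord0)) :> 'I_4 by apply/val_inj; rewrite /=
  inordK.
rewrite sum_perm_lift; under eq_bigr do under eq_bigr do rewrite lift_perm_id !lift_perm_lift.
under eq_bigr do rewrite sum_perm_lift.
under eq_bigr do under eq_bigr do under eq_bigr do rewrite lift_perm_id !lift_perm_lift.
under eq_bigr do under eq_bigr do rewrite sum_perm_lift.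
under eq_bigr do under eq_bigr do under eq_bigr do under eq_bigr do
  rewrite lift_perm_id !lift_perm_lift.
under eq_bigr do under eq_bigr do under eq_bigr do rewrite sum_perm_lift.
under eq_bigr do under eq_bigr do under eq_bigr do under eq_bigr do
  rewrite sum_perm0 lift_perm_id.
rewrite !big_ord_recl !big_ord0 /= !addr0 /bump /=.
rewrite (Xs j i) (Xs k i) (Xs l i) (Xs k j) (Xs l j) (Xs l k).
by field.
Qed.

End Sym4.

(** * Dominated integrals over the half line *)

Section Calculus.
Variable R : realType.

Lemma within_continuousP (V : normedModType R) (f : R -> V) :
  {within `[0, +oo[, continuous f} <->
  forall t, 0 <= t -> forall e, 0 < e -> exists2 d, 0 < d &
    forall s, 0 <= s -> `|s - t| < d -> `|f s - f t| < e.
Proof.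
rewrite subspace_continuousP; split=> [cf t t0 e e0|cf t].
- have := cf t; rewrite /= in_itv /= t0 => /(_ isT) /cvgrPdist_lt /(_ e e0).
  rewrite near_withinE => -[d /= d0 hd]; exists d => // s s0 sd.
  by rewrite distrC; apply: hd; rewrite /ball_/= 1?distrC// in_itv /= s0.
- rewrite /= in_itv /= andbT => t0; apply/cvgrPdist_lt => e e0.
  have [d d0 hd] := cf t t0 e e0.
  rewrite near_withinE; exists d => // s /= sd; rewrite in_itv /= andbT => s0.
  by rewrite distrC; apply: hd => //; rewrite distrC.
Qed.

(** The expansions above come with quadratic remainders, and this converts such a remainder into a
    derivative. *)
Lemma is_derive_quad (phi : R -> R) (t l c d : R) : 0 < d ->
  (forall h, `|h| < d -> `|phi (t + h) - phi t - h * l| <= c * h ^+ 2) ->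
  is_derive t 1 phi l.
Proof.
move=> d0 hq.
have cv : h^-1 *: ((phi \o shift t) (h *: 1) - phi t) @[h --> 0^'] --> l.
  apply/cvgrPdist_lt => e e0; near=> h.
  have h0 : h != 0 by near: h; exact: nbhs_dnbhs_neq.
  have hd : `|h| < d by near: h; exact: dnbhs0_lt.
  have he : `|h| < e / (`|c| + 1) by near: h; apply: dnbhs0_lt; rewrite divr_gt0// ltr_wpDl.
  rewrite /= [h *: 1]mulr1 distrC.
  rewrite (_ : _ - l = h^-1 * (phi (h + t) - phi t - h * l)); last first.
    by rewrite mulrBr mulrA mulVf// mul1r.
  rewrite normrM normfV ltr_pdivrMl ?normr_gt0//.
  apply: le_lt_trans (_ : `|c| * `|h| ^+ 2 < _).
    rewrite (addrC h); apply: le_trans (hq h hd) _.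
    by rewrite real_normK ?num_real// ler_wpM2r ?sqr_ge0// ler_norm.
  rewrite expr2 mulrCA ltr_pM2l ?normr_gt0//.
  move: he; rewrite ltr_pdivlMr ?ltr_wpDl// => he.
  by have := normr_ge0 h; have := h0; rewrite -normr_gt0 => ? ?; lra.
split; first by apply/cvg_ex; exists l.
exact: cvg_lim.
Unshelve. all: by end_near. Qed.

End Calculus.

Section Dominated.
Variable R : realType.
Notation mu := (@lebesgue_measure R).

Definition J (f : R -> R) : R := Rintegral mu `[0, +oo[%classic f.

(** The common majorant [(1 + s)^(-3/2)], which has the decay of [det (B + s)^(-1/2)]. Its integral,
    computed from the primitive [G], is 2. *)
Definition gdom (s : R) : R := (Num.sqrt ((1 + s) ^+ 3))^-1.

Lemma gdomE s : 0 <= s -> gdom s = ((1 + s) * Num.sqrt (1 + s))^-1.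
Proof.
move=> s0; rewrite /gdom exprS expr2.
have p : 0 <= 1 + s by rewrite addr_ge0.
rewrite sqrtrM// -expr2 sqrtr_sqr ger0_norm// mulrC.
by rewrite [X in _ = X]invfM invfM mulrC.
Qed.

Lemma gdom_gt0 s : 0 <= s -> 0 < gdom s.
Proof. by move=> s0; rewrite invr_gt0 sqrtr_gt0 exprn_gt0// ltr_pwDl. Qed.

Let G (s : R) : R := - (2 * (Num.sqrt (1 + s))^-1).

Let dG (s : R) : 0 <= s -> is_derive s 1 G (gdom s).
Proof.
move=> s0; have p : 0 < 1 + s by rewrite ltr_pwDl.
have q : 0 < Num.sqrt (1 + s) by rewrite sqrtr_gt0.
have d1 : is_derive s 1 (fun x : R => 1 + x) 1.
  by rewrite -[X in is_derive _ _ _ X]add0r; exact: (is_deriveD (f := cst (1 : R)) (g := id)).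
have d2 : is_derive s 1 (fun x : R => Num.sqrt (1 + x)) ((2 * Num.sqrt (1 + s))^-1).
  have := @is_derive1_comp R Num.sqrt (fun x => 1 + x) s _ _ (is_derive1_sqrt p) d1.
  by rewrite mulr1.
have d3 := @is_deriveV R _ s _ 1 (lt0r_neq0 q) d2.
have d4 : is_derive s 1 G (- (2 *: (- Num.sqrt (1 + s) ^- 2 *: (2 * Num.sqrt (1 + s))^-1))).
  exact: is_deriveN (is_deriveZ 2 d3).
apply: (is_derive_eq d4); rewrite gdomE// /GRing.scale /=.
have := sqr_sqrtr (ltW p); move: (Num.sqrt (1 + s)) q => q q0 <-.
by field; rewrite gt_eqF.
Qed.

Let gdom_cont : {within `[0, +oo[, continuous gdom}.
Proof.
apply/subspace_continuousP => s; rewrite /= in_itv /= andbT => s0.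
apply: cvg_within_filter.
apply: cvgV; first by rewrite sqrtr_eq0 -ltNge exprn_gt0// ltr_pwDl.
apply: (cvg_comp (fun x : R => (1 + x) ^+ 3) (@Num.sqrt R) _ (@sqrt_continuous R _)).
apply: (cvg_comp (fun x : R => 1 + x) (fun x => x ^+ 3) _ (@exprn_continuous _ 3 _)).
by apply: cvgD; [exact: cvg_cst|exact: cvg_id].
Qed.

Lemma sqrt_shift_inv_cvg0 : (Num.sqrt (1 + s))^-1 @[s --> +oo] --> (0 : R).
Proof.
apply/cvgrPdist_lt => e e0; near=> s.
have s0 : e ^- 2 < s by near: s; apply: nbhs_pinfty_gt; rewrite num_real.
have ee : 0 < e ^- 2 by rewrite invr_gt0 exprn_gt0.
have p : 0 < 1 + s by lra.
rewrite sub0r normrN ger0_norm ?invr_ge0 ?sqrtr_ge0//.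
rewrite -[ltRHS]invrK ltf_pV2 ?posrE ?sqrtr_gt0 ?invr_gt0//.
rewrite -[ltLHS]ger0_norm ?invr_ge0 ?(ltW e0)// -sqrtr_sqr.
by rewrite ltr_sqrt// exprVn; lra.
Unshelve. all: by end_near. Qed.

Let G_int : (\int[mu]_(x in `[0%R, +oo[) (gdom x)%:E = 2%:E)%E.
Proof.
rewrite (@ge0_continuous_FTC2y R gdom G 0 0).
- by rewrite /G addr0 sqrtr1 invr1 mulr1 sub0e -EFinN opprK.
- by move=> x x0; apply/ltW/gdom_gt0.
- exact: gdom_cont.
- rewrite -oppr0 -(mulr0 2); apply: cvgN; apply: cvgM; first exact: cvg_cst.
  exact: sqrt_shift_inv_cvg0.
- by move=> x /ltW /dG[].
- have /derivable1_diffP/differentiable_continuous h : derivable G 0 1 by have [] := dG (lexx 0).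
  exact/cvg_at_right_filter.
- move=> x; rewrite in_itv /= andbT => /ltW /dG h.
  by rewrite derive1E; apply: derive_val.
Qed.

(** A class closed under linear combinations on which [J] is linear and monotone, so that
    integrability is verified once. *)
Definition dominated (f : R -> R) := measurable_fun (`[0%R, +oo[%classic : set R) f /\
  exists c, forall s, 0 <= s -> `|f s| <= c * gdom s.

Let mD : measurable (`[0%R, +oo[%classic : set R). Proof. exact: measurable_itv. Qed.

Lemma gdom_measurable : measurable_fun (`[0%R, +oo[%classic : set R) gdom.
Proof. exact: subspace_continuous_measurable_fun. Qed.

Lemma integrable_gdom : mu.-integrable `[0%R, +oo[%classic (EFin \o gdom).
Proof.
apply/integrableP; split; first by apply/measurable_EFinP; exact: gdom_measurable.
under eq_integral => x.
  rewrite inE /= in_itv /= andbT => x0.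
  rewrite /= ger0_norm; last exact/ltW/gdom_gt0.
  over.
by rewrite G_int ltry.
Qed.

Lemma J_gdom : J gdom = 2.
Proof. by rewrite /J /Rintegral G_int. Qed.

Lemma dominated_integrable f : dominated f -> mu.-integrable `[0%R, +oo[%classic (EFin \o f).
Proof.
move=> [mf [c fc]].
apply: (@le_integrable _ _ _ mu _ mD _ (EFin \o (fun s => c * gdom s))).
- exact/measurable_EFinP.
- move=> s /=; rewrite in_itv /= andbT => s0; rewrite lee_fin.
  by apply: le_trans (fc s s0) _; rewrite ler_norm.
- rewrite (_ : EFin \o _ = (fun x => c%:E * (EFin \o gdom) x)%E)//.
  apply: integrableZl; first exact: measurable_itv.
  exact: integrable_gdom.
Qed.

Lemma dominatedZ a f : dominated f -> dominated (fun s => a * f s).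
Proof.
move=> [mf [c fc]]; split; first exact: measurable_funM.
exists (`|a| * c) => s s0; rewrite normrM -mulrA ler_wpM2l//; exact: fc.
Qed.

Lemma dominatedD f h : dominated f -> dominated h -> dominated (fun s => f s + h s).
Proof.
move=> [mf [c fc]] [mh [c' hc]]; split; first exact: measurable_funD.
exists (c + c') => s s0; rewrite mulrDl (le_trans (ler_normD _ _))// lerD//; [exact: fc|exact: hc].
Qed.

Lemma dominated0 : dominated (fun=> 0).
Proof. by split; [exact: measurable_cst|exists 0 => s _; rewrite normr0 mul0r]. Qed.

Lemma dominated_gdom : dominated gdom.
Proof.
split; first exact: gdom_measurable.
by exists 1 => s s0; rewrite mul1r ger0_norm//; exact/ltW/gdom_gt0.
Qed.

Lemma dominated_sum n (f : 'I_n -> R -> R) :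
  (forall i, dominated (f i)) -> dominated (fun s => \sum_i f i s).
Proof.
elim: n f => [|n IH] f df.
  by rewrite (_ : (fun _ => _) = fun=> 0); [exact: dominated0|apply/funext => s; rewrite big_ord0].
rewrite (_ : (fun _ => _) = fun s => f ord0 s + \sum_(i < n) f (lift ord0 i) s).
  by apply: dominatedD => //; apply: IH => i; exact: df.
by apply/funext => s; rewrite big_ord_recl.
Qed.

Lemma J_Z a f : dominated f -> J (fun s => a * f s) = a * J f.
Proof. by move=> df; rewrite /J RintegralZl//; exact: dominated_integrable. Qed.

Lemma J_D f h : dominated f -> dominated h -> J (fun s => f s + h s) = J f + J h.
Proof. by move=> df dh; rewrite /J RintegralD//; exact: dominated_integrable. Qed.

Lemma J_sum n (f : 'I_n -> R -> R) : (forall i, dominated (f i)) ->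
  J (fun s => \sum_i f i s) = \sum_i J (f i).
Proof.
elim: n f => [|n IH] f df.
  rewrite big_ord0 (_ : (fun _ => _) = fun s => 0 * 0 : R).
    by rewrite J_Z ?mul0r//; exact: dominated0.
  by apply/funext => s; rewrite big_ord0 mul0r.
rewrite big_ord_recl -IH; last by move=> i; exact: df.
rewrite -J_D//; last by apply: dominated_sum => i; exact: df.
by congr J; apply/funext => s; rewrite big_ord_recl.
Qed.

Lemma eq_J f h : (forall s, 0 <= s -> f s = h s) -> J f = J h.
Proof.
by move=> fh; apply: eq_Rintegral => s; rewrite inE /= in_itv /= andbT => /fh.
Qed.

Lemma J_le f h : dominated f -> dominated h -> (forall s, 0 <= s -> f s <= h s) -> J f <= J h.
Proof.
move=> df dh fh; apply: le_Rintegral => //; [exact: dominated_integrable..|].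
by move=> s /=; rewrite in_itv /= andbT => /fh.
Qed.

Lemma J_norm_le f c : dominated f -> (forall s, 0 <= s -> `|f s| <= c * gdom s) -> `|J f| <= c * 2.
Proof.
move=> df fc; rewrite -J_gdom -J_Z; last exact: dominated_gdom.
have dg : dominated (fun s => c * gdom s) by apply/dominatedZ/dominated_gdom.
have dN : dominated (fun s => - 1 * f s) by exact: dominatedZ.
rewrite ler_norml; apply/andP; split.
- rewrite -mulN1r -J_Z//; apply: J_le => // [|s s0]; first exact: dominatedZ.
  by rewrite mulN1r; have := fc s s0; rewrite ler_norml => /andP[].
- by apply: J_le => // s s0; have := fc s s0; rewrite ler_norml => /andP[].
Qed.

(** Lower bounds on the integrands are uniform only for bounded [s]; an interval of length 1 turns
    such a bound into the same bound on the integral. *)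
Lemma J_ge_itv01 f c : dominated f -> 0 <= c -> (forall s, 0 <= s -> 0 <= f s) ->
  (forall s, 0 <= s -> s <= 1 -> c <= f s) -> c <= J f.
Proof.
move=> df c0 f0 fc; rewrite /J.
have -> : c = Rintegral mu `[0%R, 1%R]%classic (fun=> c).
  by rewrite Rintegral_cst//= lebesgue_measure_itv/= lte01 sube0/= mulr1.
have idf := dominated_integrable df.
have idf1 : mu.-integrable `[0%R, 1%R]%classic (EFin \o f).
  by apply: integrableS idf => //; exact: subset_itvl.
apply: (@le_trans _ _ (Rintegral mu `[0%R, 1%R]%classic f)).
  apply: le_Rintegral => // [|s /=].
    by apply: continuous_compact_integrable; [exact: segment_compact|move=> x; exact: cvg_cst].
  by rewrite in_itv /= => /andP[? ?]; exact: fc.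
rewrite -subr_ge0 Rintegral_itvB ?bnd_simp//.
apply: Rintegral_ge0 => s /=; rewrite in_itv /= andbT => s1.
by apply/f0/ltW; exact: lt_trans ltr01 s1.
Qed.

End Dominated.

(** * Integral representations of A and C *)

Section AC.
Variable R : realType.
Implicit Types B H : 'M[R]_3.

Lemma qf_norm H v : `|qf H v| <= 3 * `|H| * nrm2 v.
Proof.
rewrite qfE /nrm2 !sum3E !big_ord_recl !big_ord0 !addr0.
have h i j : `|v i 0 * H i j * v j 0| <= `|H| * (v i 0 ^+ 2 + v j 0 ^+ 2) / 2.
  rewrite !normrM (mulrC `|v i 0|) -!mulrA ler_pM// ?mulr_ge0// ?mx_entry_le//.
  rewrite -[v i 0 ^+ 2]real_normK ?num_real// -[v j 0 ^+ 2]real_normK ?num_real//.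
  by have := sqr_ge0 (`|v i 0| - `|v j 0|); nra.
have hh := (h i0 i0, h i0 i1, h i0 i2, h i1 i0, h i1 i1, h i1 i2, h i2 i0, h i2 i1, h i2 i2).
move: hh; rewrite !ler_norml.
move=> [[[[[[[[]]]]]]]] /andP[? ?] /andP[? ?] /andP[? ?] /andP[? ?] /andP[? ?].
by move=> /andP[? ?] /andP[? ?] /andP[? ?] /andP[? ?]; apply/andP; split; lra.
Qed.

Lemma geI_perturb mu B H : geI mu B -> sym_mx H -> geI (mu - 3 * `|H|) (B + H).
Proof.
move=> [sB gB] sH; split=> [|v]; first by rewrite /sym_mx linearD /= sB sH.
have := qf_norm H v; rewrite ler_norml => /andP[h _].
by rewrite qfD mulrBl; have := gB v; lra.
Qed.

Definition inK (m M : R) B := geI m B /\ `|B| <= M.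

Lemma posdef_inK B : posdef B -> exists2 m, 0 < m <= 1 & geI m B.
Proof.
move=> /posdef_geI[mu mu0 gB]; exists (Num.min mu 1).
  by rewrite lt_min mu0 ltr01 ge_min lexx orbT.
by apply: geI_le gB; rewrite ge_min lexx.
Qed.

Section FixedM.
Variable m : R.
Hypothesis m01 : 0 < m <= 1.
Let m0 : 0 < m. Proof. by case/andP: m01. Qed.
Let m1 : m <= 1. Proof. by case/andP: m01. Qed.
Let mV0 : 0 <= m^-1. Proof. by rewrite invr_ge0 ltW. Qed.

Definition crd : R := (Num.sqrt (m ^+ 3 / 6))^-1.

Lemma crd_ge0 : 0 <= crd. Proof. by rewrite invr_ge0 sqrtr_ge0. Qed.

Lemma shift_posdef B s : 0 <= s -> geI m B -> posdef (B + s%:M).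
Proof. by move=> s0 /(geI_shift s); apply: geI_posdef; rewrite ltr_pwDl. Qed.

Lemma shift_inv_norm B s : 0 <= s -> geI m B -> `|invmx (B + s%:M)| <= m^-1.
Proof.
move=> s0 /(geI_shift s) gB; have ms : 0 < m + s by rewrite ltr_pwDl.
apply: le_trans (geI_inv_norm ms gB) _.
by rewrite lef_pV2 ?posrE// lerDl.
Qed.

(** Since [m <= 1], one has [m (1 + s) <= m + s], hence [det (B + s) >= (m + s)^3 / 6 >= m^3 (1 +
    s)^3 / 6]. The cap at 1 in [posdef_inK] is there for this. *)
Lemma rdet_dom B s : 0 <= s -> geI m B -> rdet (B + s%:M) <= crd * gdom s.
Proof.
move=> s0 gB; have ms : 0 < m + s by rewrite ltr_pwDl.
have s1 : 0 < 1 + s by rewrite ltr_pwDl.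
rewrite /rdet /crd /gdom -invfM lef_pV2 ?posrE ?mulr_gt0 ?sqrtr_gt0 ?divr_gt0 ?exprn_gt0//; last
  first.
  exact/posdef_det_gt0/shift_posdef.
rewrite -sqrtrM ?divr_ge0 ?exprn_ge0 ?(ltW m0)//.
apply: ler_wsqrtr; apply: le_trans (geI_det ms (geI_shift s gB)).
rewrite mulrAC ler_pM2r// -exprMn lerXn2r ?nnegrE ?mulr_ge0 ?(ltW m0) ?(ltW ms) ?(ltW s1)//.
by have := ler_wpM2r s0 m1; lra.
Qed.

Lemma gdom_le1 (s : R) : 0 <= s -> gdom s <= 1.
Proof.
move=> s0; have p : 0 < 1 + s by rewrite ltr_pwDl.
rewrite /gdom invf_le1 ?sqrtr_gt0 ?exprn_gt0//.
rewrite -[leLHS]sqrtr1; apply: ler_wsqrtr; rewrite -[leLHS](expr1n _ 3) lerXn2r ?nnegrE ?(ltW p)//.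
by rewrite lerDl.
Qed.

Lemma norm_scalar_mx3 (s : R) : `|s%:M : 'M[R]_3| <= `|s|.
Proof.
by apply: mx_norm_le => // i j; rewrite mxE; case: eqP => _; rewrite ?mulr1n ?mulr0n ?normr0.
Qed.

(** A Lipschitz estimate in [Y], read along the line [B + s], gives continuity in [s]; it supplies
    the measurability required by [dominated]. *)
Lemma shift_within_cont (phi : 'M[R]_3 -> R) k B : 0 <= k ->
  (forall Y1 Y2, posdef Y1 -> posdef Y2 -> `|invmx Y1| <= m^-1 -> `|invmx Y2| <= m^-1 ->
     `|Y2 - Y1| <= 1 -> `|phi Y2 - phi Y1| <= k * `|Y2 - Y1| * rdet Y2) ->
  geI m B -> {within `[0, +oo[, continuous (fun s : R => phi (B + s%:M))}.
Proof.
move=> k0 hphi gB; apply/within_continuousP => t t0 e e0.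
pose c := k * crd + 1.
have c0 : 0 < c by rewrite ltr_wpDl// mulr_ge0// crd_ge0.
exists (Num.min 1 (e / c)); first by rewrite lt_min ltr01 divr_gt0.
move=> s s0; rewrite lt_min => /andP[st1 ste].
have d : `|(B + s%:M) - (B + t%:M)| <= `|s - t|.
  rewrite opprD addrACA subrr add0r -raddfB /=; exact: norm_scalar_mx3.
have := hphi (B + t%:M) (B + s%:M) (shift_posdef t0 gB) (shift_posdef s0 gB)
  (shift_inv_norm t0 gB) (shift_inv_norm s0 gB) (le_trans d (ltW st1)).
move/le_lt_trans; apply.
apply: le_lt_trans (_ : k * crd * `|s - t| < _).
  rewrite -mulrA -mulrA ler_wpM2l// mulrC ler_pM// ?invr_ge0 ?sqrtr_ge0//.
  apply: le_trans (rdet_dom s0 gB) _.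
  by rewrite ler_piMr ?crd_ge0// gdom_le1.
move: ste; rewrite ltr_pdivlMr// => ste; apply: le_lt_trans ste.
by rewrite mulrC ler_wpM2l// /c lerDl.
Qed.

Lemma aent_le B s i j : 0 <= s -> geI m B -> `|aent (B + s%:M) i j| <= m^-1 * crd * gdom s.
Proof.
move=> s0 gB; rewrite normrM -mulrA ler_pM//.
  exact: le_trans (mx_entry_le _ _ _) (shift_inv_norm s0 gB).
by rewrite ger0_norm ?rdet_dom// ltW// rdet_gt0//; exact: shift_posdef.
Qed.

Lemma cent_le B s i j k l : 0 <= s -> geI m B ->
  `|cent (B + s%:M) i j k l| <= 3 * m^-1 ^+ 2 * crd * gdom s.
Proof.
move=> s0 gB; rewrite normrM -[leRHS]mulrA ler_pM//; last first.
  by rewrite ger0_norm ?rdet_dom// ltW// rdet_gt0//; exact: shift_posdef.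
have h a b c d : `|invmx (B + s%:M) a b * invmx (B + s%:M) c d| <= m^-1 ^+ 2.
  by rewrite normrM expr2 ler_pM//; exact: le_trans (mx_entry_le _ _ _) (shift_inv_norm s0 gB).
apply: le_trans (ler_normD _ _) _; apply: le_trans (lerD (ler_normD _ _) (lexx _)) _.
by have := h i j k l; have := h i k j l; have := h i l j k; lra.
Qed.

Lemma aent_cont B i j : geI m B -> {within `[0, +oo[, continuous (fun s : R => aent (B + s%:M) i
  j)}.
Proof.
apply: (@shift_within_cont (fun Y => aent Y i j)); last first.
  by move=> Y1 Y2 p1 p2 x1 x2 d; apply: (aent_lip mV0 ler01 p1 p2 x1 x2 d).
by rewrite !(mulr_ge0, addr_ge0, exprn_ge0).
Qed.

Lemma dominated_aent B i j : geI m B -> dominated (fun s => aent (B + s%:M) i j).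
Proof.
move=> gB; split; last by eexists => s s0; exact: aent_le.
by apply: subspace_continuous_measurable_fun => //; exact: aent_cont.
Qed.

Lemma dominated_cent B i j k l : geI m B -> dominated (fun s => cent (B + s%:M) i j k l).
Proof.
move=> gB; split; last by eexists => s s0; exact: cent_le.
apply: subspace_continuous_measurable_fun => //.
apply: (@shift_within_cont (fun Y => cent Y i j k l)); last exact: gB; last first.
  by move=> Y1 Y2 p1 p2 x1 x2 d; apply: (cent_lip mV0 ler01 p1 p2 x1 x2 d).
by rewrite !(mulr_ge0, addr_ge0, exprn_ge0).
Qed.

Lemma AofE B i j : Aof B i j = 2^-1 * J (fun s => aent (B + s%:M) i j).
Proof. by rewrite mxE. Qed.

Lemma CofE B i j k l : geI m B ->
  Cof B i j k l = 4^-1 * J (fun s => cent (B + s%:M) i j k l).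
Proof.
move=> gB; rewrite /Cof.
(* The average over permutations contributes [3^-1], so that [3 / 4] becomes [4^-1]. *)
transitivity (3 / 4 * J (fun s => 3^-1 * cent (B + s%:M) i j k l)).
  congr (_ * _); apply: eq_J => s s0.
  by rewrite sym4_tprod ?mulrA//; apply: sym_inv; apply: (shift_posdef s0 gB).1.
by rewrite J_Z; [field|exact: dominated_cent].
Qed.

Lemma tcontrE B H i j : geI m B ->
  tcontr (Cof B) H i j = 4^-1 * J (fun s => \sum_k \sum_l cent (B + s%:M) i j k l * H k l).
Proof.
move=> gB; rewrite mxE.
have d k l : dominated (fun s => cent (B + s%:M) i j k l * H k l).
  rewrite (_ : (fun s => _) = fun s => H k l * cent (B + s%:M) i j k l); last first.
    by apply/funext => s; rewrite mulrC.
  exact/dominatedZ/dominated_cent.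
rewrite J_sum => [|k]; last exact: dominated_sum.
rewrite mulr_sumr; apply: eq_bigr => k _; rewrite J_sum// mulr_sumr; apply: eq_bigr => l _.
rewrite CofE// -mulrA; congr (_ * _); rewrite mulrC -J_Z; last exact: dominated_cent.
by apply: eq_J => s _; rewrite mulrC.
Qed.

End FixedM.
End AC.

(** * Lipschitz estimates and coercivity *)

Section Estimates.
Variable R : realType.
Implicit Types B H : 'M[R]_3.
Variables m M : R.
Hypothesis m01 : 0 < m <= 1.
Hypothesis M0 : 0 <= M.
Let m0 : 0 < m. Proof. by case/andP: m01. Qed.
Let mV0 : 0 <= m^-1. Proof. by rewrite invr_ge0 ltW. Qed.
Let h0 : 0 <= 2 * M. Proof. by rewrite mulr_ge0. Qed.

Lemma inK_dist B1 B2 : inK m M B1 -> inK m M B2 -> `|B2 - B1| <= 2 * M.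
Proof.
by move=> [_ b1] [_ b2]; apply: le_trans (ler_normB _ _) _; lra.
Qed.

Let shift_sub B1 B2 (s : R) : (B2 + s%:M) - (B1 + s%:M) = B2 - B1.
Proof. by rewrite opprD addrACA subrr addr0. Qed.

(** The shift cancels in the difference of the two arguments, so [cent_lip] applies for every [s]
    with the same increment, of norm at most [2 M]. Integration of the weight contributes
    [crd m * 2]. *)
Lemma Cof_lip : exists2 L, 0 <= L & forall B1 B2, inK m M B1 -> inK m M B2 ->
  forall i j k l, `|Cof B2 i j k l - Cof B1 i j k l| <= L * `|B2 - B1|.
Proof.
pose k1 := 9 + 54 * (m^-1 * (2 * M)) + 162 * (m^-1 * (2 * M)) ^+ 2.
pose c := 3 * (18 * m^-1 ^+ 3 + k1 * m^-1 ^+ 3).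
have c0 : 0 <= c by rewrite !(mulr_ge0, addr_ge0, exprn_ge0).
exists (4^-1 * (c * crd m * 2)); first by rewrite !(mulr_ge0, addr_ge0, exprn_ge0, crd_ge0).
move=> B1 B2 K1 K2 i j k l; rewrite !(CofE m01); [|exact: K1.1|exact: K2.1].
rewrite -mulrBr normrM ger0_norm// -[leRHS]mulrA ler_wpM2l//.
rewrite -[X in _ + X]mulN1r -J_Z; last by apply: (dominated_cent m01); exact: K1.1.
have d2 : dominated (fun s => cent (B2 + s%:M) i j k l).
  by apply: (dominated_cent m01); exact: K2.1.
have d1 : dominated (fun s => -1 * cent (B1 + s%:M) i j k l).
  by apply: dominatedZ; apply: (dominated_cent m01); exact: K1.1.
rewrite -J_D//.
rewrite [leRHS](_ : _ = c * `|B2 - B1| * crd m * 2); last by ring.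
apply: J_norm_le.
  exact: dominatedD.
move=> s s0; rewrite mulN1r.
have := @cent_lip R m^-1 (2 * M) mV0 h0 _ _ (shift_posdef m01 s0 K1.1) (shift_posdef m01 s0 K2.1)
  (shift_inv_norm m01 s0 K1.1) (shift_inv_norm m01 s0 K2.1).
rewrite shift_sub => /(_ (inK_dist K1 K2) i j k l) /le_trans; apply.
rewrite -[leRHS]mulrA; apply: ler_wpM2l; last exact: rdet_dom K2.1.
by rewrite mulr_ge0.
Qed.

Lemma Aof_lip : exists2 L, 0 <= L & forall B1 B2, inK m M B1 -> inK m M B2 ->
  `|Aof B2 - Aof B1| <= L * `|B2 - B1|.
Proof.
pose k1 := 9 + 54 * (m^-1 * (2 * M)) + 162 * (m^-1 * (2 * M)) ^+ 2.
pose c := 9 * m^-1 ^+ 2 + k1 * m^-1 ^+ 2.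
have c0 : 0 <= c by rewrite !(mulr_ge0, addr_ge0, exprn_ge0).
exists (2^-1 * (c * crd m * 2)); first by rewrite !(mulr_ge0, addr_ge0, exprn_ge0, crd_ge0).
move=> B1 B2 K1 K2; apply: mx_norm_le => [|i j].
  by rewrite !(mulr_ge0, addr_ge0, exprn_ge0, crd_ge0).
rewrite mxBE !AofE.
rewrite -mulrBr normrM ger0_norm// -[leRHS]mulrA ler_wpM2l//.
rewrite -[X in _ + X]mulN1r -J_Z; last by apply: (dominated_aent m01); exact: K1.1.
have d2 : dominated (fun s => aent (B2 + s%:M) i j).
  by apply: (dominated_aent m01); exact: K2.1.
have d1 : dominated (fun s => -1 * aent (B1 + s%:M) i j).
  by apply: dominatedZ; apply: (dominated_aent m01); exact: K1.1.
rewrite -J_D//.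
rewrite [leRHS](_ : _ = c * `|B2 - B1| * crd m * 2); last by ring.
apply: J_norm_le.
  exact: dominatedD.
move=> s s0; rewrite mulN1r.
have := @aent_lip R m^-1 (2 * M) mV0 h0 _ _ (shift_posdef m01 s0 K1.1) (shift_posdef m01 s0 K2.1)
  (shift_inv_norm m01 s0 K1.1) (shift_inv_norm m01 s0 K2.1).
rewrite shift_sub => /(_ (inK_dist K1 K2) i j) /le_trans; apply.
rewrite -[leRHS]mulrA; apply: ler_wpM2l; last exact: rdet_dom K2.1.
by rewrite mulr_ge0.
Qed.

Lemma dominated_contract B H i j : geI m B ->
  dominated (fun s => \sum_k \sum_l cent (B + s%:M) i j k l * H k l).
Proof.
move=> gB; apply: dominated_sum => k; apply: dominated_sum => l.
rewrite (_ : (fun s => _) = fun s => H k l * cent (B + s%:M) i j k l); last first.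
  by apply/funext => s; rewrite mulrC.
by apply: dominatedZ; exact: (dominated_cent m01).
Qed.

(** The derivative of [A] in a symmetric direction is [- C(B)], with a remainder uniform on [K]. *)
Lemma Aof_quad : exists2 c, 0 <= c & forall B1 B2, inK m M B1 -> inK m M B2 ->
  `|Aof B2 - Aof B1 + tcontr (Cof B1) (B2 - B1)| <= c * `|B2 - B1| ^+ 2.
Proof.
pose k1 := 9 + 54 * (m^-1 * (2 * M)) + 162 * (m^-1 * (2 * M)) ^+ 2.
pose k2 := 54 + 162 * (m^-1 * (2 * M)).
pose c := 81 * m^-1 ^+ 3 + 9 * k1 * m^-1 ^+ 3 + (k1 ^+ 2 + k2) * m^-1 ^+ 3.
have c0 : 0 <= c by rewrite !(mulr_ge0, addr_ge0, exprn_ge0).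
exists (2^-1 * (c * (2 * crd m) * 2)); first by rewrite !(mulr_ge0, addr_ge0, exprn_ge0, crd_ge0).
move=> B1 B2 K1 K2; apply: mx_norm_le => [|i j].
  by rewrite !(mulr_ge0, addr_ge0, exprn_ge0, crd_ge0).
rewrite mxDE mxBE !AofE (tcontrE m01); last exact: K1.1.
have d2 : dominated (fun s => aent (B2 + s%:M) i j) by apply: (dominated_aent m01); exact: K2.1.
have d1 : dominated (fun s => aent (B1 + s%:M) i j) by apply: (dominated_aent m01); exact: K1.1.
have d3 := dominated_contract (B2 - B1) i j K1.1.
set a1 := J _; set a2 := J _; set a3 := J _.
rewrite (_ : _ + _ = 2^-1 * (a1 + (- 1 * a2 + 2^-1 * a3))); last by field.
rewrite normrM ger0_norm// -[leRHS]mulrA ler_wpM2l// /a1 /a2 /a3 -!J_Z//.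
rewrite -J_D; [|exact: dominatedZ..].
rewrite -J_D//; last by apply: dominatedD; exact: dominatedZ.
rewrite [leRHS](_ : _ = c * `|B2 - B1| ^+ 2 * (2 * crd m) * 2); last by ring.
apply: J_norm_le.
  by apply: dominatedD => //; apply: dominatedD; exact: dominatedZ.
move=> s s0; rewrite mulN1r addrA.
have := @aent_quad R m^-1 (2 * M) mV0 h0 _ _ (shift_posdef m01 s0 K1.1) (shift_posdef m01 s0 K2.1)
  (shift_inv_norm m01 s0 K1.1) (shift_inv_norm m01 s0 K2.1).
rewrite shift_sub => /(_ (inK_dist K1 K2) i j) /le_trans; apply.
rewrite -[leRHS]mulrA; apply: ler_wpM2l; first by rewrite mulr_ge0// exprn_ge0.
by have := rdet_dom m01 s0 K1.1; have := rdet_dom m01 s0 K2.1; lra.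
Qed.

Lemma Aof_le : exists2 c, 0 <= c & forall B, inK m M B -> `|Aof B| <= c.
Proof.
exists (2^-1 * (m^-1 * crd m * 2)); first by rewrite !(mulr_ge0, addr_ge0, exprn_ge0, crd_ge0).
move=> B KB; apply: mx_norm_le => [|i j]; first by rewrite !(mulr_ge0, addr_ge0, exprn_ge0,
  crd_ge0).
rewrite AofE normrM ger0_norm// ler_wpM2l//; apply: J_norm_le.
  by apply: (dominated_aent m01); exact: KB.1.
by move=> s s0; apply: (aent_le m01) => //; exact: KB.1.
Qed.

Lemma Cof_sym12 B i j k l : geI m B -> Cof B i j k l = Cof B j i k l.
Proof.
move=> gB; rewrite !(CofE m01)//; congr (_ * _); apply: eq_J => s s0.
have sX := sym_inv (shift_posdef m01 s0 gB).1.
have Xs a b : invmx (B + s%:M) a b = invmx (B + s%:M) b a by rewrite -{1}sX mxE.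
by rewrite /cent (Xs j i); ring.
Qed.

Lemma tcontr_Cof_sym B H : geI m B -> sym_mx (tcontr (Cof B) H).
Proof.
move=> gB; apply/matrixP => i j; rewrite !mxE.
by apply: eq_bigr => k _; apply: eq_bigr => l _; rewrite Cof_sym12.
Qed.

Lemma Aof_sym B : geI m B -> sym_mx (Aof B).
Proof.
move=> gB; apply/matrixP => i j; rewrite mxE !AofE; congr (_ * _); apply: eq_J => s s0.
have sX := sym_inv (shift_posdef m01 s0 gB).1.
by rewrite /aent -{1}sX mxE.
Qed.

(** A lower bound for the weight on [[0, 1]], from [|B + s| <= M + 1] and [det3_le]. *)
Definition rlow : R := (Num.sqrt (6 * (M + 1) ^+ 3))^-1.

Lemma rlow_gt0 : 0 < rlow.
Proof. by rewrite invr_gt0 sqrtr_gt0 mulr_gt0// exprn_gt0// ltr_wpDl. Qed.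

Lemma shift_norm B s : 0 <= s -> s <= 1 -> `|B| <= M -> `|B + s%:M| <= M + 1.
Proof.
move=> s0 s1 BM; apply: le_trans (ler_normD _ _) _; apply: lerD => //.
by apply: le_trans (norm_scalar_mx3 _) _; rewrite ger0_norm.
Qed.

Lemma rdet_lower B s : inK m M B -> 0 <= s -> s <= 1 -> rlow <= rdet (B + s%:M).
Proof.
move=> [gB BM] s0 s1; have pY := shift_posdef m01 s0 gB; have dY := posdef_det_gt0 pY.
rewrite /rlow /rdet lef_pV2 ?posrE ?sqrtr_gt0 ?mulr_gt0 ?exprn_gt0 ?ltr_wpDl//.
apply: ler_wsqrtr; apply: le_trans (ler_norm _) _; apply: le_trans (det3_le _) _.
by rewrite ler_pM2l// lerXn2r ?nnegrE ?addr_ge0// shift_norm.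
Qed.

Lemma qf_Aof B v : geI m B -> qf (Aof B) v = 2^-1 * J (fun s => qf (invmx (B + s%:M)) v * rdet (B +
  s%:M)).
Proof.
move=> gB; rewrite qfE.
have d i j : dominated (fun s => v i 0 * v j 0 * aent (B + s%:M) i j).
  by apply: dominatedZ; exact: (dominated_aent m01).
transitivity (2^-1 * J (fun s => \sum_i \sum_j v i 0 * v j 0 * aent (B + s%:M) i j)).
  rewrite J_sum => [|i]; last exact: dominated_sum.
  rewrite mulr_sumr; apply: eq_bigr => i _; rewrite J_sum// mulr_sumr; apply: eq_bigr => j _.
  by rewrite J_Z; [rewrite AofE; ring|exact: (dominated_aent m01)].
congr (_ * _); apply: eq_J => s s0; rewrite qfE mulr_suml; apply: eq_bigr => i _.
by rewrite mulr_suml; apply: eq_bigr => j _; rewrite /aent; ring.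
Qed.

Lemma dominated_qf B v : geI m B -> dominated (fun s => qf (invmx (B + s%:M)) v * rdet (B + s%:M)).
Proof.
move=> gB; rewrite (_ : (fun s => _) = fun s => \sum_i \sum_j v i 0 * v j 0 * aent (B + s%:M) i j).
  apply: dominated_sum => i; apply: dominated_sum => j.
  by apply: dominatedZ; exact: (dominated_aent m01).
apply/funext => s; rewrite qfE mulr_suml; apply: eq_bigr => i _.
by rewrite mulr_suml; apply: eq_bigr => j _; rewrite /aent; ring.
Qed.

Lemma inv_lower B s v : inK m M B -> 0 <= s -> s <= 1 ->
  nrm2 v / (3 * (M + 1)) <= qf (invmx (B + s%:M)) v.
Proof.
move=> [gB BM] s0 s1; have pY := shift_posdef m01 s0 gB.
have M1 : 0 < 3 * (M + 1) by rewrite mulr_gt0// ltr_wpDl.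
rewrite ler_pdivrMr//; apply: le_trans (posdef_lower v (posdef_inv pY)) _.
rewrite invmxK mulrC ler_wpM2l//; first exact: (posdef_psd (posdef_inv pY)).2.
apply: le_trans (ler_norm _) _; apply: le_trans (norm_tr3 _) _.
by rewrite ler_pM2l// shift_norm.
Qed.

(** Only [s] in [[0, 1]] is used: there the inverse is at least [(3 (M + 1))^-1] because
    [tr (B + s) <= 3 (M + 1)], and the weight is at least [rlow]. *)
Lemma Aof_geI B : inK m M B -> geI (2^-1 * ((3 * (M + 1))^-1 * rlow)) (Aof B).
Proof.
move=> KB; have [gB BM] := KB; split; first exact: Aof_sym.
have M1 : 0 < 3 * (M + 1) by rewrite mulr_gt0// ltr_wpDl.
move=> v; rewrite qf_Aof// -mulrA ler_wpM2l//.
apply: J_ge_itv01; first exact: dominated_qf.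
- by rewrite !mulr_ge0 ?nrm2_ge0 ?invr_ge0 ?(ltW M1) ?(ltW rlow_gt0).
- move=> s s0; rewrite mulr_ge0//; last exact/ltW/rdet_gt0/(shift_posdef m01 s0 gB).
  exact: (posdef_psd (posdef_inv (shift_posdef m01 s0 gB))).2.
- move=> s s0 s1; rewrite mulrAC ler_pM ?mulr_ge0 ?nrm2_ge0 ?invr_ge0 ?(ltW M1) ?(ltW rlow_gt0)//.
    by rewrite mulrC inv_lower.
  exact: rdet_lower.
Qed.

Lemma Aof_posdef B : inK m M B -> posdef (Aof B).
Proof.
move=> /Aof_geI; apply: geI_posdef.
by rewrite !mulr_gt0 ?rlow_gt0// invr_gt0 mulr_gt0// ltr_wpDl.
Qed.

Lemma nrm2_mul3_le (P Q : 'M[R]_3) : nrm2 (P *m Q) <= nrm2 P * nrm2 Q.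
Proof.
have cs i j : (P *m Q) i j ^+ 2 <= (\sum_k P i k ^+ 2) * (\sum_k Q k j ^+ 2).
  rewrite mxE !sum3E.
  set a := P i _; set b := P i _; set c := P i _; set x := Q _ _; set y := Q _ _; set z := Q _ _.
  rewrite -subr_ge0 [leRHS](_ : _ = (a * y - b * x) ^+ 2 + (a * z - c * x) ^+ 2 + (b * z - c * y)
    ^+ 2); last by ring.
  by rewrite !addr_ge0 ?sqr_ge0.
rewrite {1 2}/nrm2 mulr_suml; apply: ler_sum => i _.
apply: le_trans (ler_sum _ (fun j _ => cs i j)) _.
by rewrite -mulr_sumr [nrm2 Q]exchange_big.
Qed.

Lemma norm_sqr_le_nrm2 H : `|H| ^+ 2 <= nrm2 H.
Proof.
rewrite -[leRHS]sqr_sqrtr ?nrm2_ge0// lerXn2r ?nnegrE ?sqrtr_ge0//.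
apply: mx_norm_le => [|i j]; first exact: sqrtr_ge0.
rewrite -sqrtr_sqr; apply: ler_wsqrtr.
rewrite /nrm2 (bigD1 i)//= (bigD1 j)//= -addrA lerDl addr_ge0//.
  by apply: sumr_ge0 => k _; rewrite sqr_ge0.
by apply: sumr_ge0 => k _; apply: sumr_ge0 => l _; rewrite sqr_ge0.
Qed.

(* With [X = Z^T Z], the trace is the squared Frobenius norm of [Z H Z^T]. *)
Lemma tr_XHXH (Y H : 'M[R]_3) : posdef Y -> sym_mx H ->
  nrm2 H <= \tr Y ^+ 2 * \tr (invmx Y *m H *m invmx Y *m H).
Proof.
move=> pY sH; have [Z Zu XE] := posdef_gram (posdef_inv pY).
rewrite XE; pose S := Z *m H *m Z^T.
have -> : \tr (Z^T *m Z *m H *m (Z^T *m Z) *m H) = nrm2 S.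
  have sS : S^T = S by rewrite /S !trmx_mul trmxK sH mulmxA.
  rewrite nrm2_tr sS /S -!mulmxA mxtrace_mulC -!mulmxA.
  by rewrite mxtrace_mulC -!mulmxA mxtrace_mulC -!mulmxA mxtrace_mulC -!mulmxA.
have uZT : Z^T \in unitmx by rewrite unitmx_tr.
have HE : H = invmx Z *m S *m (invmx Z)^T.
  by rewrite /S trmx_inv -!mulmxA mulmxV// mulmx1 mulKmx.
have trY : \tr Y = nrm2 (invmx Z).
  rewrite nrm2_tr mxtrace_mulC; congr (\tr _).
  have zz : Z^T *m Z \in unitmx by rewrite unitmx_mul uZT Zu.
  rewrite -[Y]invmxK XE; apply: (can_inj (mulKmx zz)); rewrite mulmxV// trmx_inv.
  by rewrite mulmxA -(mulmxA Z^T) mulmxV// mulmx1 mulmxV.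
have nT (P : 'M[R]_3) : nrm2 P^T = nrm2 P.
  by rewrite !nrm2_tr trmxK mxtrace_mulC.
rewrite {1}HE trY; apply: le_trans (nrm2_mul3_le _ _) _; rewrite nT.
by rewrite expr2 -[leRHS]mulrA [leLHS]mulrC ler_wpM2l ?nrm2_ge0// nrm2_mul3_le.
Qed.

Lemma tr_XHXH_ge0 (Y H : 'M[R]_3) : posdef Y -> sym_mx H ->
  0 <= \tr (invmx Y *m H *m invmx Y *m H).
Proof.
move=> pY sH; have t0 : 0 < \tr Y ^+ 2.
  rewrite exprn_even_gt0//=; apply/negP => /eqP t0.
  have h := psd_entry_tr _ _ (posdef_psd pY); rewrite t0 in h.
  have Y0 : Y = 0 by apply/matrixP => i j; rewrite [RHS]mxE; apply/eqP; rewrite -normr_le0.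
  by have := posdef_det_gt0 pY; rewrite Y0 det0 ltxx.
by rewrite -(pmulr_rge0 _ t0); apply: le_trans (nrm2_ge0 H) (tr_XHXH pY sH).
Qed.

(** The factors are [4^-1] from [CofE], 2 from the term [2 tr (X H X H)], the squared trace bound of
    [tr_XHXH], and the weight. *)
Definition ccoe : R := 2^-1 * ((3 * (M + 1)) ^- 2 * rlow).

Lemma ccoe_gt0 : 0 < ccoe.
Proof. by rewrite !mulr_gt0 ?rlow_gt0// invr_gt0 exprn_gt0// mulr_gt0// ltr_wpDl. Qed.

(** By [cent_contract], with [X = (B + s)^-1], the form [H:C:H] is a quarter of the integral of
    [(tr (X H))^2 + 2 tr (X H X H)] against the weight. The first term is dropped and the second is
    bounded below on [[0, 1]]. *)
Lemma Cof_coercive B H : inK m M B -> sym_mx H ->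
  ccoe * `|H| ^+ 2 <= \sum_i \sum_j H i j * tcontr (Cof B) H i j.
Proof.
move=> KB sH; have [gB BM] := KB.
have M1 : 0 < 3 * (M + 1) by rewrite mulr_gt0// ltr_wpDl.
have -> : \sum_i \sum_j H i j * tcontr (Cof B) H i j =
  4^-1 * J (fun s => \sum_i \sum_j H i j * \sum_k \sum_l cent (B + s%:M) i j k l * H k l).
  have d i j : dominated (fun s => H i j * \sum_k \sum_l cent (B + s%:M) i j k l * H k l).
    by apply: dominatedZ; exact: dominated_contract.
  rewrite J_sum => [|i]; last exact: dominated_sum.
  rewrite mulr_sumr; apply: eq_bigr => i _; rewrite J_sum// mulr_sumr; apply: eq_bigr => j _.
  by rewrite (tcontrE m01)// J_Z; [ring|exact: dominated_contract].
have e s : 0 <= s -> \sum_i \sum_j H i j * (\sum_k \sum_l cent (B + s%:M) i j k l * H k l) =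
   (\tr (invmx (B + s%:M) *m H) ^+ 2 + 2 * \tr (invmx (B + s%:M) *m H *m invmx (B + s%:M) *m H))
   * rdet (B + s%:M).
  move=> s0; have pY := shift_posdef m01 s0 gB.
  under eq_bigr => i _ do under eq_bigr => j _ do rewrite (cent_contract _ _ pY.1 sH).
  move: (invmx _) (sym_inv pY.1) (rdet _) => X sX r.
  have trH (P : 'M[R]_3) : \tr (P *m H) = \sum_i \sum_j H i j * P i j.
    rewrite /mxtrace; apply: eq_bigr => i _; rewrite mxE; apply: eq_bigr => j _.
    by rewrite -{1}sH mxE mulrC.
  rewrite [\tr (_ *m _ *m _ *m _)]trH; move: (\tr (X *m H)) (trH X) => t tE.
  rewrite expr2 {3}tE (mulr_sumr _ _ _ t) (mulr_sumr _ _ _ 2).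
  rewrite -big_split /= mulr_suml; apply: eq_bigr => i _.
  rewrite (mulr_sumr _ _ _ t) (mulr_sumr _ _ _ 2) -big_split /= mulr_suml; apply: eq_bigr => j _.
  ring.
rewrite (_ : ccoe * _ = 4^-1 * (2 * (`|H| ^+ 2 / (3 * (M + 1)) ^+ 2) * rlow)); last first.
  by rewrite /ccoe; field; rewrite gt_eqF// ltr_wpDl.
rewrite ler_wpM2l//; apply: J_ge_itv01.
- by do 2 (apply: dominated_sum => ?); apply: dominatedZ; exact: dominated_contract.
- by rewrite !mulr_ge0 ?sqr_ge0 ?invr_ge0 ?sqr_ge0 ?(ltW rlow_gt0).
- move=> s s0; rewrite e//; have pY := shift_posdef m01 s0 gB.
  rewrite mulr_ge0//; last exact/ltW/rdet_gt0.
  by rewrite addr_ge0 ?sqr_ge0// mulr_ge0// tr_XHXH_ge0.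
- move=> s s0 s1; rewrite e//; have pY := shift_posdef m01 s0 gB.
  rewrite ler_pM ?mulr_ge0 ?sqr_ge0 ?invr_ge0 ?sqr_ge0 ?(ltW rlow_gt0)//; last exact: rdet_lower.
  apply: le_trans (_ : 2 * \tr (invmx (B + s%:M) *m H *m invmx (B + s%:M) *m H) <= _); last first.
    by rewrite lerDr sqr_ge0.
  rewrite ler_pM2l// ler_pdivrMr ?exprn_gt0//.
  apply: le_trans (norm_sqr_le_nrm2 _) _; apply: le_trans (tr_XHXH pY sH) _.
  rewrite mulrC ler_wpM2l ?tr_XHXH_ge0//.
  rewrite -[\tr _ ^+ 2]real_normK ?num_real// lerXn2r ?nnegrE ?(ltW M1)//.
  by apply: le_trans (norm_tr3 _) _; rewrite ler_pM2l// shift_norm.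
Qed.

End Estimates.

(** * Trace identities *)

Section Traces.
Variable R : realType.
Implicit Types B H : 'M[R]_3.

Lemma rdet_shift_cvg0 (m : R) B : 0 < m <= 1 -> geI m B ->
  rdet (B + s%:M) @[s --> +oo] --> (0 : R).
Proof.
move=> m01 gB.
apply: (@squeeze_cvgr _ _ _ _ (fun=> 0) (fun s : R => crd m * (Num.sqrt (1 + s))^-1)).
- near=> s; have s0 : 0 <= s.
    by near: s; apply: nbhs_pinfty_ge; rewrite num_real.
  have s1 : 0 < 1 + s by rewrite ltr_pwDl.
  rewrite (ltW (rdet_gt0 (shift_posdef m01 s0 gB))) /=.
  apply: le_trans (rdet_dom m01 s0 gB) _; rewrite ler_wpM2l ?crd_ge0// gdomE//.
  rewrite lef_pV2 ?posrE ?mulr_gt0 ?sqrtr_gt0//.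
  by rewrite ler_peMl ?sqrtr_ge0// lerDl.
- exact: cvg_cst.
- rewrite -(mulr0 (crd m)); apply: cvgM; first exact: cvg_cst.
  exact: sqrt_shift_inv_cvg0.
Unshelve. all: by end_near. Qed.

Lemma rdet_shift_derive (m : R) B (s : R) : 0 < m <= 1 -> geI m B -> 0 < s ->
  is_derive s 1 (fun s => rdet (B + s%:M)) (- (2^-1 * (\tr (invmx (B + s%:M)) * rdet (B + s%:M)))).
Proof.
move=> m01 gB s0; have m0 : 0 < m by case/andP: m01.
have mV0 : 0 <= m^-1 by rewrite invr_ge0 ltW.
set c0 := ((9 + 54 * (m^-1 * 1) + 162 * (m^-1 * 1) ^+ 2) ^+ 2 + (54 + 162 * (m^-1 * 1))) * m^-1 ^+
  2.
have c00 : 0 <= c0 by rewrite !(mulr_ge0, addr_ge0, exprn_ge0).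
apply: (@is_derive_quad _ _ _ _ (c0 * (2 * crd m)) (Num.min s 1)).
  by rewrite lt_min s0 ltr01.
move=> h; rewrite lt_min => /andP[hs h1].
have sh : 0 <= s + h by move: hs; rewrite ltr_norml => /andP[? _]; lra.
have YE : (B + (s + h)%:M) - (B + s%:M) = h%:M.
  by rewrite opprD addrACA subrr add0r -raddfB /= addrAC subrr add0r.
have hh : `|(B + (s + h)%:M) - (B + s%:M)| <= 1.
  by rewrite YE; apply: le_trans (norm_scalar_mx3 _) (ltW h1).
have := @rdet_quad R m^-1 1 mV0 ler01 _ _ (shift_posdef m01 (ltW s0) gB) (shift_posdef m01 sh gB)
  (shift_inv_norm m01 (ltW s0) gB) hh.
rewrite YE mul_mx_scalar mxtraceZ -/c0.
rewrite (_ : _ - _ + _ = rdet (B + (s + h)%:M) - rdet (B + s%:M) -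
  h * - (2^-1 * (\tr (invmx (B + s%:M)) * rdet (B + s%:M)))); last by field.
move=> /le_trans; apply.
have r0 : 0 <= rdet (B + s%:M) + rdet (B + (s + h)%:M).
  by apply: addr_ge0; apply/ltW/rdet_gt0/(shift_posdef m01) => //; exact: ltW.
rewrite mulrAC; apply: ler_pM; [exact: mulr_ge0|exact: exprn_ge0| |].
- apply: ler_wpM2l => //.
  have r1 := rdet_dom m01 (ltW s0) gB; have r2 := rdet_dom m01 sh gB.
  have g1 := ler_wpM2l (crd_ge0 m) (gdom_le1 (ltW s0)).
  by have g2 := ler_wpM2l (crd_ge0 m) (gdom_le1 sh); lra.
- rewrite -[h ^+ 2]real_normK ?num_real// lerXn2r ?nnegrE//; exact: norm_scalar_mx3.
Qed.

(** The integrand of the trace is [- d/ds det (B + s)^(-1/2)], and the primitive vanishes at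
    infinity. *)
Lemma tr_Aof B : posdef B -> \tr (Aof B) = rdet B.
Proof.
move=> /posdef_inK[m m01 gB]; have m0 : 0 < m by case/andP: m01.
have mV0 : 0 <= m^-1 by rewrite invr_ge0 ltW.
pose phi (Y : 'M[R]_3) := 2^-1 * (\tr (invmx Y) * rdet Y).
have phiE Y : phi Y = 2^-1 * \sum_i aent Y i i by rewrite /phi mulr_suml.
transitivity (J (fun s => phi (B + s%:M))).
  have d i : dominated (fun s => aent (B + s%:M) i i) by exact: (dominated_aent m01).
  under eq_fun do rewrite phiE.
  rewrite J_Z; last exact: dominated_sum.
  by rewrite J_sum// mulr_sumr; apply: eq_bigr => i _; rewrite AofE.
rewrite /J (@Rintegral_ge0_continuous_FTC2y R _ (fun s => - rdet (B + s%:M)) 0 0).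
- by rewrite sub0r opprK raddf0 addr0.
- move=> s s0; have pY := shift_posdef m01 s0 gB.
  apply: mulr_ge0; first by rewrite invr_ge0.
  by apply: mulr_ge0; [exact: psd_tr (posdef_psd (posdef_inv pY))|exact/ltW/rdet_gt0].
- pose k := 9 * m^-1 ^+ 2 + (9 + 54 * (m^-1 * 1) + 162 * (m^-1 * 1) ^+ 2) * m^-1 ^+ 2.
  have k0 : 0 <= k by rewrite !(mulr_ge0, addr_ge0, exprn_ge0).
  apply: (@shift_within_cont R m m01 phi (2^-1 * (3 * k))) => //; first by rewrite !mulr_ge0//
    invr_ge0.
  move=> Y1 Y2 p1 p2 x1 x2 d; have h := aent_lip mV0 ler01 p1 p2 x1 x2 d.
  rewrite !phiE -mulrBr normrM ger0_norm ?invr_ge0// -!mulrA ler_wpM2l ?invr_ge0// -sumrB.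
  apply: le_trans (ler_norm_sum _ _ _) _.
  apply: le_trans (ler_sum _ (fun i _ => h i i)) _.
  by rewrite sum3E -/k; lra.
- by rewrite -oppr0; apply: cvgN; exact: (rdet_shift_cvg0 m01 gB).
- by move=> s s0; have [] := is_deriveN (rdet_shift_derive m01 gB s0).
- apply: cvgN.
  have /continuous_within_itvcyP[_] : {within `[0, +oo[, continuous (fun s : R => rdet (B + s%:M))}.
    apply: (shift_within_cont m01 _ _ gB); last first.
      by move=> Y1 Y2 p1 p2 x1 x2 d; apply: (rdet_lip mV0 ler01 p1 p2 x1 d).
    by rewrite !(mulr_ge0, addr_ge0, exprn_ge0).
  by [].
- move=> s; rewrite in_itv /= andbT => s0; rewrite derive1E.
  have h := is_deriveN (rdet_shift_derive m01 gB s0).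
  by rewrite (derive_val (is_derive := h)) opprK.
Qed.

(** Both sides come from differentiating [tr A(B + h H) = det (B + h H)^(-1/2)] at [h = 0]: once
    through [Aof_quad], once through [rdet_quad]. *)
Lemma tr_tcontr_Cof B H : posdef B -> sym_mx H ->
  \tr (tcontr (Cof B) H) = 2^-1 * (rdet B * \tr (invmx B *m H)).
Proof.
move=> pB sH; have [m m01 gB] := posdef_inK pB.
have /andP[m0 m1] := m01.
pose m' := m / 2.
have m'01 : 0 < m' <= 1 by rewrite /m'; apply/andP; split; lra.
have m'0 : 0 < m' by case/andP: m'01.
have mV0 : 0 <= m'^-1 by rewrite invr_ge0 ltW.
pose n := `|H|; have n0 : 0 <= n := normr_ge0 _.
pose M := `|B| + n; have M0 : 0 <= M by rewrite addr_ge0.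
(* For [|h| < d] the loss [3 |h H|] of [geI_perturb] is at most [m / 2], so [B + h H] stays above
   [m']. *)
pose d := Num.min 1 (m / (6 * (n + 1))).
have n1 : 0 < 6 * (n + 1) by lra.
have d0 : 0 < d by rewrite lt_min ltr01 divr_gt0.
have KB h : `|h| < d -> inK m' M (B + h *: H).
  rewrite lt_min => /andP[h1]; rewrite ltr_pdivlMr// => hd.
  have hn : `|h *: H| = `|h| * n by rewrite normrZ.
  split.
    have sh : sym_mx (h *: H) by apply/matrixP => i j; rewrite !mxE -{1}sH mxE.
    apply: geI_le (geI_perturb gB sh); rewrite hn /m'.
    by have := mulr_ge0 (normr_ge0 h) n0; have := normr_ge0 h; nra.
  apply: le_trans (ler_normD _ _) _; rewrite lerD2l hn ler_piMl//; exact: ltW.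
have K0 : inK m' M B by have := KB 0; rewrite normr0 scale0r addr0; apply.
have d1 : is_derive (0 : R) 1 (fun h => rdet (B + h *: H)) (- \tr (tcontr (Cof B) H)).
  have [c c0 hq] := Aof_quad m'01 M0.
  apply: (@is_derive_quad _ _ _ _ (3 * c * n ^+ 2) d) => // h hd.
  rewrite add0r scale0r addr0 -!tr_Aof//; last exact: geI_posdef (KB h hd).1.
  have := hq _ _ K0 (KB h hd).
  have -> : B + h *: H - B = h *: H by rewrite addrAC subrr add0r.
  have -> : tcontr (Cof B) (h *: H) = h *: tcontr (Cof B) H.
    apply/matrixP => i j; rewrite !mxE mulr_sumr; apply: eq_bigr => k _.
    by rewrite mulr_sumr; apply: eq_bigr => l _; rewrite mxE; ring.
  set A2 := Aof (B + _); set A1 := Aof B => hA.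
  rewrite (_ : _ - _ - _ = \tr (A2 - A1 + h *: tcontr (Cof B) H)); last first.
    by rewrite mxtraceD mxtraceZ raddfB /= mulrN opprK.
  apply: le_trans (norm_tr3 _) _.
  rewrite -!mulrA ler_pM2l//; apply: le_trans hA _.
  by rewrite normrZ -/n exprMn real_normK ?num_real//; lra.
have d2 : is_derive (0 : R) 1 (fun h => rdet (B + h *: H)) (- (2^-1 * (rdet B * \tr (invmx B *m
  H)))).
  have iB h : `|h| < d -> `|invmx (B + h *: H)| <= m'^-1 by move=> hd; exact: geI_inv_norm (KB h
    hd).1.
  have pBh h : `|h| < d -> posdef (B + h *: H) by move=> hd; exact: geI_posdef (KB h hd).1.
  have iB0 : `|invmx B| <= m'^-1 by exact: geI_inv_norm K0.1.
  set c0 := ((9 + 54 * (m'^-1 * n) + 162 * (m'^-1 * n) ^+ 2) ^+ 2 + (54 + 162 * (m'^-1 * n))) *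
    m'^-1 ^+ 2.
  have c00 : 0 <= c0 by rewrite !(mulr_ge0, addr_ge0, exprn_ge0).
  apply: (@is_derive_quad _ _ _ _ (c0 * n ^+ 2 * (2 * crd m')) d) => // h hd.
  rewrite add0r scale0r addr0.
  have YE : (B + h *: H) - B = h *: H by rewrite addrAC subrr add0r.
  have hn : `|(B + h *: H) - B| = `|h| * n by rewrite YE normrZ.
  have hh : `|(B + h *: H) - B| <= n.
    rewrite hn ler_piMl// ltW//; apply: lt_le_trans hd _; by rewrite ge_min lexx.
  have := @rdet_quad R m'^-1 n mV0 n0 _ _ pB (pBh h hd) iB0 hh.
  rewrite hn YE -scalemxAr mxtraceZ -/c0.
  rewrite (_ : _ - _ + _ = rdet (B + h *: H) - rdet B - h * - (2^-1 * (rdet B * \tr (invmx B *m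
    H))));
    last by field.
  move=> /le_trans; apply.
  rewrite [leRHS](_ : _ = c0 * (`|h| * n) ^+ 2 * (2 * crd m')); last first.
    by rewrite exprMn real_normK ?num_real//; ring.
  apply: ler_wpM2l; first by apply: mulr_ge0 => //; rewrite exprn_ge0// mulr_ge0.
  have s0 := lexx (0 : R).
  have r1 := rdet_dom m'01 s0 K0.1; have r2 := rdet_dom m'01 s0 (KB h hd).1.
  rewrite !raddf0 !addr0 in r1 r2.
  by have g1 := ler_wpM2l (crd_ge0 m') (gdom_le1 s0); lra.
have := derive_val (is_derive := d1); rewrite (derive_val (is_derive := d2)).
by move=> /oppr_inj.
Qed.

End Traces.

(** * The inverse tensor and the vector field *)

Section InverseTensor.
Variable R : realType.
Implicit Types B H N E : 'M[R]_3.

Lemma tcontrD (T : tensor4 R) H N : tcontr T (H + N) = tcontr T H + tcontr T N.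
Proof.
apply/matrixP => i j; rewrite !mxE -big_split; apply: eq_bigr => k _ /=.
by rewrite -big_split; apply: eq_bigr => l _ /=; rewrite mxE mulrDr.
Qed.

Lemma tcontrZ (T : tensor4 R) a H : tcontr T (a *: H) = a *: tcontr T H.
Proof.
apply/matrixP => i j; rewrite !mxE mulr_sumr; apply: eq_bigr => k _.
by rewrite mulr_sumr; apply: eq_bigr => l _; rewrite mxE mulrCA.
Qed.

Lemma tcontr_norm (T : tensor4 R) c H : 0 <= c -> (forall i j k l, `|T i j k l| <= c) ->
  `|tcontr T H| <= 9 * c * `|H|.
Proof.
move=> c0 Tc; apply: mx_norm_le => [|i j]; first by rewrite !mulr_ge0.
have h k l : `|T i j k l * H k l| <= c * `|H|.
  by rewrite normrM ler_pM// mx_entry_le.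
rewrite mxE; apply: le_trans (ler_norm_sum _ _ _) _.
apply: le_trans (ler_sum _ (fun k _ => ler_norm_sum _ _ _)) _.
apply: le_trans (ler_sum _ (fun k _ => ler_sum _ (fun l _ => h k l))) _.
by rewrite !sum3E; lra.
Qed.

(* The antisymmetric summand makes the map invertible on all matrices, not only symmetric ones. *)
Definition Lmap B H : 'M[R]_3 := tcontr (Cof B) H + (H - H^T).

Lemma Lmap_is_linear B : linear (Lmap B).
Proof.
move=> a H N; rewrite /Lmap tcontrD tcontrZ; apply/matrixP => i j; rewrite !mxE; ring.
Qed.

HB.instance Definition _ B :=
  GRing.isLinear.Build R 'M[R]_3 'M[R]_3 *:%R (Lmap B) (Lmap_is_linear B).

Definition Dop B N : 'M[R]_3 := vec_mx (mxvec N *m invmx (lin_mx (Lmap B))).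

Lemma Dop_is_linear B : linear (Dop B).
Proof. by move=> a H N; rewrite /Dop linearP mulmxDl -scalemxAl linearP. Qed.

Lemma DopZ B a N : Dop B (a *: N) = a *: Dop B N.
Proof.
have D0 : Dop B 0 = 0 by rewrite /Dop !raddf0 mul0mx raddf0.
by have := Dop_is_linear B a N 0; rewrite D0 !addr0.
Qed.

HB.instance Definition _ B :=
  GRing.isLinear.Build R 'M[R]_3 'M[R]_3 *:%R (Dop B) (Dop_is_linear B).

(** The two summands are the symmetric and the antisymmetric part of [Lmap B H], so both vanish;
    then [H] is symmetric and coercivity applies. *)
Lemma Lmap_inj B H : posdef B -> Lmap B H = 0 -> H = 0.
Proof.
move=> pB; have [m m01 gB] := posdef_inK pB => LH.
have sC := tcontr_Cof_sym m01 H gB.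
have LH2 : tcontr (Cof B) H + (H^T - H) = 0.
  have := congr1 trmx LH; rewrite /Lmap !raddfD /= raddfN /= trmxK sC trmx0.
  by [].
have C0 : tcontr (Cof B) H = 0.
  have : 2 *: tcontr (Cof B) H = 0.
    rewrite -[RHS](addr0 0) -{1}LH -LH2 /Lmap; apply/matrixP => i j; rewrite !mxE; ring.
  by move/eqP; rewrite scaler_eq0 pnatr_eq0 /= => /eqP.
have sH : sym_mx H.
  by move: LH2; rewrite C0 add0r => /eqP; rewrite subr_eq0 => /eqP.
have := Cof_coercive m01 (normr_ge0 B) (conj gB (lexx _)) sH.
rewrite C0 big1 => [|i _]; last by rewrite big1// => j _; rewrite mxE mulr0.
move=> h; apply/eqP; rewrite -normr_le0.
have c0 := ccoe_gt0 (normr_ge0 B).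
have {h} : `|H| ^+ 2 <= 0 by rewrite -(pmulr_rle0 _ c0).
by rewrite real_exprn_even_le0 ?num_real//= => /eqP ->.
Qed.

Lemma Lmap_unit B : posdef B -> lin_mx (Lmap B) \in unitmx.
Proof.
move=> pB; rewrite unitmxE unitfE; apply/negP => /det0P[v v0].
rewrite -[v]vec_mxK mul_vec_lin => /eqP; rewrite -(raddf0 mxvec) => /eqP /(can_inj mxvecK)
  /(Lmap_inj pB) h.
by move: v0; rewrite -[v]vec_mxK h raddf0 eqxx.
Qed.

Lemma Lmap_Dop B N : posdef B -> Lmap B (Dop B N) = N.
Proof.
move=> pB; apply: (can_inj mxvecK); rewrite -mul_vec_lin /Dop vec_mxK.
by rewrite -mulmxA mulVmx ?mulmx1// Lmap_unit.
Qed.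

Lemma Dop_Lmap B H : posdef B -> Dop B (Lmap B H) = H.
Proof. by move=> pB; rewrite /Dop -mul_vec_lin mulmxK ?mxvecK// Lmap_unit. Qed.

Lemma DopP B N : posdef B -> sym_mx N ->
  sym_mx (Dop B N) /\ tcontr (Cof B) (Dop B N) = N.
Proof.
move=> pB sN; have [m m01 gB] := posdef_inK pB.
have := Lmap_Dop N pB; set H := Dop B N; rewrite /Lmap => LH.
have sC := tcontr_Cof_sym m01 H gB.
have LH2 : tcontr (Cof B) H + (H^T - H) = N.
  by have := congr1 trmx LH; rewrite !raddfD /= raddfN /= trmxK sC sN.
have h : H - H^T = 0.
  have : 2 *: (H - H^T) = 0.
    by rewrite -[RHS](subrr N) -{1}LH -LH2; apply/matrixP => i j; rewrite !mxE; ring.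
  by move/eqP; rewrite scaler_eq0 pnatr_eq0 /= => /eqP.
split; last by move: LH; rewrite h addr0.
by apply/esym/eqP; rewrite -subr_eq0 h.
Qed.

Lemma Dop_tcontr B H : posdef B -> sym_mx H -> Dop B (tcontr (Cof B) H) = H.
Proof.
move=> pB sH; rewrite -[RHS](Dop_Lmap H pB) /Lmap; congr (Dop B _).
by rewrite sH subrr addr0.
Qed.

(** The components are read off on the symmetrized unit matrices [S k l], which gives both index
    symmetries at once. *)
Lemma is_Dof_Dop B : posdef B ->
  exists2 D, is_Dof B D & forall N, sym_mx N -> tcontr D N = Dop B N.
Proof.
move=> pB; have [m m01 gB] := posdef_inK pB.
pose S k l : 'M[R]_3 := 2^-1 *: (delta_mx k l + delta_mx l k).
have sS k l : sym_mx (S k l).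
  by apply/matrixP => i j; rewrite !mxE ![(j == _) && _]andbC addrC.
pose D : tensor4 R := fun i j k l => Dop B (S k l) i j.
have DE N : sym_mx N -> tcontr D N = Dop B N.
  move=> sN; have NE : N = \sum_k \sum_l N k l *: S k l.
    have e1 : \sum_k \sum_l N k l *: delta_mx k l = N by rewrite -matrix_sum_delta.
    have e2 : \sum_k \sum_l N k l *: delta_mx l k = N.
      rewrite exchange_big -[RHS]e1; apply: eq_bigr => k _; apply: eq_bigr => l _.
      by rewrite -{1}sN mxE.
    have SE k l : N k l *: S k l = 2^-1 *: (N k l *: delta_mx k l + N k l *: delta_mx l k).
      by rewrite /S scalerA mulrC -scalerA scalerDr.
    under eq_bigr => k _ do under eq_bigr => l _ do rewrite SE.
    under eq_bigr => k _ do rewrite -scaler_sumr big_split /=.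
    rewrite -scaler_sumr big_split /= e1 e2.
    by apply/matrixP => i j; rewrite !mxE; field.
  rewrite [in RHS]NE raddf_sum /=; apply/matrixP => i j; rewrite mxE summxE; apply: eq_bigr => k _.
  by rewrite raddf_sum /= summxE; apply: eq_bigr => l _; rewrite DopZ [RHS]mxE mulrC.
exists D => //; split=> [i j k l|]; last split=> [i j k l|H sH].
- by rewrite /D -{1}(DopP pB (sS k l)).1 mxE.
- by rewrite /D /S addrC.
- rewrite !DE//; last exact: (tcontr_Cof_sym m01).
  by split; [exact: (DopP pB sH).2|exact: Dop_tcontr].
Qed.

(** * Bounds for the inverse tensor and Lipschitz continuity of the field on [K] *)

Section Bounds.
Variables m M : R.
Hypothesis m01 : 0 < m <= 1.
Hypothesis M0 : 0 <= M.
Let m0 : 0 < m. Proof. by case/andP: m01. Qed.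
Let pd B : inK m M B -> posdef B. Proof. by case=> /(geI_posdef m0). Qed.
Let c0 : 0 < ccoe M := ccoe_gt0 M0.

(** With [H = D(B):N], coercivity gives [ccoe |H|^2 <= H:N], a sum of nine products. *)
Lemma Dop_le B N : inK m M B -> sym_mx N -> `|Dop B N| <= 9 / ccoe M * `|N|.
Proof.
move=> KB sN; have [sH HE] := DopP (pd KB) sN; set H := Dop B N in sH HE *.
have := Cof_coercive m01 M0 KB sH; rewrite HE => h.
have h2 : ccoe M * `|H| ^+ 2 <= 9 * `|H| * `|N|.
  apply: le_trans h _.
  have e i j : H i j * N i j <= `|H| * `|N|.
    by apply: le_trans (ler_norm _) _; rewrite normrM ler_pM// mx_entry_le.
  apply: le_trans (ler_sum _ (fun i _ => ler_sum _ (fun j _ => e i j))) _.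
  by rewrite !sum3E; lra.
have [->|Hn0] := eqVneq H 0; first by rewrite normr0 !mulr_ge0// invr_ge0 ltW.
have H0 : 0 < `|H| by rewrite normr_gt0.
rewrite mulrAC ler_pdivlMr// mulrC -(ler_pM2l H0).
by move: h2; rewrite expr2; lra.
Qed.

(** With [H = D(B2):N2] and [G = D(B1):N1], one has [H - G = D(B2):(N2 - N1 - (C(B2) -
    C(B1)):G)]. *)
Lemma Dop_lip : exists2 L, 0 <= L & forall B1 B2 N1 N2, inK m M B1 -> inK m M B2 ->
  sym_mx N1 -> sym_mx N2 ->
  `|Dop B2 N2 - Dop B1 N1| <= L * (`|N2 - N1| + `|N1| * `|B2 - B1|).
Proof.
have [LC LC0 hC] := Cof_lip m01 M0.
have [k kE k0] : exists2 k, k = 9 / ccoe M & 0 <= k.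
  by exists (9 / ccoe M) => //; rewrite divr_ge0// ltW.
exists (k + k * (9 * LC * k)); first by rewrite addr_ge0// !mulr_ge0.
move=> B1 B2 N1 N2 K1 K2 s1 s2.
have [sG GE] := DopP (pd K1) s1; have [sH HE] := DopP (pd K2) s2.
have Gk := Dop_le K1 s1.
move: (Dop B2 N2) (Dop B1 N1) sH HE sG GE Gk => H G sH HE sG GE Gk.
pose T : tensor4 R := fun i j k l => Cof B2 i j k l - Cof B1 i j k l.
have TE : tcontr T G = tcontr (Cof B2) G - N1.
  rewrite -GE /T; move: (Cof B1) (Cof B2) => C1 C2.
  apply/matrixP => i j; rewrite !mxE -sumrB; apply: eq_bigr => a _.
  by rewrite -sumrB; apply: eq_bigr => b _; rewrite mulrBl.
have sN : sym_mx (N2 - N1 - tcontr T G).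
  by rewrite TE /sym_mx !raddfB /= s1 s2 (tcontr_Cof_sym m01)//; exact: K2.1.
have sHG : sym_mx (H - G) by rewrite /sym_mx raddfB /= sH sG.
have -> : H - G = Dop B2 (N2 - N1 - tcontr T G).
  rewrite -[LHS](Dop_tcontr (pd K2) sHG); congr (Dop B2 _).
  by rewrite tcontrD -[- G]scaleN1r tcontrZ scaleN1r HE TE opprB addrA subrK.
apply: le_trans (Dop_le K2 sN) _; rewrite -kE.
have t : `|tcontr T G| <= 9 * (LC * `|B2 - B1|) * (k * `|N1|).
  apply: le_trans (tcontr_norm (c := LC * `|B2 - B1|) _ _ _) _; first exact: mulr_ge0.
    by move=> *; exact: hC.
  by apply: ler_wpM2l; [rewrite !mulr_ge0|rewrite kE].
have t2 : `|N2 - N1 - tcontr T G| <= `|N2 - N1| + 9 * (LC * `|B2 - B1|) * (k * `|N1|).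
  by apply: le_trans (ler_normB _ _) _; rewrite lerD2l.
apply: le_trans (ler_wpM2l k0 t2) _.
have p1 := mulr_ge0 (normr_ge0 N1) (normr_ge0 (B2 - B1)).
have p2 := mulr_ge0 k0 p1.
have p3 : 0 <= k * (9 * LC * k) * `|N2 - N1| by rewrite !mulr_ge0.
rewrite [leRHS](_ : _ = k * (`|N2 - N1| + 9 * (LC * `|B2 - B1|) * (k * `|N1|))
  + k * (`|N1| * `|B2 - B1|) + k * (9 * LC * k) * `|N2 - N1|); last by ring.
by lra.
Qed.

Definition source N B : 'M[R]_3 := 2 *: N + (3 * \tr N) *: Aof B.

Definition field E N B : 'M[R]_3 := - (B *m E + E^T *m B) - Dop B (source N B).

Lemma source_sym N B : geI m B -> sym_mx N -> sym_mx (source N B).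
Proof.
move=> gB sN; have sA := Aof_sym m01 gB; rewrite /source; move: (Aof B) sA => A sA.
by apply/matrixP => i j; rewrite !mxE -{1}sN -{1}sA !mxE.
Qed.

Lemma field_sym E N B : inK m M B -> sym_mx N -> sym_mx (field E N B).
Proof.
move=> KB sN; have sS := source_sym KB.1 sN; have [sD _] := DopP (pd KB) sS.
rewrite /sym_mx /field raddfB /= raddfN /= raddfD /= !trmx_mul trmxK sD KB.1.1.
by rewrite (addrC (E^T *m B)).
Qed.

Variables e d : R.
Hypotheses (e0 : 0 <= e) (d0 : 0 <= d).

(** Time enters the field only through [E] and [N]. Treating these as variables next to [B] makes
    the extended field Lipschitz in all three, hence continuous in time along continuous data. *)
Definition inP E N B := [/\ `|E| <= e, `|N| <= d, sym_mx N & inK m M B].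

Lemma field_lip : exists2 L, 0 <= L & forall E1 N1 B1 E2 N2 B2,
  inP E1 N1 B1 -> inP E2 N2 B2 ->
  `|field E2 N2 B2 - field E1 N1 B1| <= L * (`|E2 - E1| + `|N2 - N1| + `|B2 - B1|).
Proof.
have [LA LA0 hA] := Aof_lip m01 M0; have [a a0 ha] := Aof_le M m01.
have [LD LD0 hD] := Dop_lip.
exists (6 * e + 6 * M + LD * (2 + 9 * a + 9 * d * LA + (2 * d + 9 * d * a))).
  by rewrite !(mulr_ge0, addr_ge0).
move=> E1 N1 B1 E2 N2 B2 [e1 n1 s1 K1] [e2 n2 s2 K2].
set dE := `|E2 - E1|; set dN := `|N2 - N1|; set dB := `|B2 - B1|.
have dE0 : 0 <= dE := normr_ge0 _; have dN0 : 0 <= dN := normr_ge0 _.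
have dB0 : 0 <= dB := normr_ge0 _.
have W1 : `|B2 *m E2 - B1 *m E1| <= 3 * dB * e + 3 * M * dE.
  rewrite (_ : _ - _ = (B2 - B1) *m E2 + B1 *m (E2 - E1)); last first.
    by rewrite mulmxBl mulmxBr addrA subrK.
  apply: le_trans (ler_normD _ _) _; apply: lerD; apply: le_trans (norm_mulmx3 _ _) _.
    by rewrite ler_wpM2l ?mulr_ge0.
  by rewrite ler_wpM2r// ler_pM2l//; exact: K1.2.
have W2 : `|E2^T *m B2 - E1^T *m B1| <= 3 * dB * e + 3 * M * dE.
  by rewrite -norm_trmx raddfB /= !trmx_mul !trmxK K1.1.1 K2.1.1.
have S1 : `|source N1 B1| <= 2 * d + 9 * d * a.
  apply: le_trans (ler_normD _ _) _; rewrite !normrZ; apply: lerD.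
    by rewrite ger0_norm// ler_pM2l.
  apply: ler_pM => //; last exact: ha.
  by rewrite ?normrM [`|3|]ger0_norm//; have := norm_tr3 N1; lra.
have S2 : `|source N2 B2 - source N1 B1| <= 2 * dN + 9 * dN * a + 9 * d * (LA * dB).
  rewrite (_ : _ - _ = 2 *: (N2 - N1) + (3 * \tr (N2 - N1)) *: Aof B2
      + (3 * \tr N1) *: (Aof B2 - Aof B1)); last first.
    rewrite /source raddfB /=; move: (Aof B1) (Aof B2) => A1 A2.
    by apply/matrixP => i j; rewrite !mxE; ring.
  apply: le_trans (ler_normD _ _) _; apply: lerD.
    apply: le_trans (ler_normD _ _) _; rewrite !normrZ; apply: lerD.
      by rewrite ger0_norm.
    apply: ler_pM => //; last exact: ha.
    by rewrite ?normrM [`|3|]ger0_norm//; have := norm_tr3 (N2 - N1); rewrite -/dN; lra.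
  rewrite normrZ; apply: ler_pM => //; last exact: hA.
  by rewrite ?normrM [`|3|]ger0_norm//; have := norm_tr3 N1; lra.
have Dd := hD _ _ _ _ K1 K2 (source_sym K1.1 s1) (source_sym K2.1 s2).
rewrite (_ : _ - _ = - (B2 *m E2 - B1 *m E1) - (E2^T *m B2 - E1^T *m B1)
   - (Dop B2 (source N2 B2) - Dop B1 (source N1 B1))); last first.
  rewrite /field; move: (Dop B2 _) (Dop B1 _) (B2 *m _) (B1 *m _) (_ *m B2) (_ *m B1) => D2 D1 x2
    x1 y2 y1.
  by apply/matrixP => i j; rewrite !mxE; ring.
apply: le_trans (ler_normB _ _) _; apply: le_trans (lerD (ler_normB _ _) (lexx _)) _.
rewrite normrN -/dB in Dd *.
have S3 : `|source N1 B1| * dB <= (2 * d + 9 * d * a) * dB by rewrite ler_wpM2r.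
have Dd2 : `|Dop B2 (source N2 B2) - Dop B1 (source N1 B1)| <=
  LD * (2 * dN + 9 * dN * a + 9 * d * (LA * dB) + (2 * d + 9 * d * a) * dB).
  by apply: le_trans Dd _; rewrite ler_wpM2l// lerD.
apply: le_trans (lerD (lerD W1 W2) Dd2) _.
pose k1 := 2 + 9 * a; pose k2 := 9 * d * LA + (2 * d + 9 * d * a).
have q1 : 0 <= k1 by rewrite !(mulr_ge0, addr_ge0).
have q2 : 0 <= k2 by rewrite !(mulr_ge0, addr_ge0).
rewrite -subr_ge0 [leRHS](_ : _ = 6 * e * (dE + dN) + 6 * M * (dN + dB) + LD * k1 * (dE + dB)
  + LD * k2 * (dE + dN)); last by rewrite /k1 /k2; ring.
by rewrite !(addr_ge0 _ _, mulr_ge0 _ _).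
Qed.

End Bounds.
End InverseTensor.

(** * Global solutions of Lipschitz differential equations *)

Section RealCalculus.
Variable R : realType.

Lemma nonincr_le (f df : R -> R) (a b : R) : a <= b -> {within `[a, b], continuous f} ->
  (forall x, a < x < b -> is_derive x 1 f (df x)) ->
  (forall x, a < x < b -> df x <= 0) -> f b <= f a.
Proof.
rewrite le_eqVlt => /predU1P[->//|ab] cf dfP df0.
have dP x : x \in `]a, b[%R -> is_derive x 1 f (df x) by rewrite in_itv /=; exact: dfP.
have [c + e] := MVT ab dP cf; rewrite in_itv /= => /df0 dc; rewrite -subr_le0 e.
by apply: mulr_le0_ge0 => //; rewrite subr_ge0 ltW.
Qed.

Lemma is_derive_continuous (V : normedModType R) (f : R -> V) (t : R) (l : V) :
  is_derive t 1 f l -> {for t, continuous f}.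
Proof. by case=> /derivable1_diffP/differentiable_continuous. Qed.

Lemma is_derive_mxP m n (f : R -> 'M[R]_(m, n)) (t : R) (D : 'M[R]_(m, n)) :
  is_derive t 1 f D <-> forall i j, is_derive t 1 (fun x => f x i j) (D i j).
Proof.
split=> [[df fE] i j|h].
  have dfe : derivable (fun x => f x i j) t 1 by move/derivable_mxP: df.
  by split=> //; rewrite -fE derive_mx// mxE.
have df : derivable f t 1 by apply/derivable_mxP => i j; case: (h i j).
split=> //; rewrite derive_mx//; apply/matrixP => i j; rewrite mxE.
by case: (h i j).
Qed.

Lemma entry_continuous m n (f : R -> 'M[R]_(m, n)) (t : R) i j :
  {for t, continuous f} -> {for t, continuous (fun x => f x i j)}.
Proof.
move=> cf; apply/cvgrPdist_lt => e e0.
have /cvgrPdist_lt/(_ e e0) := cf; apply: filterS => s; apply: le_lt_trans.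
by have := mx_entry_le (f t - f s) i j; rewrite !mxE.
Qed.

(** Integration starts at -1 so that 0 is an interior point and the derivative there is two-sided;
    the subtraction normalizes the value at 0. *)
Definition prim (h : R -> R) (x : R) : R :=
  Rintegral (@lebesgue_measure R) `[-1, x]%classic h - Rintegral (@lebesgue_measure R) `[-1,
    0]%classic h.

Lemma prim0 h : prim h 0 = 0.
Proof. by rewrite /prim subrr. Qed.

Lemma prim_derive h (t : R) : continuous h -> - 1 < t -> is_derive t 1 (prim h) (h t).
Proof.
move=> ch t1.
have ih : (@lebesgue_measure R).-integrable `[-1, t + 1] (EFin \o h).
  apply: continuous_compact_integrable; first exact: segment_compact.
  exact: continuous_subspaceT.
have [|df fE] := @continuous_FTC1_closed R h (-1) t (t + 1) _ ih t1 (ch t).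
  by rewrite ltrDl.
rewrite derive1E in fE.
have d1 := DeriveDef df fE.
by rewrite -[h t]subr0; apply: is_deriveB d1 (is_derive_cst _ _ _).
Qed.

Lemma geometric_limit (u : nat -> R) (K : R) :
  (forall n, `|u n.+1 - u n| <= K * 2^-1 ^+ n) ->
  exists l, forall n, `|l - u n| <= 2 * K * 2^-1 ^+ n.
Proof.
move=> hu.
have K0 : 0 <= K by have := hu 0%N; rewrite expr0 mulr1; apply: le_trans.
pose z n := K * 2^-1 ^+ n.
have zS n : z n = 2 * z n.+1 by rewrite /z exprS; field.
have z0 n : 0 <= z n by rewrite /z mulr_ge0// exprn_ge0// invr_ge0.
(* Since [z n = 2 z (n + 1)], the intervals [[a n, b n]] are nested, and the supremum of the left
   ends lies in all of them. *)
pose a n := u n - 2 * z n; pose b n := u n + 2 * z n.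
have hu2 n : - z n <= u n.+1 - u n <= z n by rewrite -ler_norml; exact: hu.
have aS n : a n <= a n.+1.
  by rewrite /a; have /andP[? ?] := hu2 n; have := zS n; lra.
have bS n : b n.+1 <= b n.
  by rewrite /b; have /andP[? ?] := hu2 n; have := zS n; lra.
have amono n k : a n <= a (n + k)%N.
  by elim: k => [|k IH]; rewrite ?addn0// addnS (le_trans IH).
have bmono n k : b (n + k)%N <= b n.
  by elim: k => [|k IH]; rewrite ?addn0// addnS (le_trans _ IH).
have ab n k : a n <= b k.
  apply: le_trans (amono n k) _; apply: le_trans (_ : b (n + k)%N <= _).
    by rewrite /a /b; have := z0 (n + k)%N; lra.
  by rewrite addnC; exact: bmono.
pose A := [set a n | n in [set: nat]].
have hA : has_sup A.
  split; first by exists (a 0%N); exists 0%N.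
  by exists (b 0%N) => _ [n _ <-].
exists (sup A) => n.
have h1 : a n <= sup A by apply: sup_upper_bound => //; exists n.
have h2 : sup A <= b n.
  by apply: sup_le_ub; [case: hA|move=> _ [k _ <-]].
rewrite -[2 * K * _]mulrA -/(z n) ler_norml; move: h1 h2; rewrite /a /b => h1 h2.
by apply/andP; split; lra.
Qed.

Lemma half_exp_small (K e : R) : 0 < e -> exists n, K * 2^-1 ^+ n < e.
Proof.
move=> e0.
have [K0|K0] := leP K 0.
  by exists 0%N; rewrite expr0 mulr1 (le_lt_trans K0).
exists (Num.truncn (K / e)).+1.
have h1 : K / e < (Num.truncn (K / e)).+1%:R by rewrite truncnS_gt.
set n := _.+1 in h1 *.
have h2 : n%:R <= 2 ^+ n :> R by rewrite -natrX ler_nat ltnW// ltn_expl.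
rewrite exprVn ltr_pdivrMr ?exprn_gt0// mulrC -ltr_pdivrMr//.
exact: lt_le_trans h1 h2.
Qed.

Lemma max0_lip (s t : R) : `|Num.max s 0 - Num.max t 0| <= `|s - t|.
Proof.
rewrite /Num.max; case: ltP => h1; case: ltP => h2.
- by rewrite subrr normr0.
- by rewrite sub0r normrN ger0_norm// ler_normr; apply/orP; right; lra.
- by rewrite subr0 ger0_norm// ler_normr; apply/orP; left; lra.
- by [].
Qed.

End RealCalculus.

(** * Picard iteration with an exponential weight *)

Section Picard.
Variables (R : realType) (F : R -> 'M[R]_3 -> 'M[R]_3) (x0 : 'M[R]_3) (L b : R).
Hypothesis L0 : 0 < L.
Hypothesis F_lip : forall t x y, `|F t x - F t y| <= L * `|x - y|.
Hypothesis F_cont : forall X : R -> 'M[R]_3, continuous X -> continuous (fun t => F t (X t)).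
Hypothesis F_bound : forall t, `|F t x0| <= b.

Let V := 'M[R]_3.

Definition primx (h : R -> V) (t : R) : V := \matrix_(i, j) prim (fun s => h s i j) t.

Lemma primx_derive h (t : R) : continuous h -> - 1 < t -> is_derive t 1 (primx h) (h t).
Proof.
move=> ch t1; apply/is_derive_mxP => i j.
rewrite (_ : (fun x => _) = prim (fun s => h s i j)); last by apply/funext => s; rewrite mxE.
by apply: prim_derive => // s; apply: entry_continuous; exact: ch.
Qed.

(** With rate [2 L], each Picard step halves the weighted distance on the whole half line, so no
    local solutions have to be glued. *)
Let w (s : R) : R := expR (2 * L * s).

Let w_derive (s : R) : is_derive s 1 w (2 * L * w s).
Proof.
have d1 : is_derive s 1 (fun x : R => 2 * L * x) (2 * L).
  by rewrite -[X in is_derive _ _ _ X]mulr1; exact: (is_deriveZ (f := id)).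
rewrite [X in is_derive _ _ _ X]mulrC.
exact: (@is_derive1_comp R expR (fun x => 2 * L * x) s _ _ (is_derive_expR _) d1).
Qed.

Let w0 : w 0 = 1. Proof. by rewrite /w mulr0 expR0. Qed.
Let w_gt0 s : 0 < w s. Proof. exact: expR_gt0. Qed.

(** [2 L c w] is the derivative of [c w], so each entry of [X - Y] minus [c w] is nonincreasing;
    exchanging [X] and [Y] gives the other sign. *)
Let compare_ode (X Y p q : R -> V) (c : R) : 0 <= c ->
  (forall s : R, 0 <= s -> is_derive s 1 X (p s)) -> (forall s : R, 0 <= s -> is_derive s 1 Y (q
    s)) ->
  X 0 = Y 0 -> (forall s, 0 <= s -> `|p s - q s| <= 2 * L * c * w s) ->
  forall t, 0 <= t -> `|X t - Y t| <= c * w t.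
Proof.
move=> c0 dX dY XY0 hpq t t0.
apply: mx_norm_le => [|i j]; first by rewrite mulr_ge0// ltW.
have key (X' Y' p' q' : R -> V) :
  (forall s : R, 0 <= s -> is_derive s 1 X' (p' s)) -> (forall s : R, 0 <= s -> is_derive s 1 Y'
    (q' s)) ->
  X' 0 = Y' 0 -> (forall s, 0 <= s -> `|p' s - q' s| <= 2 * L * c * w s) ->
  X' t i j - Y' t i j <= c * w t.
  move=> dX' dY' e0 h.
  pose g s := X' s i j - Y' s i j - c * w s.
  have dg (s : R) : 0 <= s -> is_derive s 1 g (p' s i j - q' s i j - c * (2 * L * w s)).
    move=> s0; have d1 := (is_derive_mxP _ _ _).1 (dX' s s0) i j.
    have d2 := (is_derive_mxP _ _ _).1 (dY' s s0) i j.
    exact: is_deriveB (is_deriveB d1 d2) (is_deriveZ c (w_derive s)).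
  have : g t <= g 0.
    apply: (@nonincr_le _ g (fun s => p' s i j - q' s i j - c * (2 * L * w s))) => //.
    - apply: derivable_within_continuous => s; rewrite in_itv /= => /andP[s0 _].
      by have [] := dg s s0.
    - by move=> s /andP[/ltW/dg].
    - move=> s /andP[/ltW s0 _]; have := mx_entry_le (p' s - q' s) i j; rewrite mxE [(- _ : V) i
      j]mxE.
      by move=> /le_trans/(_ (h s s0)); rewrite ler_norml => /andP[_]; lra.
  by rewrite /g e0 subrr w0; lra.
rewrite mxE [(- _ : V) i j]mxE ler_norml; apply/andP; split; last exact: key dX dY XY0 hpq.
have := key Y X q p dY dX (esym XY0) _; rewrite lerNl opprB; apply.
by move=> s s0; rewrite distrC; exact: hpq.
Qed.

(** Freezing at time 0 makes the iterates continuous on the whole line, although they are controlled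
    only for nonnegative times. *)
Let fr (X : R -> V) (s : R) : V := X (Num.max s 0).

Let fr_cont (X p : R -> V) : (forall s : R, 0 <= s -> is_derive s 1 X (p s)) -> continuous (fr X).
Proof.
move=> dX s; have m0 : 0 <= Num.max s 0 by rewrite le_max lexx orbT.
have := is_derive_continuous (dX _ m0) => /cvgrPdist_lt cX.
apply/cvgrPdist_lt => e e0.
have [d /= d0 hd] := cX e e0.
exists d => // s' /= ss'; apply: hd => /=; apply: le_lt_trans ss'.
exact: max0_lip.
Qed.

Fixpoint iterate (n : nat) : R -> V :=
  if n is k.+1 then fun t => x0 + primx (fun s => F s (fr (iterate k) s)) t else fun=> x0.

Let primx0 h : primx h 0 = 0.
Proof. by apply/matrixP => i j; rewrite !mxE prim0. Qed.

Let step_derive (X : R -> V) (t : R) : continuous (fr X) -> 0 <= t ->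
  is_derive t 1 (fun t => x0 + primx (fun s => F s (fr X s)) t) (F t (fr X t)).
Proof.
move=> cX t0; rewrite -[F t _]add0r.
apply: (is_deriveD (f := cst x0)); apply: (primx_derive (F_cont cX)).
by apply: lt_le_trans t0; rewrite oppr_lt0.
Qed.

Let iterate_cont n : continuous (fr (iterate n)).
Proof.
elim: n => [|n IH]; first by move=> s; exact: cvg_cst.
by apply: (@fr_cont _ (fun s => F s (fr (iterate n) s))) => s s0; exact: step_derive.
Qed.

Let fr_id X s : 0 <= s -> fr X s = X s.
Proof. by move=> s0; rewrite /fr max_l. Qed.

Let b0 : 0 <= b. Proof. exact: le_trans (F_bound 0). Qed.
(** Chosen so that [2 L c = b], the bound on the field at the starting point. *)
Let c := b / (2 * L).
Let c0 : 0 <= c. Proof. by rewrite divr_ge0// mulr_ge0// ltW. Qed.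

Let iterate_diff n t : 0 <= t -> `|iterate n.+1 t - iterate n t| <= c * 2^-1 ^+ n * w t.
Proof.
elim: n t => [|n IH] t t0.
  apply: (@compare_ode _ _ (fun s => F s (fr (iterate 0) s)) (fun=> 0)) => //.
  - by rewrite mulr_ge0// exprn_ge0.
  - by move=> s s0; exact: (@step_derive (iterate 0) s (@iterate_cont 0) s0).
  - by rewrite /= primx0 addr0.
  - move=> s s0; rewrite subr0 /fr /= expr0 mulr1.
    rewrite (_ : 2 * L * c = b); last by rewrite /c; field; rewrite gt_eqF.
    apply: le_trans (F_bound s) _; rewrite ler_peMr//.
    by rewrite -[leLHS]expR0 ler_expR mulr_ge0// mulr_ge0// ltW.
apply: (@compare_ode _ _ (fun s => F s (fr (iterate n.+1) s)) (fun s => F s (fr (iterate n) s))) =>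
  //.
- by rewrite mulr_ge0// exprn_ge0// invr_ge0.
- by move=> s s0; exact: (@step_derive (iterate n.+1) s (@iterate_cont n.+1) s0).
- by move=> s s0; exact: (@step_derive (iterate n) s (@iterate_cont n) s0).
- by rewrite /= !primx0.
- move=> s s0; apply: le_trans (F_lip _ _ _) _; rewrite !fr_id//.
  rewrite (_ : 2 * L * _ * _ = L * (c * 2^-1 ^+ n * w s)); last by rewrite exprS; field.
  by rewrite ler_pM2l// IH.
Qed.

Lemma ode_global : exists Y : R -> V, Y 0 = x0 /\ forall t : R, 0 <= t -> is_derive t 1 Y (F t (Y
  t)).
Proof.
have ex t i j : exists l, 0 <= t -> forall n, `|l - iterate n t i j| <= 2 * (c * w t) * 2^-1 ^+ n.
  have [t0|t0] := leP 0 t; last by exists 0.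
  have [|l hl] := @geometric_limit _ (fun n => iterate n t i j) (c * w t); last by exists l.
  move=> n; rewrite mulrAC; apply: le_trans (iterate_diff n t0).
  by have := mx_entry_le (iterate n.+1 t - iterate n t) i j; rewrite mxE [(- _ : V) i j]mxE.
pose X t : V := \matrix_(i, j) sval (cid (ex t i j)).
have hX n t : 0 <= t -> `|X t - iterate n t| <= 2 * (c * w t) * 2^-1 ^+ n.
  move=> t0; apply: mx_norm_le => [|i j].
    by rewrite mulr_ge0 ?exprn_ge0 ?invr_ge0// mulr_ge0// mulr_ge0// ltW.
  by rewrite mxE [(- _ : V) i j]mxE mxE; exact: (svalP (cid (ex t i j))).
have cX : continuous (fr X).
  move=> s; apply/cvgrPdist_lt => e e0.
  (* The weight increases, so its value at [t1] makes the convergence uniform for times within 1 of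
     [s]. *)
  pose t1 := Num.max s 0 + 1.
  have [n hn] := half_exp_small (2 * (c * w t1)) (e := e / 4) (divr_gt0 e0 (ltr0n _ 4)).
  have hw s' : `|s - s'| < 1 -> `|fr X s' - fr (iterate n) s'| < e / 4.
    move=> ss'; have m0 : 0 <= Num.max s' 0 by rewrite le_max lexx orbT.
    apply: le_lt_trans hn; apply: le_trans (hX n _ m0) _.
    rewrite ler_wpM2r ?exprn_ge0 ?invr_ge0// ler_pM2l// ler_wpM2l//.
    rewrite ler_expR ler_pM2l ?mulr_gt0// /t1 ge_max.
    have := le_max s s 0; rewrite lexx /= => /esym h1; have h2 : 0 <= Num.max s 0 by rewrite le_max
      lexx orbT.
    move: ss'; rewrite ltr_norml => /andP[? ?].
    by apply/andP; split; lra.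
  have /cvgrPdist_lt/(_ (e / 4) (divr_gt0 e0 (ltr0n _ 4))) := @iterate_cont n s.
  move=> [d /= d0 hd]; exists (Num.min d 1); first by rewrite /= lt_min d0 ltr01.
  move=> s' /=; rewrite lt_min => /andP[sd s1].
  have h1 := hd s' sd; have h2 := hw s' s1.
  have h3 : `|fr X s - fr (iterate n) s| < e / 4 by apply: hw; rewrite subrr normr0.
  rewrite (_ : fr X s - fr X s' = (fr X s - fr (iterate n) s) + (fr (iterate n) s - fr (iterate n)
    s')
     - (fr X s' - fr (iterate n) s')); last first.
    by rewrite opprB !addrA !subrK.
  apply: le_lt_trans (ler_normB _ _) _; apply: le_lt_trans (lerD (ler_normD _ _) (lexx _)) _.
  by rewrite /= in h1 *; lra.
pose Y t := x0 + primx (fun s => F s (fr X s)) t.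
have dY (t : R) : 0 <= t -> is_derive t 1 Y (F t (fr X t)) by move=> t0; exact: step_derive.
(* The limit [X] and the integral [Y] of the field along it are both within a geometrically small
   distance of the iterates. *)
have XY t : 0 <= t -> X t = Y t.
  move=> t0; apply/eqP; rewrite -subr_eq0 -normr_le0; apply/ler_addgt0Pr => e e0; rewrite add0r.
  have [n hn] := half_exp_small (2 * (c * w t)) e0.
  have h1 := hX n.+1 t t0.
  have h2 : `|iterate n.+1 t - Y t| <= c * 2^-1 ^+ n * w t.
    apply: (@compare_ode _ _ (fun s => F s (fr (iterate n) s)) (fun s => F s (fr X s))) => //.
    - by rewrite mulr_ge0// exprn_ge0// invr_ge0.
    - by move=> s s0; exact: (@step_derive (iterate n) s (@iterate_cont n) s0).
    - by rewrite /Y /= !primx0.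
    - move=> s s0; apply: le_trans (F_lip _ _ _) _; rewrite !fr_id// distrC.
      rewrite (_ : 2 * L * _ * _ = L * (2 * (c * w s) * 2^-1 ^+ n)); last by ring.
      by rewrite ler_pM2l// hX.
  rewrite -(subrK (iterate n.+1 t) (X t)) -addrA; apply: le_trans (ler_normD _ _) _.
  move: h1; rewrite exprS => h1.
  rewrite (_ : 2 * (c * w t) * (2^-1 * 2^-1 ^+ n) = c * 2^-1 ^+ n * w t) in h1; last by field.
  by apply: le_trans (lerD h1 h2) _; move: hn => /ltW; lra.
exists Y; split; first by rewrite /Y primx0 addr0.
by move=> t t0; have := dY t t0; rewrite fr_id// XY.
Qed.

End Picard.

(** * Lipschitz extension of the vector field *)

Section McShane.
Variables (R : realType) (T : Type) (dist : T -> T -> R).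
Hypothesis dist0 : forall x, dist x x = 0.
Hypothesis distC : forall x y, dist x y = dist y x.
Hypothesis dist_tri : forall x y z, dist x z <= dist x y + dist y z.

(** The extension is the infimum over [y] in [S] of [f y + L * dist x y]. The abstract distance
    allows triples of matrices with the sum of the three norms. *)
Lemma mcshane (S : set T) (f : T -> R) (L : R) : 0 <= L -> S !=set0 ->
  (forall x y, S x -> S y -> `|f x - f y| <= L * dist x y) ->
  exists F : T -> R, (forall x, S x -> F x = f x) /\
    forall x y, `|F x - F y| <= L * dist x y.
Proof.
move=> L0 [y0 Sy0] fL.
pose E x := [set f y + L * dist x y | y in S].
have E0 x : E x !=set0 by exists (f y0 + L * dist x y0); exists y0.
have Elb x : has_lbound (E x).
  exists (f y0 - L * dist x y0) => _ [y Sy <-].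
  have := fL y y0 Sy Sy0; rewrite ler_norml => /andP[h _].
  by have := ler_wpM2l L0 (dist_tri y x y0); rewrite (distC y x); lra.
have le x y : inf (E x) <= inf (E y) + L * dist x y.
  rewrite -lerBlDr; apply: lb_le_inf => // _ [z Sz <-].
  have h : inf (E x) <= f z + L * dist x z by apply: (ge_inf (Elb x)); exists z.
  by have := ler_wpM2l L0 (dist_tri x y z); lra.
exists (fun x => inf (E x)); split=> [x Sx|x y]; last first.
  have h1 := le x y; have h2 := le y x; rewrite (distC y x) in h2.
  by rewrite ler_norml; apply/andP; split; lra.
apply/eqP; rewrite eq_le; apply/andP; split.
  by apply: (ge_inf (Elb x)); exists x => //; rewrite dist0 mulr0 addr0.
apply: lb_le_inf => // _ [z Sz <-].
by have := fL x z Sx Sz; rewrite ler_norml => /andP[_]; lra.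
Qed.

End McShane.

Section FieldExtension.
Variable R : realType.
Implicit Types B N E : 'M[R]_3.
Variables m M e d : R.
Hypothesis m01 : 0 < m <= 1.
Hypotheses (M0 : 0 <= M) (e0 : 0 <= e) (d0 : 0 <= d).

Let T := ('M[R]_3 * 'M[R]_3 * 'M[R]_3)%type.
Let dist (x y : T) : R := `|x.1.1 - y.1.1| + `|x.1.2 - y.1.2| + `|x.2 - y.2|.

(* The symmetrizations keep the extended flow inside the symmetric matrices. *)
Lemma field_ext : (exists E N B, inP m M e d E N B) ->
  exists2 L, 0 < L & exists F : 'M[R]_3 -> 'M[R]_3 -> 'M[R]_3 -> 'M[R]_3,
  [/\ forall E N B, inP m M e d E N B -> F E N B = field E N B,
      forall E N B, sym_mx (F E N B) &
      forall E1 N1 B1 E2 N2 B2,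
        `|F E2 N2 B2 - F E1 N1 B1| <= L * (`|E2 - E1| + `|N2 - N1| + `|B2 - B1|)].
Proof.
move=> [E' [N' [B' P']]]; have [L L0 hL] := field_lip m01 M0 e0 d0.
have ex i j : exists F : T -> R,
    (forall x, inP m M e d x.1.1 x.1.2 x.2 -> F x = field x.1.1 x.1.2 x.2 i j) /\
    forall x y, `|F x - F y| <= L * dist x y.
  apply: (@mcshane _ _ dist _ _ _ [set x | inP m M e d x.1.1 x.1.2 x.2]
    (fun x => field x.1.1 x.1.2 x.2 i j)) => //.
  - by move=> x; rewrite /dist !subrr !normr0 !addr0.
  - by move=> x y; rewrite /dist ![`|x.1.1 - _|]distrC ![`|x.1.2 - _|]distrC ![`|x.2 - _|]distrC.
  - move=> x y z; rewrite /dist.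
    have := ler_distD y.1.1 x.1.1 z.1.1; have := ler_distD y.1.2 x.1.2 z.1.2.
    by have := ler_distD y.2 x.2 z.2; lra.
  - by exists ((E', N'), B').
  - move=> x y /= Px Py; apply: le_trans (hL _ _ _ _ _ _ Py Px).
    by have := mx_entry_le (field x.1.1 x.1.2 x.2 - field y.1.1 y.1.2 y.2) i j; rewrite mxBE.
pose G i j := sval (cid (ex i j)).
have GP i j : (forall x, inP m M e d x.1.1 x.1.2 x.2 -> G i j x = field x.1.1 x.1.2 x.2 i j) /\
    forall x y, `|G i j x - G i j y| <= L * dist x y := svalP (cid (ex i j)).
clearbody G.
pose sy (X : 'M[R]_3) : 'M[R]_3 := 2^-1 *: (X + X^T).
have sy_sym X : sym_mx (sy X).
  by apply/matrixP => i j; rewrite !mxE addrC.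
have sy_id X : sym_mx X -> sy X = X.
  by move=> sX; rewrite /sy sX; apply/matrixP => i j; rewrite !mxE; field.
have sy_lip X Y : `|sy X - sy Y| <= `|X - Y|.
  apply: mx_norm_le => // i j; have h1 := mx_entry_le (X - Y) i j.
  have h2 := mx_entry_le (X - Y) j i; move: h1 h2; rewrite !mxE => h1 h2.
  rewrite (_ : _ - _ = 2^-1 * ((X i j - Y i j) + (X j i - Y j i))); last by ring.
  rewrite normrM ger0_norm ?invr_ge0//.
  by have := ler_normD (X i j - Y i j) (X j i - Y j i); lra.
(* The Picard iteration divides by the Lipschitz constant, which must therefore be positive. *)
exists (L + 1); first by rewrite ltr_wpDl.
exists (fun E N B => sy (\matrix_(i, j) G i j (E, N, sy B))); split=> //.
- move=> E N B P; have [_ _ sN KB] := P; rewrite (sy_id B KB.1.1).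
  rewrite (_ : \matrix_(i, j) _ = field E N B); first exact/sy_id/(field_sym m01 _ KB).
  by apply/matrixP => i j; rewrite mxE (GP i j).1.
- move=> E1 N1 B1 E2 N2 B2; apply: le_trans (sy_lip _ _) _.
  have s0 : 0 <= `|E2 - E1| + `|N2 - N1| + `|B2 - B1| by rewrite !addr_ge0.
  apply: mx_norm_le => [|i j]; first by rewrite mulr_ge0// addr_ge0.
  rewrite !mxE; apply: le_trans ((GP i j).2 _ _) _ => /=.
  rewrite /dist /= mulrDl mul1r; have h := sy_lip B2 B1.
  have := ler_wpM2l L0 h; lra.
Qed.

End FieldExtension.

(** * Commutation estimates *)

Section Frechet.
Variable R : realType.

(** The expansion of [f] is required only at points of the curve, since the estimates are available
    only on [K]. *)
Lemma is_derive_frechet (B : R -> 'M[R]_3) (t : R) (B' : 'M[R]_3) (f l : 'M[R]_3 -> R) (k c d : R) :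
  0 < d -> 0 <= k -> 0 <= c -> (forall a X, l (a *: X) = a * l X) ->
  (forall X Y, `|l X - l Y| <= k * `|X - Y|) -> is_derive t 1 B B' ->
  (forall h, `|h| < d -> `|f (B (t + h)) - f (B t) - l (B (t + h) - B t)|
      <= c * `|B (t + h) - B t| ^+ 2) ->
  is_derive t 1 (fun s => f (B s)) (l B').
Proof.
move=> d0 k0 c0 lZ lL [dB BE] hf.
have cB : h^-1 *: ((B \o shift t) (h *: 1) - B t) @[h --> 0^'] --> B'.
  by rewrite -BE; exact: dB.
have cv : h^-1 *: (((fun s => f (B s)) \o shift t) (h *: 1) - f (B t)) @[h --> 0^'] --> l B'.
  apply/cvgrPdist_lt => e e0.
  pose b := `|B'| + 1; have b0 : 0 < b by rewrite ltr_wpDl.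
  pose e1 := Num.min 1 (e / (2 * (k + 1))).
  have k1 : 0 < 2 * (k + 1) by lra.
  have e10 : 0 < e1 by rewrite lt_min ltr01 divr_gt0.
  have cb : 0 < 2 * (c * b ^+ 2 + 1).
    by rewrite mulr_gt0// ltr_wpDl// mulr_ge0// exprn_ge0// ltW.
  near=> h.
  have h0 : h != 0 by near: h; exact: nbhs_dnbhs_neq.
  have hd : `|h| < d by near: h; exact: dnbhs0_lt.
  have he : `|h| < e / (2 * (c * b ^+ 2 + 1)).
    by near: h; apply: dnbhs0_lt; rewrite divr_gt0.
  have hB : `|B' - h^-1 *: (B (h *: 1 + t) - B t)| < e1.
    by near: h; move/cvgrPdist_lt : cB; apply.
  rewrite /= [h *: 1]mulr1 in hB *.
  rewrite (addrC h t) in hB *.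
  set D := B (t + h) - B t in hB *.
  have hf' := hf h hd; rewrite -/D in hf'.
  have DE : D = h *: (h^-1 *: D) by rewrite scalerA mulfV// scale1r.
  set Q := h^-1 *: D in hB DE.
  have e11 : e1 <= 1 by rewrite ge_min lexx.
  have Qb : `|Q| <= b.
    rewrite -[Q](subrK B') (le_trans (ler_normD _ _))// addrC lerD2l distrC.
    by rewrite (le_trans (ltW hB)).
  have nD : `|D| = `|h| * `|Q| by rewrite {1}DE normrZ.
  have hn : 0 < `|h| by rewrite normr_gt0.
  have r1 : `|h^-1 * (f (B (t + h)) - f (B t) - l D)| <= c * b ^+ 2 * `|h|.
    rewrite normrM normfV ler_pdivrMl//; apply: le_trans hf' _; rewrite nD exprMn.
    have q2 : `|Q| ^+ 2 <= b ^+ 2 by rewrite lerXn2r ?nnegrE// ltW.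
    have := ler_wpM2l (mulr_ge0 c0 (sqr_ge0 `|h|)) q2; rewrite expr2; lra.
  have r2 : `|l B' - l Q| <= k * e1.
    by apply: le_trans (lL _ _) _; rewrite ler_wpM2l// ltW.
  rewrite [X in `|X| < _](_ : _ = (l B' - l Q) - h^-1 * (f (B (t + h)) - f (B t) - l D)); last
    first.
    have lD : l D = h * l Q by rewrite {1}DE; exact: lZ.
    by rewrite lD /GRing.scale /=; field.
  apply: le_lt_trans (ler_normB _ _) _.
  have r3 : k * e1 < e / 2.
    apply: le_lt_trans (_ : k * (e / (2 * (k + 1))) < _).
      by rewrite ler_wpM2l// ge_min lexx orbT.
    by rewrite mulrA ltr_pdivrMr//; have := mulr_ge0 k0 (ltW e0); lra.
  have r4 : c * b ^+ 2 * `|h| < e / 2.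
    move: he; rewrite ltr_pdivlMr//; lra.
  by lra.
split; first by apply/cvg_ex; exists (l B').
exact: cvg_lim.
Unshelve. all: by end_near. Qed.

End Frechet.

Lemma J_norm_le_J (R : realType) (f h : R -> R) : dominated f -> dominated h ->
  (forall s, 0 <= s -> `|f s| <= h s) -> `|J f| <= J h.
Proof.
move=> df dh fh; rewrite ler_norml; apply/andP; split.
- rewrite -mulN1r -J_Z//; apply: J_le => // [|s s0]; first exact: dominatedZ.
  by rewrite mulN1r; have := fh s s0; rewrite ler_norml => /andP[].
- by apply: J_le => // s s0; have := fh s s0; rewrite ler_norml => /andP[].
Qed.

Section Commutation.
Variable R : realType.
Implicit Types B E P : 'M[R]_3.

Lemma norm_tr_mul (P Q : 'M[R]_3) : `|\tr (P *m Q)| <= 9 * `|P| * `|Q|.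
Proof. by apply: le_trans (norm_tr3 _) _; have := norm_mulmx3 P Q; lra. Qed.

Variable m : R.
Hypothesis m01 : 0 < m <= 1.
Let m0 : 0 < m. Proof. by case/andP: m01. Qed.
Variable B : 'M[R]_3.
Hypothesis gB : geI m B.

Lemma shift_invE s : 0 <= s -> invmx (B + s%:M) *m B = 1%:M - s *: invmx (B + s%:M).
Proof.
move=> s0; have uY := posdef_unit (shift_posdef m01 s0 gB).
by rewrite -[X in _ *m X](addrK s%:M) mulmxBr mulVmx// mul_mx_scalar.
Qed.

Lemma shift_invEl s : 0 <= s -> B *m invmx (B + s%:M) = 1%:M - s *: invmx (B + s%:M).
Proof.
move=> s0; have uY := posdef_unit (shift_posdef m01 s0 gB).
by rewrite -[X in X *m _](addrK s%:M) mulmxBl mulmxV// mul_scalar_mx.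
Qed.

Lemma shift_inv_mul_psd s : 0 <= s -> psd (invmx (B + s%:M) *m B).
Proof.
move=> s0; have pY := shift_posdef m01 s0 gB; rewrite shift_invE//; split=> [|v].
  rewrite /sym_mx raddfB /= trmx1; congr (_ - _).
  by apply/matrixP => i j; rewrite mxE [RHS]mxE -{1}(sym_inv pY.1) !mxE.
have ms : 0 < m + s by rewrite ltr_pwDl.
have h := geI_inv_le v ms (geI_shift s gB).
have -> : qf (1%:M - s *: invmx (B + s%:M)) v = nrm2 v - s * qf (invmx (B + s%:M)) v.
  by rewrite qfD -scaleNr qfZ qf1 mulNr.
have h2 : s * qf (invmx (B + s%:M)) v <= s * ((m + s)^-1 * nrm2 v) by rewrite ler_wpM2l.
have h3 : s * ((m + s)^-1 * nrm2 v) <= nrm2 v.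
  by rewrite mulrA ler_piMl ?nrm2_ge0// ler_pdivrMr// mul1r lerDr ltW.
by lra.
Qed.

(** With [X = (B + s)^-1], the product [X B = 1 - s X] lies between 0 and 1. The bound involves
    neither [m] nor [|B|], which is what makes the transport estimate uniform. *)
Lemma shift_inv_mul_norm s : 0 <= s -> `|invmx (B + s%:M) *m B| <= 1.
Proof.
move=> s0; have pY := shift_posdef m01 s0 gB; have pXB := shift_inv_mul_psd s0.
have hd i : (invmx (B + s%:M) *m B) i i <= 1.
  rewrite shift_invE// mxBE mxE eqxx mulr1n [X in 1 - X]mxE gerBl.
  by rewrite mulr_ge0//; exact: psd_diag (posdef_psd (posdef_inv pY)).
apply: mx_norm_le => // i j; apply: le_trans (psd_entry i j pXB) _.
by have := hd i; have := hd j; lra.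
Qed.

Lemma shift_mul_inv_norm s : 0 <= s -> `|B *m invmx (B + s%:M)| <= 1.
Proof. by move=> s0; rewrite shift_invEl// -shift_invE// shift_inv_mul_norm. Qed.

Lemma Aof_comm : Aof B *m B = B *m Aof B.
Proof.
apply/matrixP => i j; rewrite mxE [RHS]mxE.
have d k l c : dominated (fun s => c * aent (B + s%:M) k l).
  by apply: dominatedZ; exact: (dominated_aent m01).
transitivity (2^-1 * J (fun s => \sum_k B k j * aent (B + s%:M) i k)).
  rewrite J_sum// mulr_sumr; apply: eq_bigr => k _; rewrite J_Z ?AofE; first by ring.
  exact: (dominated_aent m01).
transitivity (2^-1 * J (fun s => \sum_k B i k * aent (B + s%:M) k j)); last first.
  rewrite J_sum// mulr_sumr; apply: eq_bigr => k _; rewrite J_Z ?AofE; first by ring.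
  exact: (dominated_aent m01).
congr (_ * _); apply: eq_J => s s0.
have h : (invmx (B + s%:M) *m B) i j = (B *m invmx (B + s%:M)) i j.
  by rewrite shift_invE// shift_invEl.
move: h; rewrite mxE [RHS]mxE => h.
transitivity ((\sum_k invmx (B + s%:M) i k * B k j) * rdet (B + s%:M)).
  by rewrite mulr_suml; apply: eq_bigr => k _; rewrite /aent; ring.
by rewrite h mulr_suml; apply: eq_bigr => k _; rewrite /aent; ring.
Qed.

Lemma comm_inv (P Q : 'M[R]_3) : P \in unitmx -> P *m Q = Q *m P -> invmx P *m Q = Q *m invmx P.
Proof.
move=> uP PQ; apply: (can_inj (mulKmx uP)).
by rewrite mulKVmx// mulmxA PQ -mulmxA mulmxV// mulmx1.
Qed.

Lemma Aof_inv_comm s : 0 <= s -> Aof B \in unitmx ->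
  invmx (Aof B) *m invmx (B + s%:M) = invmx (B + s%:M) *m invmx (Aof B).
Proof.
move=> s0 uA; have uY := posdef_unit (shift_posdef m01 s0 gB).
apply: comm_inv => //; apply/esym/comm_inv => //.
by rewrite mulmxDl mulmxDr Aof_comm mul_scalar_mx mul_mx_scalar.
Qed.

(* Everything commutes with [B], so with [P = A^-1] the integrand is controlled by the trace
   of the positive matrix [P X P], whose integral is [2 tr P]. *)
Lemma tr_CW_bound E e : posdef (Aof B) -> `|E| <= e ->
  `|\tr (invmx (Aof B) *m tcontr (Cof B) (B *m E + E^T *m B) *m invmx (Aof B))|
  <= 63 * e * \tr (invmx (Aof B)).
Proof.
move=> pA Ee; have e0 : 0 <= e := le_trans (normr_ge0 _) Ee.
have uA := posdef_unit pA; set P := invmx (Aof B).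
have sP : P^T = P := sym_inv pA.1.
set W := B *m E + E^T *m B.
have sW : sym_mx W by rewrite /sym_mx /W raddfD /= !trmx_mul trmxK gB.1 addrC.
pose S := P *m P.
have sS : S^T = S by rewrite /S trmx_mul sP.
have trS (Q : 'M[R]_3) : sym_mx Q -> \tr (P *m Q *m P) = \sum_i \sum_j S i j * Q i j.
  move=> sQ; rewrite mxtrace_mulC mulmxA -/S /mxtrace; apply: eq_bigr => i _; rewrite mxE.
  by apply: eq_bigr => j _; congr (_ * _); rewrite -{1}sQ mxE.
have dX i j : dominated (fun s => S i j * aent (B + s%:M) i j).
  by apply: dominatedZ; exact: (dominated_aent m01).
have dC i j : dominated (fun s => S i j * \sum_k \sum_l cent (B + s%:M) i j k l * W k l).
  by apply: dominatedZ; exact: (dominated_contract m01).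
have CWE : \tr (P *m tcontr (Cof B) W *m P) =
    4^-1 * J (fun s => \sum_i \sum_j S i j * \sum_k \sum_l cent (B + s%:M) i j k l * W k l).
  rewrite trS; last exact: (tcontr_Cof_sym m01).
  rewrite J_sum => [|i]; last exact: dominated_sum.
  rewrite mulr_sumr; apply: eq_bigr => i _; rewrite J_sum// mulr_sumr; apply: eq_bigr => j _.
  by rewrite (tcontrE m01)// J_Z; [ring|exact: (dominated_contract m01)].
have PE : \tr P = 2^-1 * J (fun s => \sum_i \sum_j S i j * aent (B + s%:M) i j).
  transitivity (\tr (P *m Aof B *m P)); first by rewrite /P mulVmx// mul1mx.
  rewrite trS; last exact: pA.1.
  rewrite J_sum => [|i]; last exact: dominated_sum.
  rewrite mulr_sumr; apply: eq_bigr => i _; rewrite J_sum// mulr_sumr; apply: eq_bigr => j _.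
  by rewrite AofE J_Z; [ring|exact: (dominated_aent m01)].
rewrite CWE PE normrM ger0_norm ?invr_ge0//.
(* 126 = 18 + 2 * 54, by [t1] and [t2] below; trading [4^-1] for the [2^-1] in [PE] turns it into
   63. *)
rewrite [leRHS](_ : _ = 4^-1 * (126 * e * J (fun s => \sum_i \sum_j S i j * aent (B + s%:M) i j)));
  last by field.
rewrite ler_wpM2l ?invr_ge0// -J_Z; last by do 2 apply: dominated_sum => ?.
apply: J_norm_le_J; [by do 2 apply: dominated_sum => ? | by apply: dominatedZ; do 2 apply:
  dominated_sum => ? |].
move=> s s0; have pY := shift_posdef m01 s0 gB; have pX := posdef_inv pY.
under eq_bigr => i _ do under eq_bigr => j _ do rewrite (cent_contract _ _ pY.1 sW).
have cXP := Aof_inv_comm s0 uA; rewrite -/P in cXP.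
have XB1 := shift_inv_mul_norm s0; have BX1 := shift_mul_inv_norm s0.
rewrite /aent; move: (invmx (B + s%:M)) pX (rdet _) (rdet_gt0 pY) cXP XB1 BX1 => X pX r r0 cXP XB1
  BX1.
have sX := pX.1.
pose Q := P *m X *m P.
have pQ : psd Q.
  split=> [|v]; first by rewrite /sym_mx /Q !trmx_mul sP sX mulmxA.
  by rewrite /Q -{1}sP qf_conj; exact: (posdef_psd pX).2.
have Qn : `|Q| <= \tr Q by apply: mx_norm_le => [|i j]; [exact: psd_tr|exact: psd_entry_tr].
have q0 := psd_tr pQ.
have XPP : X *m S = Q by rewrite /S /Q mulmxA -cXP.
have PPX : S *m X = Q by rewrite /S /Q -!mulmxA cXP.
have sXWX : sym_mx (X *m W *m X) by rewrite /sym_mx !trmx_mul sX sW mulmxA.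
have -> : \sum_i \sum_j S i j * (X i j * r) = \tr Q * r.
  rewrite /Q trS// mulr_suml; apply: eq_bigr => i _; rewrite mulr_suml; apply: eq_bigr => j _.
  by rewrite mulrA.
have -> : \sum_i \sum_j S i j * ((X i j * \tr (X *m W) + 2 * (X *m W *m X) i j) * r) =
    (\tr (X *m W) * \tr Q + 2 * \tr (P *m (X *m W *m X) *m P)) * r.
  rewrite !trS//; move: (\tr (X *m W)) (X *m W *m X) => t Z.
  rewrite (mulr_sumr _ _ _ t) (mulr_sumr _ _ _ 2) -big_split mulr_suml; apply: eq_bigr => i _ /=.
  rewrite (mulr_sumr _ _ _ t) (mulr_sumr _ _ _ 2) -big_split mulr_suml; apply: eq_bigr => j _ /=.
  by ring.
have t1 : `|\tr (X *m W)| <= 18 * e.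
  rewrite /W mulmxDr raddfD /= mulmxA (mxtrace_mulC X) -(mulmxA E^T).
  apply: le_trans (ler_normD _ _) _.
  have h1 : `|\tr (X *m B *m E)| <= 9 * 1 * e.
    by apply: le_trans (norm_tr_mul _ _) _; rewrite ler_pM ?mulr_ge0// ler_pM2l.
  have h2 : `|\tr (E^T *m (B *m X))| <= 9 * e * 1.
    by apply: le_trans (norm_tr_mul _ _) _; rewrite ler_pM ?mulr_ge0// norm_trmx ler_pM2l.
  by lra.
have t2 : `|\tr (P *m (X *m W *m X) *m P)| <= 54 * e * \tr Q.
  have -> : \tr (P *m (X *m W *m X) *m P) = \tr (Q *m (X *m B *m E)) + \tr (E^T *m (B *m X *m Q)).
    rewrite mxtrace_mulC mulmxA -/S /W.
    rewrite !(mulmxDr, mulmxDl) raddfD /=; congr (_ + _).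
      by rewrite -XPP -!mulmxA mxtrace_mulC -!mulmxA mxtrace_mulC -!mulmxA mxtrace_mulC -!mulmxA
        mxtrace_mulC -!mulmxA mxtrace_mulC -!mulmxA mxtrace_mulC.
    by rewrite -PPX -!mulmxA mxtrace_mulC -!mulmxA mxtrace_mulC -!mulmxA mxtrace_mulC -!mulmxA.
  apply: le_trans (ler_normD _ _) _.
  have h1 : `|\tr (Q *m (X *m B *m E))| <= 9 * \tr Q * (3 * 1 * e).
    apply: le_trans (norm_tr_mul _ _) _; rewrite ler_pM ?mulr_ge0// ?ler_pM2l//.
    by apply: le_trans (norm_mulmx3 _ _) _; rewrite ler_pM ?mulr_ge0// ler_pM2l.
  have h2 : `|\tr (E^T *m (B *m X *m Q))| <= 9 * e * (3 * 1 * \tr Q).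
    apply: le_trans (norm_tr_mul _ _) _; rewrite ler_pM ?mulr_ge0// ?norm_trmx ?ler_pM2l//.
    by apply: le_trans (norm_mulmx3 _ _) _; rewrite ler_pM ?mulr_ge0// ler_pM2l.
  by lra.
rewrite normrM (gtr0_norm r0) mulrA ler_wpM2r ?(ltW r0)//.
apply: le_trans (ler_normD _ _) _; rewrite !normrM (ger0_norm q0) [`|2|]ger0_norm//.
by have := ler_wpM2r q0 t1; lra.
Qed.

End Commutation.

(** * A priori bounds *)

Section CompactBounds.
Variable R : realType.
Implicit Types B N P : 'M[R]_3.

Lemma qf_col N P i : (P^T *m N *m P) i i = qf N (col i P).
Proof.
rewrite qfE mxE; under eq_bigr do rewrite mxE mulr_suml.
rewrite exchange_big /=; apply: eq_bigr => k _; apply: eq_bigr => l _.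
by rewrite !mxE.
Qed.

Lemma nrm2_cols P : nrm2 P = \sum_i nrm2 (col i P).
Proof.
rewrite /nrm2 exchange_big /=; apply: eq_bigr => j _; apply: eq_bigr => i _.
by rewrite big_ord_recl big_ord0 addr0 mxE.
Qed.

Lemma tr_conj_ge mu N P : geI mu N -> mu * nrm2 P <= \tr (P^T *m N *m P).
Proof.
move=> [_ gN]; rewrite nrm2_cols mulr_sumr; apply: ler_sum => i _.
by rewrite qf_col.
Qed.

Lemma tr_sqr_le P : \tr P ^+ 2 <= 3 * nrm2 P.
Proof.
rewrite /nrm2 /mxtrace !sum3E.
set a := P i0 i0; set b := P i1 i1; set c := P i2 i2.
have h i j : 0 <= P i j ^+ 2 by exact: sqr_ge0.
have := (h i0 i1, h i0 i2, h i1 i0, h i1 i2, h i2 i0, h i2 i1) => -[[[[[]]]]] *.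
have := sqr_ge0 (a - b); have := sqr_ge0 (b - c); have := sqr_ge0 (a - c).
by nra.
Qed.

(** The trace in the integrand is at most 3, and [det (B + s) >= 1 + s^3 >= (1 + s)^3 / 4] bounds
    the weight by [2 gdom]. With the integral 2 of [gdom] and the factor [2^-1] this makes 6. *)
Lemma tr_Aof_mul B : posdef B -> \det B = 1 -> \tr (Aof B *m B) <= 6.
Proof.
move=> pB dB; have [m m01 gB] := posdef_inK pB.
have -> : \tr (Aof B *m B) = 2^-1 * J (fun s => \tr (invmx (B + s%:M) *m B) * rdet (B + s%:M)).
  have d i j : dominated (fun s => B j i * aent (B + s%:M) i j).
    by apply: dominatedZ; exact: (dominated_aent m01).
  transitivity (2^-1 * J (fun s => \sum_i \sum_j B j i * aent (B + s%:M) i j)).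
    rewrite J_sum => [|i]; last exact: dominated_sum.
    rewrite mulr_sumr; apply: eq_bigr => i _; rewrite J_sum// mulr_sumr mxE; apply: eq_bigr => j _.
    by rewrite J_Z; [rewrite AofE; ring|exact: (dominated_aent m01)].
  congr (_ * _); apply: eq_J => s _; rewrite mulr_suml; apply: eq_bigr => i _.
  by rewrite mxE mulr_suml; apply: eq_bigr => j _; rewrite /aent; ring.
have dd : dominated (fun s => \tr (invmx (B + s%:M) *m B) * rdet (B + s%:M)).
  have d i j : dominated (fun s => B j i * aent (B + s%:M) i j).
    by apply: dominatedZ; exact: (dominated_aent m01).
  rewrite (_ : (fun s => _) = fun s => \sum_i \sum_j B j i * aent (B + s%:M) i j).
    by do 2 apply: dominated_sum => ?.
  apply/funext => s; rewrite mulr_suml; apply: eq_bigr => i _.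
  by rewrite mxE mulr_suml; apply: eq_bigr => j _; rewrite /aent; ring.
have : `|J (fun s => \tr (invmx (B + s%:M) *m B) * rdet (B + s%:M))| <= 6 * 2.
  apply: J_norm_le => // s s0; have pY := shift_posdef m01 s0 gB; have r0 := rdet_gt0 pY.
  have p1 : 0 < 1 + s by rewrite ltr_pwDl.
  rewrite normrM (gtr0_norm r0) (_ : 6 = 3 * 2); last by ring.
  rewrite -mulrA; apply: ler_pM => //; first exact: ltW.
    by apply: le_trans (norm_tr3 _) _; have := shift_inv_mul_norm m01 gB s0; lra.
  have tadj : 0 <= \tr (\adj B).
    have := psd_tr (posdef_psd (posdef_inv pB)).
    by rewrite /invmx (posdef_unit pB) dB invr1 scale1r.
  have tB := psd_tr (posdef_psd pB).
  have dge : ((1 + s) ^+ 3) / 2 ^+ 2 <= \det (B + s%:M).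
    rewrite det3_shift dB.
    have := mulr_ge0 s0 tadj; have := mulr_ge0 (sqr_ge0 s) tB.
    (* Indeed [4 (1 + s^3) - (1 + s)^3 = 3 (s - 1)^2 (1 + s)]. *)
    have : 0 <= (s - 1) ^+ 2 * (1 + s) by rewrite mulr_ge0 ?sqr_ge0// ltW.
    by nra.
  have g0 : 0 < (1 + s) ^+ 3 / 2 ^+ 2 by rewrite divr_gt0 ?exprn_gt0.
  rewrite /rdet /gdom -[X in X * _]invrK -invfM.
  rewrite lef_pV2 ?posrE ?mulr_gt0 ?sqrtr_gt0 ?exprn_gt0 ?invr_gt0 ?posdef_det_gt0//.
  apply: le_trans (ler_wsqrtr dge).
  rewrite -exprVn [leRHS]sqrtrM ?exprn_ge0 ?(ltW p1)// sqrtr_sqr ger0_norm ?invr_ge0//.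
  by rewrite mulrC.
by rewrite ler_norml => /andP[_]; lra.
Qed.

(** Writing [B = Z^T Z] and using [posdef_lower] for [A] gives [tr B <= tr A^-1 tr (A B) <= 6 Q].
    For the lower bound, [det B = 1] gives [tr B^-1 = det (B + 1) - 2 - tr B], and the determinant
    is bounded through [|B|]. *)
Lemma compact_bounds B Q : posdef B -> posdef (Aof B) -> \det B = 1 -> \tr (invmx (Aof B)) <= Q ->
  inK (6 * (6 * Q + 1) ^+ 3)^-1 (6 * Q) B.
Proof.
move=> pB pA dB hQ.
have pAi := posdef_psd (posdef_inv pA); have q0 := psd_tr pAi.
have Q0 : 0 <= Q := le_trans q0 hQ.
have pB' := posdef_psd pB; have tB0 := psd_tr pB'.
have tB : \tr B <= 6 * Q.
  have [Z Zu ZE] := posdef_gram pB.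
  have h1 : \tr B <= \tr (invmx (Aof B)) * \tr (Aof B *m B).
    have -> : \tr (Aof B *m B) = \sum_i qf (Aof B) (col i Z^T).
      rewrite {2}ZE mulmxA mxtrace_mulC mulmxA -{1}(trmxK Z).
      by apply: eq_bigr => i _; rewrite qf_col.
    have -> : \tr B = \sum_i nrm2 (col i Z^T).
      by rewrite -nrm2_cols nrm2_tr trmxK mxtrace_mulC -ZE.
    by rewrite mulr_sumr; apply: ler_sum => i _; exact: posdef_lower.
  apply: le_trans h1 _; apply: le_trans (ler_wpM2l q0 (tr_Aof_mul pB dB)) _; lra.
have nB : `|B| <= 6 * Q.
  by apply: mx_norm_le => [|i j]; [rewrite mulr_ge0|apply: le_trans (psd_entry_tr i j pB') tB].
split=> //; split; first exact: pB.1.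
have c0 : 0 < 6 * (6 * Q + 1) ^+ 3 by rewrite mulr_gt0// exprn_gt0// ltr_wpDl// mulr_ge0.
move=> v; rewrite ler_pdivrMl//; apply: le_trans (posdef_lower v pB) _.
rewrite ler_wpM2r ?pB'.2//.
have -> : \tr (invmx B) = \det (B + 1%:M) - 2 - \tr B.
  rewrite det3_shift dB !expr1n !mul1r /invmx (posdef_unit pB) dB invr1 scale1r; ring.
have h : \det (B + 1%:M) <= 6 * (6 * Q + 1) ^+ 3.
  apply: le_trans (ler_norm _) _; apply: le_trans (det3_le _) _.
  rewrite ler_pM2l// lerXn2r ?nnegrE ?addr_ge0 ?mulr_ge0//.
  apply: le_trans (ler_normD _ _) _; rewrite lerD//.
  by apply: le_trans (norm_scalar_mx3 _) _; rewrite normr1.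
by lra.
Qed.

End CompactBounds.

(** * Evolution of [tr A] and [tr A^-1] along a solution *)

Section Apriori.
Variable R : realType.

Lemma within_lip (V W : normedModType R) (D : set R) (B : R -> V) (A : R -> W) (L : R) :
  0 <= L -> {within D, continuous B} ->
  (forall x y, D x -> D y -> `|A x - A y| <= L * `|B x - B y|) -> {within D, continuous A}.
Proof.
move=> L0 /subspace_continuousP cB hL; apply/subspace_continuousP => x Dx.
apply/cvgrPdist_lt => e e0.
have L1 : 0 < L + 1 by rewrite ltr_wpDl.
have /cvgrPdist_lt/(_ (e / (L + 1)) (divr_gt0 e0 L1)) := cB x Dx.
rewrite !near_withinE; apply: filterS => y hy Dy.
apply: le_lt_trans (hL x y Dx Dy) _; have := hy Dy; rewrite ltr_pdivlMr//.
by have := normr_ge0 (B x - B y); nra.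
Qed.

(** The square of [y] is nonincreasing. *)
Lemma decay_zero (y a : R -> R) (T : R) : 0 <= T -> {within `[0, T], continuous y} ->
  (forall s : R, 0 < s < T -> is_derive s 1 y (- a s * y s)) ->
  (forall s : R, 0 < s < T -> 0 <= a s) -> y 0 = 0 -> y T = 0.
Proof.
move=> T0 cy dy a0 y0.
have : y T * y T <= y 0 * y 0.
  apply: (@nonincr_le _ (fun s => y s * y s) (fun s => y s *: (- a s * y s) + y s *: (- a s * y
    s))) => //.
  - by apply/subspace_continuousP => u uT; apply: cvgM; move/subspace_continuousP : cy; apply.
  - by move=> s /dy d; exact: (is_deriveM d d).
  - move=> s /a0 as0; rewrite /GRing.scale /=.
    by have := mulr_ge0 as0 (sqr_ge0 (y s)); rewrite expr2; lra.
rewrite y0 mulr0 -expr2 => h; apply/eqP; rewrite -sqrf_eq0.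
by rewrite eq_le h sqr_ge0.
Qed.

(** The substitution [1 / q] linearizes the Riccati inequality: [z = exp (k s) (c - 1 / q)]
    satisfies [z' <= exp (k s) (k c - a) <= 0], so [z] stays nonpositive. *)
Lemma riccati_bound (q dq : R -> R) (T k a c : R) : 0 <= T -> {within `[0, T], continuous q} ->
  (forall s, 0 <= s <= T -> 0 < q s) ->
  (forall s : R, 0 < s < T -> is_derive s 1 q (dq s)) ->
  (forall s, 0 < s < T -> dq s <= k * q s - a * q s ^+ 2) ->
  0 < c -> k * c <= a -> q 0 <= c^-1 -> q T <= c^-1.
Proof.
move=> T0 cq qp dqP dq_le c0 kca hq0.
have oo s : 0 < s < T -> 0 <= s <= T by move=> /andP[? ?]; apply/andP; split; exact: ltW.
pose z s := expR (k * s) * (c - (q s)^-1).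
pose dz s := expR (k * s) *: - (- q s ^- 2 *: dq s) + (c - (q s)^-1) *: (expR (k * s) * k).
have dzP (s : R) : 0 < s < T -> is_derive s 1 z (dz s).
  move=> sT; have qs := qp s (oo s sT).
  have d1 : is_derive s 1 (fun u : R => k * u) k.
    by rewrite -[X in is_derive _ _ _ X]mulr1; exact: (is_deriveZ (f := id)).
  have d2 := @is_derive1_comp R expR (fun u => k * u) s _ _ (is_derive_expR _) d1.
  have d3 := @is_deriveV R q s _ 1 (lt0r_neq0 qs) (dqP s sT).
  have d4 : is_derive s 1 (fun u => c - (q u)^-1) (- (- q s ^- 2 *: dq s)).
    by rewrite -[X in is_derive _ _ _ X]add0r; exact: (is_deriveB (f := cst c)).
  exact: (is_deriveM d2 d4).
have : z T <= z 0.
  apply: (@nonincr_le _ z dz) => //.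
  - apply/subspace_continuousP => u uT; apply: cvgM.
      apply: cvg_within_filter.
      apply: (cvg_comp (fun u : R => k * u) expR _ (@continuous_expR R _)).
      by apply: cvgM; [exact: cvg_cst|exact: cvg_id].
    apply: cvgB; first exact: cvg_cst.
    apply: cvgV; first by apply: lt0r_neq0; apply: qp; move: uT; rewrite /= in_itv.
    by move/subspace_continuousP : cq; apply.
  - move=> s sT; have qs := qp s (oo s sT); rewrite /dz /GRing.scale /=.
    have := dq_le s sT; move: (q s) qs (dq s) (expR _) (expR_gt0 (k * s)) => y y0 w ex ex0 h.
    rewrite (_ : _ + _ = ex * (k * c - a + (w - (k * y - a * y ^+ 2)) / y ^+ 2)); last by field;
      rewrite gt_eqF.
    rewrite pmulr_rle0//.
    have : (w - (k * y - a * y ^+ 2)) / y ^+ 2 <= 0.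
      by apply: mulr_le0_ge0; [rewrite subr_le0|rewrite invr_ge0 sqr_ge0].
    by lra.
rewrite /z mulr0 expR0 mul1r => hz.
have q0p : 0 < q 0 by apply: qp; apply/andP; split.
have qTp : 0 < q T by apply: qp; apply/andP; split.
have z0 : c - (q 0)^-1 <= 0.
  by rewrite subr_le0 -[c]invrK lef_pV2 ?posrE ?invr_gt0.
have : expR (k * T) * (c - (q T)^-1) <= 0 by exact: le_trans hz z0.
rewrite pmulr_rle0 ?expR_gt0// subr_le0 => h.
by rewrite -[q T]invrK lef_pV2 ?posrE ?invr_gt0.
Qed.

Variables (m M e dm T : R) (E N B : R -> 'M[R]_3).
Hypothesis m01 : 0 < m <= 1.
Hypothesis M0 : 0 <= M.
Hypothesis dm0 : 0 < dm.
Hypothesis T0 : 0 <= T.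
Hypothesis hE : forall s, 0 <= s -> `|E s| <= e.
Hypothesis hN : forall s, 0 <= s -> geI dm (N s).
Hypothesis hEN : forall s, 0 <= s -> \tr (E s) = - 5 * \tr (N s).
Hypothesis KB : forall s, 0 <= s <= T -> inK m M (B s).
Hypothesis cB : {within `[0, T], continuous B}.
Hypothesis dB : forall s : R, 0 < s < T -> is_derive s 1 B (field (E s) (N s) (B s)).

Let m0 : 0 < m. Proof. by case/andP: m01. Qed.
Let pd s : 0 <= s <= T -> posdef (B s). Proof. by move=> /KB[/(geI_posdef m0)]. Qed.
Let A s := Aof (B s).
Let A' s := tcontr (Cof (B s)) (B s *m E s + (E s)^T *m B s) + source (N s) (B s).

Let oo s : 0 < s < T -> 0 <= s <= T. Proof. by move=> /andP[? ?]; apply/andP; split; exact: ltW.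
  Qed.

(** In [- C(B):B'] the product of [C(B)] with [D(B)] cancels and leaves the source term itself. *)
Lemma Aof_derive (s : R) : 0 < s < T -> is_derive s 1 (fun s => Aof (B s))
  (tcontr (Cof (B s)) (B s *m E s + (E s)^T *m B s) + source (N s) (B s)).
Proof.
move=> sT; rewrite -/(A' s); have /andP[s0 sT'] := sT; have Ks := KB (oo sT).
have [c c0 hq] := Aof_quad m01 M0.
have sN : sym_mx (N s) by have [] := hN (ltW s0).
have [_ DE] := DopP (pd (oo sT)) (source_sym m01 Ks.1 sN).
have A'E : A' s = - tcontr (Cof (B s)) (field (E s) (N s) (B s)).
  have -> : field (E s) (N s) (B s) = -1 *: (B s *m E s + (E s)^T *m B s + Dop (B s) (source (N s)
    (B s))).
    by rewrite scaleN1r opprD.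
  by rewrite tcontrZ scaleN1r opprK tcontrD DE.
rewrite A'E; apply/is_derive_mxP => i j; rewrite mxE.
pose l (X : 'M[R]_3) := - tcontr (Cof (B s)) X i j.
pose k := \sum_a \sum_b `|Cof (B s) i j a b|.
have lB X Y : l X - l Y = - tcontr (Cof (B s)) (X - Y) i j.
  by rewrite /l tcontrD -[- Y]scaleN1r tcontrZ scaleN1r mxBE; ring.
apply: (@is_derive_frechet _ B s _ (fun X => Aof X i j) l k c (Num.min s (T - s))) => //.
- by rewrite lt_min s0 subr_gt0.
- by do 2 apply: sumr_ge0 => ? _.
- by move=> a X; rewrite /l tcontrZ [(a *: _ : 'M[R]_3) i j]mxE mulrN.
- move=> X Y; rewrite lB normrN mxE /k mulr_suml.
  apply: le_trans (ler_norm_sum _ _ _) _; apply: ler_sum => a _.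
  rewrite mulr_suml; apply: le_trans (ler_norm_sum _ _ _) _; apply: ler_sum => b _.
  by rewrite normrM ler_wpM2l// mx_entry_le.
- exact: dB.
- move=> h; rewrite lt_min !ltr_norml => /andP[/andP[? ?] /andP[? ?]].
  have K2 : inK m M (B (s + h)) by apply: KB; apply/andP; split; lra.
  apply: le_trans (hq _ _ Ks K2); rewrite /l opprK.
  by have := mx_entry_le (Aof (B (s + h)) - Aof (B s) + tcontr (Cof (B s)) (B (s + h) - B s)) i j;
    rewrite mxDE mxBE.
Qed.

Lemma tr_Aof_one : \tr (Aof (B 0)) = 1 -> \tr (Aof (B T)) = 1.
Proof.
move=> A01; pose y s := \tr (A s) - 1.
have dy (s : R) : 0 < s < T -> is_derive s 1 y (- (2 * \tr (N s)) * y s).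
  move=> sT; have /andP[/ltW s0 _] := sT.
  have hd := (is_derive_mxP _ _ _).1 (Aof_derive sT); rewrite -/(A' s) in hd.
  have -> : - (2 * \tr (N s)) * y s = A' s i0 i0 + A' s i1 i1 + A' s i2 i2 - 0.
    have sW : sym_mx (B s *m E s + (E s)^T *m B s).
      by rewrite /sym_mx raddfD /= !trmx_mul trmxK (pd (oo sT)).1 addrC.
    (* By [tr_tcontr_Cof]; after multiplication by [B^-1] each half of the argument contributes
       [tr E]. *)
    have t1 : \tr (tcontr (Cof (B s)) (B s *m E s + (E s)^T *m B s)) = \tr (A s) * \tr (E s).
      rewrite tr_tcontr_Cof//; last exact: (pd (oo sT)).
      rewrite mulmxDr mxtraceD mulKmx ?posdef_unit//; last exact: (pd (oo sT)).
      rewrite mulmxA mxtrace_mulC mulKVmx ?posdef_unit//; last exact: (pd (oo sT)).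
      by rewrite mxtrace_tr /A tr_Aof; [field|exact: (pd (oo sT))].
    have : \tr (A' s) = \tr (A s) * \tr (E s) + (2 * \tr (N s) + 3 * \tr (N s) * \tr (A s)).
      by rewrite /A' mxtraceD t1 /source mxtraceD !mxtraceZ.
    rewrite {1}/mxtrace sum3E subr0 => ->; rewrite hEN// /y; ring.
  have -> : y = (fun s => A s i0 i0 + A s i1 i1 + A s i2 i2 - 1).
    by apply/funext => x; rewrite /y /mxtrace sum3E.
  exact: is_deriveB (is_deriveD (is_deriveD (hd i0 i0) (hd i1 i1)) (hd i2 i2)) (is_derive_cst _ _
    _).
have [L L0 hL] := Aof_lip m01 M0.
have cy : {within `[0, T], continuous y}.
  apply: (@within_lip _ _ _ B _ (3 * L)) => //; first by rewrite mulr_ge0.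
  move=> x z; rewrite /= !in_itv /= => xT zT.
  rewrite /y [X in `|X| <= _](_ : _ = \tr (A x - A z)); last first.
    by rewrite opprB addrA subrK [RHS]raddfB.
  apply: le_trans (norm_tr3 _) _; rewrite -mulrA ler_pM2l//.
  by apply: hL; exact: KB.
have /eqP : y T = 0; last by rewrite /y subr_eq0 => /eqP.
apply: (@decay_zero y (fun s => 2 * \tr (N s))) => //; last by rewrite /y A01 subrr.
move=> s /andP[/ltW s0 _]; apply: mulr_ge0 => //.
exact: psd_tr (posdef_psd (geI_posdef dm0 (hN s0))).
Qed.

Let P s := invmx (A s).
Let q s := \tr (P s).

(** A bound for [|A^-1|] on [K]. It serves only for differentiability and continuity of [q], never
    in the bound on [q] itself. *)
Let x := (2^-1 * ((3 * (M + 1))^-1 * rlow M))^-1.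
Let xi0 : 0 < 2^-1 * ((3 * (M + 1))^-1 * rlow M).
Proof.
apply: mulr_gt0; first by rewrite invr_gt0.
by apply: mulr_gt0; [rewrite invr_gt0 mulr_gt0// ltr_wpDl|exact: rlow_gt0].
Qed.
Let x0 : 0 <= x. Proof. by rewrite invr_ge0 ltW. Qed.
Let pA s : 0 <= s <= T -> posdef (A s). Proof. by move=> /KB/(Aof_geI m01 M0)/(geI_posdef xi0). Qed.
Let Px s : 0 <= s <= T -> `|P s| <= x.
Proof. by move=> /KB/(Aof_geI m01 M0)/(geI_inv_norm xi0). Qed.

Let kap := 63 * e.

Lemma q_derive (s : R) : 0 < s < T -> is_derive s 1 q (- \tr (P s *m A' s *m P s)).
Proof.
move=> sT; have /andP[s0 sT'] := sT; have Ks := KB (oo sT).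
have [a a0 ha] := Aof_le M m01.
pose l (X : 'M[R]_3) := - \tr (P s *m X *m P s).
apply: (@is_derive_frechet _ A s _ (fun X => \tr (invmx X)) l (27 * `|P s| ^+ 2) (3 * (81 * x ^+
  3)) (Num.min s (T - s))) => //.
- by rewrite lt_min s0 subr_gt0.
- by apply: mulr_ge0 => //; apply: mulr_ge0 => //; exact: exprn_ge0.
- by move=> b X; rewrite /l -scalemxAr -scalemxAl mxtraceZ mulrN.
- move=> X Y; rewrite /l [X in `|X| <= _](_ : _ = - \tr (P s *m (X - Y) *m P s)); last first.
    by rewrite mulmxBr mulmxBl [\tr (_ - _)]raddfB /= opprB opprK addrC.
  rewrite normrN; apply: le_trans (norm_tr_mul _ _) _.
  have := norm_mulmx3 (P s) (X - Y) => h; have := ler_wpM2r (normr_ge0 (P s)) h.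
  by rewrite expr2; lra.
- exact: Aof_derive.
- move=> h; rewrite lt_min !ltr_norml => /andP[/andP[? ?] /andP[? ?]].
  have sh : 0 <= s + h <= T by apply/andP; split; lra.
  have := @inv_quad R x _ _ (pA (oo sT)) (pA sh) (Px (oo sT)) (Px sh).
  move=> hh; rewrite /l opprK [X in `|X| <= _](_ : _ = \tr (invmx (A (s + h)) - invmx (A s)
     + P s *m (A (s + h) - A s) *m P s)); last by rewrite mxtraceD [\tr (_ - _)]raddfB.
  by apply: le_trans (norm_tr3 _) _; rewrite -[leRHS]mulrA ler_pM2l.
Qed.

(** Diffusion gives [2 tr (P N P) >= 2 dm |P|_F^2 >= (2 dm / 3) q^2]; the term [3 (tr N) q] has a
    favourable sign and is dropped; transport is [tr_CW_bound]. *)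
Lemma q_ineq s : 0 < s < T -> - \tr (P s *m A' s *m P s) <= kap * q s - 2 * dm / 3 * q s ^+ 2.
Proof.
move=> sT; have /andP[/ltW s0 _] := sT; have Ks := KB (oo sT).
have uA := posdef_unit (pA (oo sT)); have sP : (P s)^T = P s := sym_inv (pA (oo sT)).1.
have q0 : 0 <= q s := psd_tr (posdef_psd (posdef_inv (pA (oo sT)))).
have tN := psd_tr (posdef_psd (geI_posdef dm0 (hN s0))).
have h1 := tr_CW_bound m01 Ks.1 (pA (oo sT)) (hE s0).
have h2 := tr_conj_ge (P s) (hN s0); rewrite sP in h2.
have h3 := tr_sqr_le (P s).
have -> : \tr (P s *m A' s *m P s) = \tr (P s *m tcontr (Cof (B s)) (B s *m E s + (E s)^T *m B s)
  *m P s)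
   + 2 * \tr (P s *m N s *m P s) + 3 * \tr (N s) * q s.
  rewrite /A' /source !(mulmxDr, mulmxDl) !mxtraceD -!scalemxAr -!scalemxAl !mxtraceZ.
  by rewrite -/(A s) [P s *m A s]mulVmx// mul1mx addrA.
move: h1; rewrite -/(A s) -/(P s) -/(q s) ler_norml => /andP[h1 _].
have h4 := mulr_ge0 tN q0.
have h5 := ler_wpM2l (ltW dm0) h3; rewrite -/(q s) in h5.
by rewrite /kap; lra.
Qed.

(** The condition on [c0] involves [e] and [dm] but not [m] or [M], so [K] can be built from [c0]
    without circularity. *)
Lemma q_bound c0 : 0 < c0 -> 63 * e * c0 <= 2 * dm / 3 ->
  \tr (invmx (Aof (B 0))) <= c0^-1 -> \tr (invmx (Aof (B T))) <= c0^-1.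
Proof.
move=> c00 hc hq0.
have qp s : 0 <= s <= T -> 0 < q s.
  move=> sT; have pPs := posdef_inv (pA sT).
  rewrite lt_def (psd_tr (posdef_psd pPs)) andbT; apply/negP => /eqP t0.
  have h := psd_entry_tr _ _ (posdef_psd pPs); rewrite -/(P s) -/(q s) t0 in h.
  have P0 : P s = 0 by apply/matrixP => i j; rewrite [RHS]mxE; apply/eqP; rewrite -normr_le0.
  by have := posdef_det_gt0 pPs; rewrite -/(P s) P0 det0 ltxx.
have [L L0 hL] := Aof_lip m01 M0.
have cq : {within `[0, T], continuous q}.
  apply: (@within_lip _ _ _ B _ (3 * (9 * x ^+ 2 * L))) => //; first by rewrite !mulr_ge0//
    exprn_ge0.
  move=> u v; rewrite /= !in_itv /= => uT vT.
  rewrite /q [X in `|X| <= _](_ : _ = \tr (P u - P v)); last by rewrite raddfB.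
  apply: le_trans (norm_tr3 _) _; rewrite -[leRHS]mulrA ler_pM2l//.
  rewrite /P (inv_diff (posdef_unit (pA vT)) (posdef_unit (pA uT))) normrN.
  apply: le_trans (norm_mulmx3 _ _) _.
  have h1 := norm_mulmx3 (invmx (A v)) (A u - A v).
  have h2 := hL _ _ (KB vT) (KB uT).
  have h3 : `|invmx (A v) *m (A u - A v)| <= 3 * x * (L * `|B u - B v|).
    by apply: le_trans h1 _; apply: ler_pM; rewrite ?mulr_ge0// ler_pM2l//; exact: Px.
  rewrite (_ : 9 * _ * _ * _ = 3 * (3 * x * (L * `|B u - B v|)) * x); last by ring.
  by apply: ler_pM; rewrite ?mulr_ge0// ?ler_pM2l//; exact: Px.
suff : q T <= c0^-1 by [].
apply: (@riccati_bound q (fun s => - \tr (P s *m A' s *m P s)) T kap (2 * dm / 3) c0) => //.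
- exact: q_derive.
- exact: q_ineq.
Qed.

End Apriori.

(** * The flow *)

Section Flow.
Variable R : realType.

(** At the supremum of the times reached, the step would lead beyond it. At [T = 0] its premise is
    empty, so the step contains the base case. *)
Lemma real_induction (P : R -> Prop) :
  (forall T, 0 <= T -> (forall s, 0 <= s < T -> P s) ->
     exists2 e, 0 < e & forall s, 0 <= s < T + e -> P s) ->
  forall t, 0 <= t -> P t.
Proof.
move=> step t t0; apply: contrapT => nPt.
pose S := [set T | 0 <= T /\ forall s, 0 <= s < T -> P s].
have S0 : S 0 by split=> // s /andP[h1 h2]; have := le_lt_trans h1 h2; rewrite ltxx.
have St T : S T -> T <= t.
  by move=> [_ hT]; rewrite leNgt; apply/negP => tT; apply/nPt/hT; rewrite t0.
have hS : has_sup S by split; [exists 0|exists t => T /St].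
have sup0 : 0 <= sup S by exact: sup_upper_bound hS _ S0.
have [s /andP[s0 sS]|e e0 he] := step (sup S) sup0.
  have e1 : 0 < sup S - s by rewrite subr_gt0.
  have [T [_ hT] sT] := sup_adherent e1 hS.
  by apply: hT; rewrite s0; move: sT; rewrite opprB addrC subrK.
have : sup S + e <= sup S by apply: sup_upper_bound => //; split=> //; rewrite addr_ge0// ltW.
by rewrite gerDl leNgt e0.
Qed.

Lemma freeze_continuous (V : normedModType R) (f : R -> V) :
  {within `[0, +oo[, continuous f} -> continuous (fun t : R => f (Num.max t 0)).
Proof.
move=> /within_continuousP cf t; apply/cvgrPdist_lt => e e0.
have m0 s : 0 <= Num.max s (0 : R) by rewrite le_max lexx orbT.
have [d d0 hd] := cf _ (m0 t) e e0.
exists d => // s /= std; rewrite distrC; apply: hd => //.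
by apply: le_lt_trans std; rewrite [leRHS]distrC max0_lip.
Qed.

Lemma rdet_eq1 (B : 'M[R]_3) : posdef B -> rdet B = 1 -> \det B = 1.
Proof.
move=> /posdef_det_gt0 d0; rewrite /rdet => /(congr1 GRing.inv); rewrite invrK invr1 => h.
by rewrite -[LHS]sqr_sqrtr ?ltW// h expr1n.
Qed.

Variables (E N : R -> 'M[R]_3) (B0 : 'M[R]_3) (e d dm : R).
Hypothesis e0 : 0 <= e.
Hypothesis d0 : 0 <= d.
Hypothesis dm0 : 0 < dm.
Hypothesis cE : continuous E.
Hypothesis cN : continuous N.
Hypothesis hE : forall s, `|E s| <= e.
Hypothesis hN : forall s, geI dm (N s).
Hypothesis hNd : forall s, `|N s| <= d.
Hypothesis hEN : forall s, \tr (E s) = - 5 * \tr (N s).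
Hypothesis pB0 : posdef B0.
Hypothesis dB0 : \det B0 = 1.

Lemma flow : exists m M : R, [/\ 0 < m <= 1, 0 <= M & exists Y : R -> 'M[R]_3,
  [/\ Y 0 = B0, forall t : R, 0 <= t -> is_derive t 1 Y (field (E t) (N t) (Y t)),
      forall t, 0 <= t -> inK m M (Y t) & forall t, 0 <= t -> \tr (Aof (Y t)) = 1]].
Proof.
have [mi mi01 gB0] := posdef_inK pB0.
have pA0 : posdef (Aof B0) by exact: (Aof_posdef mi01 (normr_ge0 B0) (conj gB0 (lexx _))).
have q00 := psd_tr (posdef_psd (posdef_inv pA0)).
set q0 := \tr (invmx (Aof B0)) in q00.
have q1 : 0 < q0 + 1 by rewrite ltr_wpDl.
have k1 : 0 < 63 * e + 1 by rewrite ltr_wpDl// mulr_ge0.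
pose a := 2 * dm / 3; have a0 : 0 < a by rewrite divr_gt0// mulr_gt0.
(* The two entries secure the initial bound [q0 <= c^-1] and the smallness condition of [q_bound];
   the added ones keep the denominators positive. *)
pose c := Num.min (q0 + 1)^-1 (a / (63 * e + 1)).
have c0 : 0 < c by rewrite lt_min invr_gt0 q1 divr_gt0.
have kc : 63 * e * c <= a.
  have : c * (63 * e + 1) <= a by rewrite -ler_pdivlMr// ge_min lexx orbT.
  by lra.
have q0c : q0 <= c^-1.
  have : c <= (q0 + 1)^-1 by rewrite ge_min lexx.
  by rewrite -[X in X <= _]invrK lef_pV2 ?posrE ?invr_gt0// => h; lra.
pose M' := 6 * c^-1; pose m' := (6 * (M' + 1) ^+ 3)^-1.
have M'0 : 0 <= M' by rewrite mulr_ge0// invr_ge0 ltW.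
have m'0 : 0 < m' by rewrite invr_gt0 mulr_gt0// exprn_gt0// ltr_wpDl.
have m'1 : m' <= 1.
  rewrite invf_le1 ?mulr_gt0 ?exprn_gt0 ?ltr_wpDl//.
  have : 1 <= (M' + 1) ^+ 3 by rewrite exprn_ege1// lerDr.
  by lra.
(* [K'], with constants [m'] and [M'], is where the a priori bounds place the solution; [K] is
   larger by a fixed margin. *)
pose m := m' / 2; pose M := M' + 1.
have m01 : 0 < m <= 1 by rewrite /m; apply/andP; split; lra.
have M0 : 0 <= M by rewrite addr_ge0.
have K'K B : inK m' M' B -> inK m M B.
  move=> [gB nB]; split; last by apply: le_trans nB _; rewrite lerDl.
  by apply: geI_le gB; rewrite /m; lra.
have KB0 : inK m' M' B0 by exact: compact_bounds.
have P0 s B : inK m M B -> inP m M e d (E s) (N s) B.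
  by move=> KB; split=> //; case: (hN s).
have [|L L0 [F [FE Fsym FL]]] := @field_ext R m M e d m01 M0 e0 d0.
  by exists (E 0), (N 0), B0; apply/P0/K'K.
have F_lip t x y : `|F (E t) (N t) x - F (E t) (N t) y| <= L * `|x - y|.
  by have := FL (E t) (N t) y (E t) (N t) x; rewrite !subrr !normr0 !add0r.
have F_cont (X : R -> 'M[R]_3) : continuous X -> continuous (fun t : R => F (E t) (N t) (X t)).
  move=> cX t; apply/cvgrPdist_lt => ep ep0.
  have ep3 : 0 < ep / (3 * L) by rewrite divr_gt0// mulr_gt0.
  have /cvgrPdist_lt/(_ _ ep3) h1 := cX t; have /cvgrPdist_lt/(_ _ ep3) h2 := @cE t.
  have /cvgrPdist_lt/(_ _ ep3) h3 := @cN t.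
  near=> s.
  have g1 : `|X t - X s| < ep / (3 * L) by near: s.
  have g2 : `|E t - E s| < ep / (3 * L) by near: s.
  have g3 : `|N t - N s| < ep / (3 * L) by near: s.
  apply: le_lt_trans (FL _ _ _ _ _ _) _.
  rewrite mulrC -ltr_pdivlMr//.
  have -> : ep / L = ep / (3 * L) + ep / (3 * L) + ep / (3 * L) by field; rewrite gt_eqF.
  by apply: ltrD => //; apply: ltrD.
have F_bound t : `|F (E t) (N t) B0| <= `|F 0 0 B0| + L * (e + d).
  rewrite -(subrK (F 0 0 B0) (F (E t) (N t) B0)) addrC.
  apply: le_trans (ler_normD _ _) _; rewrite lerD2l.
  have := FL 0 0 B0 (E t) (N t) B0; rewrite !subr0 subrr normr0 addr0 => h.
  by apply: le_trans h _; rewrite ler_pM2l// lerD.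
have [Y [Y0 dY]] := @ode_global R (fun t => F (E t) (N t)) B0 L _ L0 F_lip F_cont F_bound.
have cY (t : R) : 0 <= t -> {for t, continuous Y} by move=> /dY/is_derive_continuous.
have cYT (T : R) : {within `[0, T], continuous Y}.
  apply/subspace_continuousP => t; rewrite /= in_itv /= => /andP[t0 _].
  by apply: cvg_within_filter; exact: cY.
(* Symmetry is part of membership in [K], so it must be known beforehand; it holds because the
   extended field has symmetric values. *)
have symY t : 0 <= t -> sym_mx (Y t).
  move=> t0; apply/matrixP => i j; rewrite mxE; apply/eqP; rewrite -subr_eq0; apply/eqP.
  apply: (@decay_zero _ (fun s => Y s j i - Y s i j) (fun=> 0) t t0) => //.
  - apply: (@within_lip _ _ _ _ Y _ 2) => // x y _ _.
    rewrite (_ : _ - _ = (Y x - Y y) j i - (Y x - Y y) i j); last by rewrite !mxBE; ring.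
    apply: le_trans (ler_normB _ _) _.
    by have := mx_entry_le (Y x - Y y) j i; have := mx_entry_le (Y x - Y y) i j; lra.
  - move=> s /andP[/ltW s0 _]; have h := (is_derive_mxP _ _ _).1 (dY s s0).
    have <- : F (E s) (N s) (Y s) j i - F (E s) (N s) (Y s) i j = - 0 * (Y s j i - Y s i j).
      by rewrite -{1}(Fsym (E s) (N s) (Y s)) mxE subrr oppr0 mul0r.
    exact: (is_deriveB (h j i) (h i j)).
  - by rewrite Y0 -{1}pB0.1 mxE subrr.
(* Staying in [K] up to time [T] already forces the solution into the smaller set [K']. *)
have apriori T : 0 <= T -> (forall s, 0 <= s <= T -> inK m M (Y s)) ->
    inK m' M' (Y T) /\ \tr (Aof (Y T)) = 1.
  move=> T0 KT.
  have dYT (s : R) : 0 < s < T -> is_derive s 1 Y (field (E s) (N s) (Y s)).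
    move=> /andP[/ltW s0 /ltW sT]; rewrite -FE; first exact: dY.
    by apply/P0/KT; rewrite s0.
  have TT : 0 <= T <= T by rewrite T0 lexx.
  have m0 : 0 < m by case/andP: m01.
  have pT := geI_posdef m0 (KT T TT).1.
  have A01 : \tr (Aof (Y 0)) = 1 by rewrite Y0 (tr_Aof pB0) /rdet dB0 sqrtr1 invr1.
  have t1 := tr_Aof_one m01 M0 dm0 T0 (fun s _ => hN s) (fun s _ => hEN s) KT (cYT T) dYT A01.
  have Q0 : \tr (invmx (Aof (Y 0))) <= c^-1 by rewrite Y0; exact: q0c.
  have qT := q_bound m01 M0 dm0 T0 (fun s _ => hE s) (fun s _ => hN s) KT (cYT T) dYT c0 kc Q0.
  have pA := Aof_posdef m01 M0 (KT T TT).
  have d1 : \det (Y T) = 1 by apply: (rdet_eq1 pT); rewrite -(tr_Aof pT); exact: t1.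
  exact: conj (compact_bounds pT pA d1 qT) t1.
have KY : forall t, 0 <= t -> inK m M (Y t).
  apply: real_induction => T T0 KT.
  have near_T ep : 0 < ep -> exists2 dl, 0 < dl & forall s, `|T - s| < dl -> `|Y T - Y s| < ep.
    move=> ep0; have /cvgrPdist_lt/(_ ep ep0)[dl /= dl0 h] := cY T T0.
    by exists dl => // s /h.
  (* [K] is closed: both bounds pass to the limit from earlier times, up to an arbitrary [ep]. *)
  have KYT : inK m M (Y T).
    have [T1|T1] := ltP 0 T; last first.
      have -> : T = 0 by apply/eqP; rewrite eq_le T1.
      by rewrite Y0; exact: K'K.
    have appr ep : 0 < ep -> exists2 s, 0 <= s < T & `|Y T - Y s| < ep.
      move=> ep0; have [dl dl0 h] := near_T ep ep0.
      pose s := Num.max (T / 2) (T - dl / 2).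
      have sT : s < T by rewrite gt_max; apply/andP; split; lra.
      have s0 : 0 <= s by rewrite le_max divr_ge0// ltW.
      have sd : T - dl / 2 <= s by rewrite le_max lexx orbT.
      exists s; first by rewrite s0.
      by apply: h; rewrite ger0_norm ?subr_ge0 ?(ltW sT)//; lra.
    split.
      split=> [|v]; first exact: symY.
      apply/ler_addgt0Pr => ep ep0.
      have n0 : 0 < 3 * nrm2 v + 1 by rewrite ltr_wpDl// mulr_ge0// nrm2_ge0.
      have [s sT hs] := appr (ep / (3 * nrm2 v + 1)) (divr_gt0 ep0 n0).
      have sH : sym_mx (Y T - Y s).
        by rewrite /sym_mx raddfB /= !symY//; case/andP: sT.
      have YE : Y s + (Y T - Y s) = Y T by rewrite addrC subrK.
      have [_ /(_ v)] := geI_perturb (KT s sT).1 sH; rewrite YE mulrBl.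
      move: hs; rewrite ltr_pdivlMr// => hs.
      by have := nrm2_ge0 v; have := normr_ge0 (Y T - Y s); nra.
    apply/ler_addgt0Pr => ep ep0; have [s sT hs] := appr ep ep0.
    rewrite -(subrK (Y s) (Y T)); apply: le_trans (ler_normD _ _) _.
    by have [_ ?] := KT s sT; lra.
  have [|[gT nT] _] := apriori T T0.
    move=> s /andP[s0]; rewrite le_eqVlt => /predU1P[->//|sT].
    by apply: KT; rewrite s0.
  (* A displacement below [m' / 6] costs at most [m' / 2] in [geI_perturb], and one below 1 costs at
     most 1 in norm: exactly the margins of [K]. *)
  have m6 : 0 < Num.min (m' / 6) 1 by rewrite lt_min ltr01 divr_gt0.
  have [dl dl0 h] := near_T _ m6.
  exists dl => // s /andP[s0 sd].
  have [sT|Ts] := ltP s T; first by apply: KT; rewrite s0.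
  have : `|T - s| < dl by rewrite distrC ger0_norm ?subr_ge0//; lra.
  move=> /h; rewrite lt_min => /andP[h1 h2].
  have sH : sym_mx (Y s - Y T) by rewrite /sym_mx raddfB /= !symY.
  split.
    have YE : Y T + (Y s - Y T) = Y s by rewrite addrC subrK.
    have := geI_perturb gT sH; rewrite YE; apply: geI_le.
    by rewrite distrC /m; lra.
  rewrite -(subrK (Y T) (Y s)); apply: le_trans (ler_normD _ _) _.
  by rewrite distrC /M; lra.
exists m, M; split=> //; exists Y; split=> //.
- by move=> t t0; rewrite -FE; [exact: dY|exact/P0/KY].
- move=> t t0; have [|_ //] := apriori t t0.
  by move=> s /andP[s0 _]; exact: KY.
Unshelve. all: by end_near. Qed.

End Flow.

Theorem theorem2 (R : realType) (lam : R)
  (Om Ga Dr : R -> 'M[R]_3) (B0 : 'M[R]_3) :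
  (* Omega antisymmetric, Gamma sym_mx traceless, both continuous and bounded on [0,oo) *)
  (forall t, 0 <= t -> (Om t)^T = - Om t) ->
  (forall t, 0 <= t -> sym_mx (Ga t) /\ \tr (Ga t) = 0) ->
  {within `[0, +oo[, continuous Om} ->
  {within `[0, +oo[, continuous Ga} ->
  (exists M : R, forall t, 0 <= t -> `|Om t| <= M) ->
  (exists M : R, forall t, 0 <= t -> `|Ga t| <= M) ->
  (* D_r sym_mx positive definite, C^1, with D_r, dD_r/dt, D_r^{-1} bounded *)
  (forall t, 0 <= t -> posdef (Dr t)) ->
  {within `[0, +oo[, continuous Dr} ->
  (forall t, 0 < t -> derivable Dr t 1) ->
  (forall t, 0 < t -> {for t, continuous (fun s => 'D_1 Dr s)}) ->
  (exists M : R, forall t, 0 <= t -> `|Dr t| <= M) ->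
  (exists M : R, forall t, 0 < t -> `|'D_1 Dr t| <= M) ->
  (exists M : R, forall t, 0 <= t -> `|invmx (Dr t)| <= M) ->
  (* initial data *)
  posdef B0 -> \det B0 = 1 ->
  exists A B : R -> 'M[R]_3,
    A 0 = Aof B0 /\ B 0 = B0 /\
    {within `[0, +oo[, continuous A} /\
    {within `[0, +oo[, continuous B} /\
    (forall t, 0 < t ->
       let W := B t *m (Om t + lam *: Ga t) + (- Om t + lam *: Ga t) *m B t in
       let BD := B t *m Dr t + Dr t *m B t in
       is_derive t 1 A
         (2^-1 *: tcontr (Cof (B t)) W + 2 *: Dr t
          + (3 * \tr (Dr t)) *: A t - 5 *: tcontr (Cof (B t)) BD) /\
       exists D, is_Dof (B t) D /\
       is_derive t 1 B
         (- (2^-1 *: W) - tcontr D (2 *: Dr t + (3 * \tr (Dr t)) *: A t)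
          + 5 *: BD)) /\
    (forall t, 0 <= t ->
       posdef (B t) /\ \det (B t) = 1 /\ A t = Aof (B t) /\
       posdef (A t) /\ \tr (A t) = 1).
Proof.
move=> antiOm symGa cOm cGa [M1 hOm] [M2 hGa] pDr cDr _ _ [M3 hDr] _ [M4 hDi] pB0 dB0.
pose E0 t := 2^-1 *: (Om t + lam *: Ga t) - 5 *: Dr t.
have cE0 : {within `[0, +oo[, continuous E0}.
  move=> t; apply: cvgB; last by apply: cvgZr; exact: cDr.
  by apply: cvgZr; apply: cvgD; [exact: cOm|apply: cvgZr; exact: cGa].
have m0 s : 0 <= Num.max s (0 : R) by rewrite le_max lexx orbT.
have M10 : 0 <= M1 := le_trans (normr_ge0 _) (hOm 0 (lexx 0)).
have M20 : 0 <= M2 := le_trans (normr_ge0 _) (hGa 0 (lexx 0)).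
have M30 : 0 <= M3 := le_trans (normr_ge0 _) (hDr 0 (lexx 0)).
have M40 : 0 <= M4 := le_trans (normr_ge0 _) (hDi 0 (lexx 0)).
pose e := 2^-1 * (M1 + `|lam| * M2) + 5 * M3.
have e0 : 0 <= e by rewrite !(addr_ge0, mulr_ge0) ?invr_ge0.
have hE s : `|E0 (Num.max s 0)| <= e.
  have := m0 s; move: (Num.max s 0) => t t0.
  apply: le_trans (ler_normB _ _) _; rewrite !normrZ !ger0_norm ?invr_ge0//.
  apply: lerD; last by rewrite ler_pM2l// hDr.
  rewrite ler_pM2l ?invr_gt0//; apply: le_trans (ler_normD _ _) _; rewrite normrZ.
  by apply: lerD; [exact: hOm|rewrite ler_wpM2l// hGa].
have t4 : 0 < 3 * M4 + 1 by rewrite ltr_wpDl// mulr_ge0.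
(* The bound on the inverse of [D_r] enters through [tr (D_r^-1) <= 3 M4] and [posdef_lower]. *)
have gDr t : 0 <= t -> geI (3 * M4 + 1)^-1 (Dr t).
  move=> t0; split=> [|v]; first exact: (pDr t t0).1.
  rewrite ler_pdivrMl//; apply: le_trans (posdef_lower v (pDr t t0)) _.
  rewrite ler_wpM2r ?(posdef_psd (pDr t t0)).2//.
  apply: le_trans (ler_norm _) _; apply: le_trans (norm_tr3 _) _.
  by have := hDi t t0; lra.
have hEN t : 0 <= t -> \tr (E0 t) = - 5 * \tr (Dr t).
  move=> t0; rewrite /E0 mxtraceD mxtraceZ -scaleNr mxtraceZ mxtraceD mxtraceZ (symGa t t0).2 mulr0
    addr0.
  have : \tr (Om t) = - \tr (Om t) by rewrite -{1}mxtrace_tr antiOm// raddfN.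
  move=> h; have tO : \tr (Om t) = 0 by lra.
  by rewrite tO mulr0 add0r.
have [m [M [m01 M0 [B [B0E dB KB trA]]]]] := @flow R (fun t => E0 (Num.max t 0))
  (fun t => Dr (Num.max t 0)) B0 e M3 (3 * M4 + 1)^-1 e0 M30 (etrans (invr_gt0 _) t4)
  (freeze_continuous cE0) (freeze_continuous cDr) hE (fun s => gDr _ (m0 s))
  (fun s => hDr _ (m0 s)) (fun s => hEN _ (m0 s)) pB0 dB0.
have dB' (t : R) : 0 <= t -> is_derive t 1 B (field (E0 t) (Dr t) (B t)).
  by move=> t0; have := dB t t0; rewrite max_l.
have mp : 0 < m by case/andP: m01.
have pB t : 0 <= t -> posdef (B t) by move=> /KB[/(geI_posdef mp)].
have cB : {within `[0, +oo[, continuous B}.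
  apply/subspace_continuousP => t; rewrite /= in_itv /= andbT => t0.
  by apply: cvg_within_filter; exact: is_derive_continuous (dB' t t0).
exists (fun t => Aof (B t)), B; split; first by rewrite B0E.
split=> //; split.
  have [L L0 hL] := Aof_lip m01 M0.
  apply: (@within_lip _ _ _ _ B _ L) => // x y; rewrite /= !in_itv /= !andbT => x0 y0.
  by apply: hL; exact: KB.
split=> //; split; last first.
  move=> t t0; split; first exact: pB.
  split; first by apply: rdet_eq1; [exact: pB|rewrite -tr_Aof; [exact: trA|exact: pB]].
  by split=> //; split; [exact: (Aof_posdef m01 M0 (KB t t0))|exact: trA].
move=> t t0 W BD; have t0' := ltW t0.
(* Transposing [E0] changes the sign of [Om] only, which reproduces the two factors of [W]. *)
have WE : B t *m E0 t + (E0 t)^T *m B t = 2^-1 *: W - 5 *: BD.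
  have -> : (E0 t)^T = 2^-1 *: (- Om t + lam *: Ga t) - 5 *: Dr t.
    rewrite -antiOm// -{1}(symGa t t0').1 -{1}(pDr t t0').1 /E0.
    by apply/matrixP => i j; rewrite !mxE.
  rewrite /E0 /W /BD mulmxBr mulmxBl -!scalemxAr -!scalemxAl.
  move: (B t *m (Om t + lam *: Ga t)) ((- Om t + lam *: Ga t) *m B t) (B t *m Dr t) (Dr t *m B t)
    => a b c d.
  by apply/matrixP => i j; rewrite !mxE; ring.
split.
  (* [Aof_derive] concerns interior times, so it is used on [[0, t + 1]]. *)
  have t1 : 0 < t < t + 1 by rewrite t0 ltrDl ltr01.
  have KBt s : 0 <= s <= t + 1 -> inK m M (B s) by move=> /andP[/KB].
  have dBt (s : R) : 0 < s < t + 1 -> is_derive s 1 B (field (E0 s) (Dr s) (B s)).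
    by move=> /andP[/ltW/dB'].
  have := Aof_derive m01 M0 gDr KBt dBt t1.
  rewrite WE /source tcontrD -scaleNr !tcontrZ.
  congr is_derive.
  move: (tcontr _ W) (tcontr _ BD) (Aof _) => a b A.
  by apply/matrixP => i j; rewrite !mxE; ring.
have [D DD DE] := is_Dof_Dop (pB t t0').
exists D; split=> //; have := dB' t t0'; congr is_derive.
rewrite /field WE -/(source (Dr t) (B t)) DE; last first.
  by apply: (source_sym m01 (KB t t0').1); exact: (pDr t t0').1.
by rewrite opprB [5 *: BD - _]addrC addrAC.
Qed.
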